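(* Assume that $h\in C([0,T],L^2(\Omega))$, $\min_{t\in[0,T]}|(h(t),1)|\ge\omega>0$ and $m\in C([0,T])$. Let $f$ be Lipschitz continuous in all variables. Then the problem (P)-(MP) (stated in the context, with initial condition $u(\cdot,0)=u_0$) has at most one solution $\langle u,K\rangle\in L^2((0,T),H^1(\Omega))\times L^2(0,T)$ with $\partial_t u\in L^2((0,T),(H^1(\Omega))^* )$.
   Context: $\Omega\subset\mathbb{R}^N$, $N\ge1$, is a bounded Lipschitz domain with boundary $\Gamma=\partial\Omega$, and $T>0$. $(\cdot,\cdot)$ and $\|\cdot\|$ are the inner product and norm of $L^2(\Omega)$ (also the duality between $(H^1(\Omega))^*$ and $H^1(\Omega)$); $(\cdot,\cdot)_\Gamma$ is the inner product of $L^2(\Gamma)$. $X^*$ is the dual of $X$. Convolution in time: $(K\ast u(\mathbf{x}))(t)=\int_0^t K(t-s)u(\mathbf{x},s)\,ds$, and likewise $(K\ast m)(t)=\int_0^tK(t-s)m(s)\,ds$. Given data: $u_0:\Omega\to\mathbb{R}$, $g:\Gamma\times[0,T]\to\mathbb{R}$, $h:\Omega\times[0,T]\to\mathbb{R}$, $m:[0,T]\to\mathbb{R}$, $f:\Omega\times[0,T]\times\mathbb{R}\times\mathbb{R}^N\to\mathbb{R}$; the abbreviation $f(u,\nabla u)$ stands for $f(\mathbf{x},t,u(\mathbf{x},t),\nabla u(\mathbf{x},t))$. The data are such that all terms below make sense (in particular $g(t)\in L^2(\Gamma)$, $u_0\in L^2(\Omega)$, and $m'$ is the derivative of $m$, in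 the sense of distributions if necessary). The inverse problem is to find $\langle u,K\rangle$ with $\partial_tu-\Delta u+K(t)h+K\ast u=f(\mathbf{x},t,u,\nabla u)$ in $\Omega\times[0,T]$, $-\nabla u\cdot\nu=g$ on $\Gamma\times[0,T]$ ($\nu$ the outward unit normal), $u(\cdot,0)=u_0$, and $\int_\Omega u(\mathbf{x},t)\,d\mathbf{x}=m(t)$ for $t\in[0,T]$. Its variational formulation, (P)-(MP), is: $u(\cdot,0)=u_0$ and, for a.e. $t\in(0,T)$, (P) $(\partial_tu,\phi)+(\nabla u,\nabla\phi)+(g,\phi)_\Gamma+K(h,\phi)+(K\ast u,\phi)=(f(u,\nabla u),\phi)$ for all $\phi\in H^1(\Omega)$; (MP) $m'+(g,1)_\Gamma+K(h,1)+K\ast m=(f(u,\nabla u),1)$. *)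

(* Defs.v *)
From HB Require Import structures.
From mathcomp Require Import all_boot all_order all_algebra.
From mathcomp Require Import all_classical all_reals all_analysis.

Set Implicit Arguments.
Unset Strict Implicit.
Unset Printing Implicit Defensive.

Import Order.TTheory GRing.Theory Num.Theory.
Import numFieldNormedType.Exports.

Local Open Scope classical_set_scope.
Local Open Scope ring_scope.

(* The library norm on 'rV[R]_n is the sup norm; it is only used for the topology
   and for Lipschitz conditions, where the choice of norm is immaterial.  Wherever
   the metric matters the Euclidean norm [enorm] below is used. *)

Definition rV_display : measure_display. Proof. exact: default_measure_display. Qed.

Section borel_rV.
Context {R : realType} {n : nat}.

Definition rV_coord (i : 'I_n) (v : 'rV[R]_n) : R := v ord0 i.

Let rV_set0 : g_sigma_preimage rV_coord set0.
Proof. exact: sigma_algebra0. Qed.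

Let rV_setC A : g_sigma_preimage rV_coord A -> g_sigma_preimage rV_coord (~` A).
Proof. exact: sigma_algebraC. Qed.

Let rV_bigcup (F : (set 'rV[R]_n)^nat) :
  (forall i, g_sigma_preimage rV_coord (F i)) ->
  g_sigma_preimage rV_coord (\bigcup_i (F i)).
Proof. exact: sigma_algebra_bigcup. Qed.

(* The sigma-algebra generated by the coordinates, i.e. the Borel one. *)
HB.instance Definition _ := @isMeasurable.Build rV_display
  'rV[R]_n (g_sigma_preimage rV_coord) rV_set0 rV_setC rV_bigcup.

Lemma measurable_rV_coord (i : 'I_n) : measurable_fun [set: 'rV[R]_n] (rV_coord i).
Proof.
move=> _ Y mY; rewrite setTI; apply: sub_sigma_algebra => /=.
rewrite -bigcup_seq/=; exists i => /=; first by rewrite mem_index_enum.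
by exists Y => //; rewrite setTI.
Qed.

Lemma measurable_fun_rV d (T : measurableType d) (f : T -> 'rV[R]_n) :
  (forall i, measurable_fun [set: T] (rV_coord i \o f)) ->
  measurable_fun [set: T] f.
Proof.
move=> mf _ A mA; rewrite setTI.
suff : g_sigma_preimage rV_coord `<=` [set B | measurable (f @^-1` B)].
  by apply; exact: mA.
apply: smallest_sub.
  split => /=.
  - by rewrite preimage_set0; exact: measurable0.
  - by move=> B mB; rewrite setTD preimage_setC; exact: measurableC.
  - by move=> F mF; rewrite preimage_bigcup; exact: bigcup_measurable.
rewrite -bigcup_seq; apply: bigcup_sub => i _ B [C mC <-] /=.
by rewrite setTI -comp_preimage -[X in measurable X]setTI; exact: mf.
Qed.

End borel_rV.

Section lebesgue_rV.
Context {R : realType}.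

Definition rV_cons n (p : R * 'rV[R]_n) : 'rV[R]_n.+1 :=
  \row_(i < n.+1) oapp (p.2 ord0) p.1 (unlift ord0 i).

Lemma measurable_rV_cons n : measurable_fun [set: R * 'rV[R]_n] (@rV_cons n).
Proof.
apply: measurable_fun_rV => i.
case: (unliftP ord0 i) => [j|] ij.
  rewrite (_ : _ \o _ = rV_coord j \o snd); last first.
    by apply/funext => p; rewrite /rV_coord /= mxE ij liftK.
  by apply: measurableT_comp => //; exact: measurable_rV_coord.
rewrite (_ : _ \o _ = fst) //.
by apply/funext => p; rewrite /rV_coord /= mxE ij unlift_none.
Qed.

Definition rV_uncons n (v : 'rV[R]_n.+1) : R * 'rV[R]_n :=
  (v ord0 ord0, \row_j v ord0 (lift ord0 j)).

Lemma measurable_rV_uncons n : measurable_fun [set: 'rV[R]_n.+1] (@rV_uncons n).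
Proof.
apply/measurable_fun_pairP; split; first exact: (measurable_rV_coord ord0).
apply: measurable_fun_rV => i.
rewrite (_ : _ \o _ = rV_coord (lift ord0 i)); first exact: measurable_rV_coord.
by apply/funext => v; rewrite /rV_coord /= mxE.
Qed.

Lemma rV_consK n : cancel (@rV_cons n) (@rV_uncons n).
Proof.
case=> x v; rewrite /rV_uncons; apply/pair_equal_spec; split; first by rewrite mxE unlift_none.
by apply/rowP => i; rewrite !mxE liftK.
Qed.

Section step.
Variables (n : nat) (mu : {sigma_finite_measure set 'rV[R]_n -> \bar R}).

Definition lebesgue_rV_step : set 'rV[R]_n.+1 -> \bar R :=
  pushforward (@lebesgue_measure R \x mu)%E (@rV_cons n).

Let step0 : lebesgue_rV_step set0 = 0%E.
Proof. by rewrite /lebesgue_rV_step /pushforward preimage_set0 measure0. Qed.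

Let step_ge0 A : (0 <= lebesgue_rV_step A)%E.
Proof. by rewrite /lebesgue_rV_step /pushforward; exact: (measure_ge0 (_ \x _)%E). Qed.

Let step_sigma_additive : semi_sigma_additive lebesgue_rV_step.
Proof.
move=> F mF tF mUF; rewrite /lebesgue_rV_step /pushforward preimage_bigcup.
have mcons A : measurable A -> measurable (@rV_cons n @^-1` A).
  by move=> mA; rewrite -[X in measurable X]setTI; exact: measurable_rV_cons.
apply: measure_semi_sigma_additive.
- by move=> k; exact: mcons.
- apply/trivIsetP => i j _ _ ij; rewrite -preimage_setI.
  by move/trivIsetP : tF => /(_ _ _ Logic.I Logic.I ij) ->; rewrite preimage_set0.
- by rewrite -preimage_bigcup; exact: mcons.
Qed.

HB.instance Definition _ := isMeasure.Build _ _ _ lebesgue_rV_step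
  step0 step_ge0 step_sigma_additive.

Let step_sigma_finite : sigma_finite setT lebesgue_rV_step.
Proof.
have /sigma_finiteP[F [FT ndF Foo]] := sigma_finiteT (@lebesgue_measure R).
have /sigma_finiteP[G [GT ndG Goo]] := sigma_finiteT mu.
exists (fun k => @rV_uncons n @^-1` (F k `*` G k)).
  apply/esym; rewrite -subTset => v _.
  have [i _ Fi] : (\bigcup_k F k) (rV_uncons v).1 by rewrite -FT.
  have [j _ Gj] : (\bigcup_k G k) (rV_uncons v).2 by rewrite -GT.
  exists (maxn i j) => //; split.
    by move: Fi; exact/subsetPset/ndF/leq_maxl.
  by move: Gj; exact/subsetPset/ndG/leq_maxr.
move=> k; have [mF Fk] := Foo k; have [mG Gk] := Goo k; split.
  rewrite -[X in measurable X]setTI; apply: measurable_rV_uncons => //.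
  exact: measurableX.
rewrite /lebesgue_rV_step /pushforward -comp_preimage.
rewrite (_ : _ \o _ = id); last by apply/funext => p /=; rewrite rV_consK.
by rewrite preimage_id product_measure1E// lte_mul_pinfty// ge0_fin_numE.
Qed.

HB.instance Definition _ := Measure_isSigmaFinite.Build _ _ _ lebesgue_rV_step
  step_sigma_finite.

End step.

(* R^n.+1 is identified with R * R^n and carries the product measure; R^0 is a
   point of mass 1. *)
Fixpoint lebesgue_rV (n : nat) : {sigma_finite_measure set 'rV[R]_n -> \bar R} :=
  if n is m.+1 then lebesgue_rV_step (lebesgue_rV m) else \d_(0 : 'rV[R]_0).

End lebesgue_rV.

Section euclidean.
Context {R : realType} {n : nat}.
Implicit Types (v w : 'rV[R]_n) (A : set 'rV[R]_n).

Definition dotrV v w : R := \sum_(i < n) v ord0 i * w ord0 i.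
Definition enorm v : R := Num.sqrt (dotrV v v).
Definition ediam A : \bar R :=
  ereal_sup [set (enorm (p.1 - p.2))%:E | p in A `*` A].

Definition rV_boundary A : set 'rV[R]_n := closure A `\` interior A.

(* Near each boundary point, Om is the strict epigraph, in some unit direction
   e, of a Lipschitz function gamma of the component orthogonal to e (only the
   values of gamma on the hyperplane orthogonal to e are used). *)
Definition bounded_lipschitz_domain (Om : set 'rV[R]_n) : Prop :=
  [/\ open Om, connected Om, Om !=set0, bounded_set Om &
    forall x, rV_boundary Om x ->
      exists (U : set 'rV[R]_n) (e : 'rV[R]_n) (gamma : 'rV[R]_n -> R),
      [/\ nbhs x U, enorm e = 1, lipschitz gamma &
        Om `&` U =
        [set y | U y /\ gamma (y - dotrV y e *: e) < dotrV y e] ] ].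

End euclidean.

(* [surface_measure] below is the (n-1)-dimensional Hausdorff measure, on its
   Caratheodory sigma-algebra. *)
Section hausdorff.
Context {R : realType} {n : nat}.
Variable d : nat.
Implicit Types A : set 'rV[R]_n.
Local Open Scope ereal_scope.

(* Volume of the ball of diameter 1 in R^d, so that the Hausdorff measure agrees
   with Lebesgue measure on d-dimensional affine subspaces. *)
Definition hausdorff_cst : \bar R :=
  lebesgue_rV d [set v : 'rV[R]_d | (enorm v <= 2^-1)%R].

(* For d = 0 a nonempty set has gauge 1, by the convention x ^+ 0 = 1. *)
Definition hausdorff_gauge (delta : R) A : \bar R :=
  if `[< A = set0 >] then 0
  else if ediam A <= delta%:E then hausdorff_cst * ediam A ^+ d else +oo.

Definition hausdorff_pre (delta : R) A : \bar R :=
  ereal_inf [set \sum_(k <oo) hausdorff_gauge delta (U k)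
            | U in [set U : (set 'rV[R]_n)^nat | A `<=` \bigcup_k U k]].

Definition hausdorff A : \bar R :=
  ereal_sup [set hausdorff_pre delta A | delta in [set delta | (0 < delta)%R]].

Let ediam_ge0 A : A <> set0 -> 0 <= ediam A.
Proof.
move=> /eqP/set0P[x Ax]; apply: ereal_sup_ubound; exists (x, x) => //=.
rewrite subrr /enorm /dotrV big1 ?sqrtr0// => i _.
by rewrite mxE mul0r.
Qed.

Let gauge0 delta : hausdorff_gauge delta set0 = 0.
Proof. by rewrite /hausdorff_gauge; case: asboolP. Qed.

Let gauge_ge0 delta A : 0 <= hausdorff_gauge delta A.
Proof.
rewrite /hausdorff_gauge; case: asboolP => // A0; case: ifPn => // _.
by apply: mule_ge0; [exact: measure_ge0 | apply/expe_ge0/ediam_ge0].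
Qed.

Let discrete := g_sigma_algebraType [set: set 'rV[R]_n].

Let hausdorff_preE delta :
  hausdorff_pre delta = mu_ext (hausdorff_gauge delta : set discrete -> \bar R).
Proof.
apply/funext => A; rewrite /hausdorff_pre /mu_ext; congr (ereal_inf (image _ _)).
apply/seteqP; split => [U AU|U [_ AU]] //; split => // i.
exact: sub_sigma_algebra.
Qed.

Let hausdorff_pre_ge0 delta A : 0 <= hausdorff_pre delta A.
Proof. by rewrite hausdorff_preE; exact: mu_ext_ge0. Qed.

Let hausdorff0 : hausdorff set0 = 0.
Proof.
rewrite /hausdorff (_ : image _ _ = [set 0]) ?ereal_sup1//.
have pre0 delta : hausdorff_pre delta set0 = 0.
  by rewrite hausdorff_preE; exact: mu_ext0.
apply/seteqP; split => [_ [delta _ <-]|_ ->] /=; first exact: pre0.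
by exists 1%R => //=.
Qed.

Let hausdorff_ge0 A : 0 <= hausdorff A.
Proof.
apply: le_trans (hausdorff_pre_ge0 1%R A) _.
by apply: ereal_sup_ubound; exists 1%R => //=.
Qed.

Let le_hausdorff : {homo hausdorff : A B / A `<=` B >-> A <= B}.
Proof.
move=> A B AB; apply: ub_ereal_sup => _ [delta d0 <-].
apply: le_trans (_ : hausdorff_pre delta B <= _).
  by rewrite hausdorff_preE; exact: le_mu_ext.
by apply: ereal_sup_ubound; exists delta.
Qed.

Let hausdorff_sigma_subadditive : sigma_subadditive hausdorff.
Proof.
move=> F; apply: ub_ereal_sup => _ [delta d0 <-].
apply: (@le_trans _ _ (\sum_(k <oo) hausdorff_pre delta (F k))).
  by rewrite hausdorff_preE; exact: mu_ext_sigma_subadditive.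
apply: lee_nneseries => k; first by move=> _ _; exact: hausdorff_pre_ge0.
by move=> _; apply: ereal_sup_ubound; exists delta.
Qed.

HB.instance Definition _ := isOuterMeasure.Build R 'rV[R]_n hausdorff
  hausdorff0 hausdorff_ge0 le_hausdorff hausdorff_sigma_subadditive.

End hausdorff.

Definition caratheodory_measure {R : realType} {T : pointedType}
    (mu : {outer_measure set T -> \bar R}) :
    {measure set (caratheodory_type mu) -> \bar R} :=
  (mu : set (caratheodory_type mu) -> \bar R).

Definition surface_measure {R : realType} (n : nat) :
    {measure set (caratheodory_type (@hausdorff R n n.-1)) -> \bar R} :=
  caratheodory_measure (@hausdorff R n n.-1).

Section L2.
Context {d} {T : measurableType d} {R : realType}.
Variables (mu : {measure set T -> \bar R}) (D : set T).

(* Elements are functions rather than classes; they are compared either almost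
   everywhere or through [L2norm]. *)
Definition L2 : set (T -> R) :=
  [set f : T -> R | measurable_fun D f /\ (\int[mu]_(x in D) (f x ^+ 2)%:E < +oo)%E].

Definition L2ip (f g : T -> R) : R := \int[mu]_(x in D) (f x * g x).

Definition L2norm (f : T -> R) : R := Num.sqrt (L2ip f f).

End L2.

Section test_functions.
Context {R : realType} {V : normedModType R}.
Implicit Types f : V -> R.

(* C^infty when V is finite-dimensional *)
Definition smooth f : Prop := forall (vs : seq V) (x : V),
  differentiable (foldr (fun v g => 'D_v g) f vs) x.

Definition test_function (D : set V) : set (V -> R) :=
  [set f | smooth f /\
    exists K, [/\ compact K, K `<=` D & forall x, ~ K x -> f x = 0] ].

End test_functions.

(* A Sobolev function v is handled together with its weak gradient, as the pair
   (v, grad v); the second component is determined a.e. by the first one. *)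
Definition sobolev_pair (R : realType) (n : nat) : Type :=
  ('rV[R]_n -> R) * ('rV[R]_n -> 'rV[R]_n).
HB.instance Definition _ (R : realType) (n : nat) :=
  GRing.Lmodule.on (sobolev_pair R n).

Section sobolev.
Context {R : realType} {n : nat}.
Variable Om : set 'rV[R]_n.
Local Notation leb := (@lebesgue_rV R n).

Definition rV_partial (i : 'I_n) (f : 'rV[R]_n -> R) : 'rV[R]_n -> R :=
  'D_(delta_mx ord0 i) f.

Definition rV_grad (f : 'rV[R]_n -> R) : 'rV[R]_n -> 'rV[R]_n :=
  fun x => \row_i rV_partial i f x.

Definition weak_gradient (v : 'rV[R]_n -> R) (Dv : 'rV[R]_n -> 'rV[R]_n) : Prop :=
  forall psi, test_function Om psi -> forall i : 'I_n,
    \int[leb]_(x in Om) (v x * rV_partial i psi x) =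
    - \int[leb]_(x in Om) (Dv x ord0 i * psi x).

Implicit Types v w : sobolev_pair R n.

Definition H1 : set (sobolev_pair R n) :=
  [set v : sobolev_pair R n | [/\ L2 leb Om v.1,
               forall i : 'I_n, L2 leb Om (fun x => v.2 x ord0 i) &
               weak_gradient v.1 v.2] ].

Definition gradip v w : R := \int[leb]_(x in Om) dotrV (v.2 x) (w.2 x).

Definition H1norm v : R := Num.sqrt (L2ip leb Om v.1 v.1 + gradip v v).

Local Notation Gam := (rV_boundary Om).
Local Notation surf := (@surface_measure R n).

(* L^2(Gam)-limit of the boundary values of smooth functions on R^n whose
   restrictions to Om converge to v in H^1(Om). *)
Definition is_trace v (tau : 'rV[R]_n -> R) : Prop :=
  L2 surf Gam tau /\
  exists p : ('rV[R]_n -> R)^nat,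
  [/\ forall k, smooth (p k),
      H1norm ((p k, rV_grad (p k)) - v) @[k --> \oo] --> 0 &
      L2norm surf Gam (p k - tau) @[k --> \oo] --> 0].

Definition trace v : 'rV[R]_n -> R := xget (fun=> 0) [set tau | is_trace v tau].

End sobolev.

Section bochner.
Context {R : realType} {V : lmodType R}.
Variables (S : set V) (nrm : V -> R).

(* Dual of the seminormed space (S, nrm), S being a subspace of V; only the
   values of a functional on S are used. *)
Definition dual : set (V -> R) :=
  [set l | (forall (a : R) v w, S v -> S w -> l (a *: v + w) = a * l v + l w) /\
           exists C : R, forall v, S v -> `|l v| <= C * nrm v].

Definition dual_norm (l : V -> R) : R :=
  sup [set `|l v| | v in [set v | S v /\ nrm v <= 1]].

Definition simple_curve (s : R -> V) : Prop :=
  exists (k : nat) (A : 'I_k -> set R) (v : 'I_k -> V),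
  [/\ forall i, measurable (A i), forall i, S (v i) &
      s = fun t => \sum_(i < k) \1_(A i) t *: v i].

Definition strongly_measurable (I : set R) (u : R -> V) : Prop :=
  exists s : (R -> V)^nat, (forall k, simple_curve (s k)) /\
    {ae @lebesgue_measure R, forall t, I t ->
      nrm (s k t - u t) @[k --> \oo] --> 0}.

Definition bochner_L2 (I : set R) : set (R -> V) :=
  [set u | [/\ {ae @lebesgue_measure R, forall t, I t -> S (u t)},
               strongly_measurable I u &
               (\int[@lebesgue_measure R]_(t in I) (nrm (u t) ^+ 2)%:E < +oo)%E] ].

Definition continuous_curve (T : R) : set (R -> V) :=
  [set u | (forall t, t \in `[0, T] -> S (u t)) /\
    forall t, t \in `[0, T] ->
      nrm (u s - u t) @[s --> within `[0, T] (nbhs t)] --> 0].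

End bochner.

Section inverse_problem.
Context {R : realType} {n : nat}.
Variables (Om : set 'rV[R]_n) (T : R).
Local Notation leb := (@lebesgue_rV R n).
Local Notation lebR := (@lebesgue_measure R).
Local Notation Gam := (rV_boundary Om).
Local Notation surf := (@surface_measure R n).
Local Notation H1' := (dual (H1 Om) (H1norm Om)).

Definition weak_derivative (m dm : R -> R) : Prop :=
  locally_integrable `]0, T[ dm /\
  forall psi, test_function `]0, T[ psi ->
    \int[lebR]_(t in `]0, T[) (m t * derive1 psi t) =
    - \int[lebR]_(t in `]0, T[) (dm t * psi t).

Definition L2_H1 : set (R -> sobolev_pair R n) :=
  bochner_L2 (H1 Om) (H1norm Om) `]0, T[.

Definition L2_H1dual : set (R -> sobolev_pair R n -> R) :=
  bochner_L2 H1' (dual_norm (H1 Om) (H1norm Om)) `]0, T[.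

(* du is the distributional derivative of u in the dual of H^1(Om), which contains
   u through the L^2(Om) inner product. *)
Definition time_derivative (u : R -> sobolev_pair R n)
    (du : R -> sobolev_pair R n -> R) : Prop :=
  forall psi, test_function `]0, T[ psi -> forall phi, H1 Om phi ->
    \int[lebR]_(t in `]0, T[) (L2ip leb Om (u t).1 phi.1 * derive1 psi t) =
    - \int[lebR]_(t in `]0, T[) (du t phi * psi t).

(* u(., 0) = u0, evaluated on the representative of u in C([0, T], L^2(Om)) *)
Definition initial_condition (u : R -> sobolev_pair R n) (u0 : 'rV[R]_n -> R) : Prop :=
  exists c : R -> 'rV[R]_n -> R,
  [/\ continuous_curve (L2 leb Om) (L2norm leb Om) T c,
      {ae lebR, forall t, t \in `]0, T[ ->
        {ae leb, forall x, Om x -> c t x = (u t).1 x}} &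
      {ae leb, forall x, Om x -> c 0 x = u0 x}].

Definition conv (K m : R -> R) (t : R) : R :=
  \int[lebR]_(s in `[0, t]) (K (t - s) * m s).

Variables (u0 : 'rV[R]_n -> R) (g h : R -> 'rV[R]_n -> R) (m dm : R -> R).
Variable f : 'rV[R]_n -> R -> R -> 'rV[R]_n -> R.

Definition source (u : R -> sobolev_pair R n) (t : R) : 'rV[R]_n -> R :=
  fun x => f x t ((u t).1 x) ((u t).2 x).

(* The representative (t, x) |-> u(x, t) is required to be jointly measurable, so
   that the pointwise convolution K * u(x) makes sense.  dm stands for m'. *)
Record solution (u : R -> sobolev_pair R n) (K : R -> R) : Prop := Solution {
  sol_u : L2_H1 u ;
  sol_meas : measurable_fun (`]0, T[ `*` Om)
    (fun z : R * 'rV[R]_n => (u z.1).1 z.2) ;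
  sol_K : L2 lebR `]0, T[ K ;
  sol_init : initial_condition u u0 ;
  sol_P : exists du, [/\ L2_H1dual du, time_derivative u du &
    {ae lebR, forall t, t \in `]0, T[ -> forall phi, H1 Om phi ->
      du t phi + gradip Om (u t) phi + L2ip surf Gam (g t) (trace Om phi)
      + K t * L2ip leb Om (h t) phi.1
      + L2ip leb Om (fun x => conv K (fun s => (u s).1 x) t) phi.1
      = L2ip leb Om (source u t) phi.1} ] ;
  sol_MP : {ae lebR, forall t, t \in `]0, T[ ->
    dm t + L2ip surf Gam (g t) (cst 1) + K t * L2ip leb Om (h t) (cst 1)
    + conv K m t = L2ip leb Om (source u t) (cst 1)}
}.

End inverse_problem.

(* Main.v *)
(** Let [u] and [K] be the differences of the two solutions, and [w] the
    difference of the time derivatives.  The boundary terms cancel, so that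
    [w = Delta u - K h - (K1 * u1 - K2 * u2) + f(u1, grad u1) - f(u2, grad u2)]
    weakly, with [K1 * u1 - K2 * u2 = K1 * u + K * u2].  Testing with [u] and
    integrating in time bounds [|u(t)|^2 + 2 int |grad u|^2] by
    [int (e (|K|^2 + |grad u|^2) + C_e (|u|^2 + its primitives))].  The
    measurement equation and [|(h, 1)| >= omega] give
    [|K|^2 <= C (int_0^t |K|^2 + |u|^2 + |grad u|^2)] pointwise, hence an integral
    bound of [|K|^2] by [|u|^2 + |grad u|^2]; choosing [e] small absorbs the
    gradient and Gronwall's lemma makes everything vanish.

    The energy inequality [|c(t)|^2 <= 2 int_0^t w(u)] for the continuous
    representative [c] of [u] is obtained without mollification in time: the weak
    derivative is integrated to increments of [c] (du Bois-Reymond), and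
    [|c(r)|^2 - |c(r - d)|^2 <= 2 (c(r) - c(r - d), c(r))] is averaged over [r] and
    divided by [d]; the backward averages of [w] are then tested against simple
    functions approximating [u]. *)

Require Import Defs.
From HB Require Import structures.
From mathcomp Require Import all_boot all_order all_algebra.
From mathcomp Require Import all_classical all_reals all_analysis.
From mathcomp Require Import measurable_realfun ring lra.
Set Implicit Arguments.
Unset Strict Implicit.
Unset Printing Implicit Defensive.
Import Order.TTheory GRing.Theory Num.Theory.
Import numFieldNormedType.Exports.
Local Open Scope classical_set_scope.
Local Open Scope ring_scope.

(** * A smooth step function *)

Section expbump.
Context {R : realType}.
Implicit Types (p : {poly R}) (k : nat) (x : R).

(** The time derivative of [u] takes values only in the dual of H^1, and [f] depends on [grad u], so
    neither equation bounds [|u|] alone at a fixed time. An inequality for the energy is enough,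
    since Gronwall's lemma uses only its upper bound. In the increment inequality the factor [c(r)]
    can be replaced, for almost every [r], by [u(r)], which lies in H^1 and is an admissible test
    vector. The averages of [w] are never shown to converge themselves: Fubini's theorem transfers
    the averaging to the set of integration, where Lebesgue's density theorem applies. The bound of
    [|K|^2] contains [|grad u|^2] with a large constant [C]. It is absorbed only after integration
    in time, with [e = 1 / (2 C)].

    Functions are representatives and the measures are not complete. Each almost everywhere
    condition is therefore made to hold everywhere, by setting the curves to zero off a Borel set of
    times of full measure. Measurability in time then comes from pointwise limits of simple
    curves. *)

Lemma is_derive_quadratic (f : R -> R) x (C : R) :
  (forall z, `|f z| <= C * (z - x) ^+ 2) -> is_derive x 1 f 0.
Proof.
move=> fC.
have fx : f x = 0.
  by apply/eqP; rewrite -normr_le0 (le_trans (fC x))// subrr expr0n mulr0.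
have cv : h^-1 *: ((f \o shift x) (h *: 1) - f x) @[h --> 0^'] --> (0 : R).
  apply/cvgr0Pnorm_le => e e0; near=> h.
  have h0 : h != 0 by near: h; exact: nbhs_dnbhs_neq.
  rewrite fx subr0 /= normrM normfV [h *: 1]mulr1.
  rewrite ler_pdivrMl ?normr_gt0//.
  rewrite (le_trans (fC _))// addrK -real_normK ?num_real// expr2 mulrA [leRHS]mulrC.
  rewrite ler_wpM2r// (@le_trans _ _ ((`|C| + 1) * `|h|))//.
    by rewrite ler_wpM2r// (le_trans (ler_norm _))// lerDl.
  rewrite -ler_pdivlMl ?ltr_wpDl// ltW//.
  near: h; apply: dnbhs0_lt.
  by rewrite mulr_gt0// invr_gt0 ltr_wpDl.
apply: DeriveDef; first by apply/cvg_ex; exists 0.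
exact/cvg_lim.
Unshelve. all: by end_near. Qed.

(** With [y = x (1 - x)] this is [p(x) y^-k exp(-1/y)]. The parameters [p] and [k] make the family
    closed under differentiation. *)
Definition expbump p k x : R :=
  if 0 < x < 1 then p.[x] * (x * (1 - x))^-1 ^+ k * expR (- (x * (1 - x))^-1)
  else 0.

(** The term of order [k + 2] of the exponential series gives [y^-k exp(-1/y) <= (k+2)! y^2], and
    [y <= |z - x|] because [x] lies outside the open interval. This gives a zero derivative at the
    endpoints 0 and 1 as well. *)
Lemma expbump_quadratic p k x : (0 < x < 1) = false ->
  exists C, forall z, `|expbump p k z| <= C * (z - x) ^+ 2.
Proof.
move=> x01.
have [M pM] : exists M : R, forall z : R, 0 < z < 1 -> `|p.[z]| <= M.
  exists (\sum_(i < size p) `|p`_i|) => z /andP[z0 z1].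
  rewrite horner_coef (le_trans (ler_norm_sum _ _ _))// ler_sum// => i _.
  rewrite normrM -[leRHS]mulr1 ler_wpM2l// normrX exprn_ile1// ger0_norm ltW//.
have M0 : 0 <= M.
  by apply: le_trans (pM 2^-1 _) => //; rewrite invr_gt0 ltr0n invf_lt1// ltr1n.
exists (M * k.+2`!%:R) => z; rewrite /expbump; case: ifPn => [z01|_]; last first.
  by rewrite normr0 mulr_ge0 ?sqr_ge0 ?mulr_ge0 ?ler0n.
have /andP[z0 z1] := z01.
set y := z * (1 - z); have y0 : 0 < y by rewrite mulr_gt0// subr_gt0.
have yx : y <= `|z - x|.
  move/negbT : x01; rewrite negb_and -!leNgt => /orP[x0|x1].
    by rewrite ger0_norm ?subr_ge0; [|rewrite (le_trans x0)// ltW]; rewrite /y; nra.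
  by rewrite ler0_norm ?subr_le0; [|rewrite (le_trans _ x1)// ltW]; rewrite /y; nra.
rewrite !normrM (ger0_norm (expR_ge0 _)) normrX (ger0_norm (_ : 0 <= y^-1)) ?invr_ge0 ?(ltW y0)//.
rewrite -!mulrA; apply: ler_pM => //.
- by rewrite mulr_ge0 ?expR_ge0// exprn_ge0// invr_ge0 ltW.
- exact: pM.
have h : 1 + y^-1 ^+ k.+2 / k.+2`!%:R <= expR y^-1.
  by apply: expR_ge1Dxn; rewrite invr_ge0 ltW.
have h' : y^-1 ^+ k.+2 / k.+2`!%:R <= expR y^-1 by rewrite (le_trans _ h)// lerDr.
rewrite expRN ler_pdivrMr ?expR_gt0//.
rewrite ler_pdivrMr ?ltr0n ?fact_gt0// in h'.
apply: (@le_trans _ _ (y ^+ 2 * y^-1 ^+ k.+2)).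
  by rewrite -[k.+2]addn2 exprD [leRHS]mulrC -mulrA -exprMn mulVf ?gt_eqF// expr1n mulr1.
apply: (@le_trans _ _ (y ^+ 2 * (expR y^-1 * k.+2`!%:R))).
  by rewrite ler_wpM2l// sqr_ge0.
have -> : y ^+ 2 * (expR y^-1 * k.+2`!%:R) = expR y^-1 * (k.+2`!%:R * y ^+ 2) by ring.
rewrite [leRHS]mulrC.
rewrite ler_wpM2l ?expR_ge0// ler_wpM2l ?ler0n//.
by rewrite -[leRHS]real_normK ?num_real// lerXn2r// ?nnegrE// ltW.
Qed.

Let Y : {poly R} := 'X * (1 - 'X).

(** Inside the interval, the product rule is put over the common factor [Y^-(k+2) exp(-1/Y)].
    Outside, the quadratic bound yields derivative 0. *)
Lemma expbump_derive p k x : is_derive x 1 (expbump p k)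
  (expbump (p^`() * Y ^+ 2 - (p * Y * Y^`()) *+ k + p * Y^`()) k.+2 x).
Proof.
have [x01|x01] := boolP (0 < x < 1); last first.
  rewrite {2}/expbump (negbTE x01).
  by have [C] := expbump_quadratic p k (negbTE x01); exact: is_derive_quadratic.
have Yx (z : R) : z * (1 - z) = Y.[z] by rewrite /Y !hornerE.
have Y0 (z : R) : 0 < z < 1 -> 0 < Y.[z].
  by rewrite -Yx => /andP[z0 z1]; rewrite mulr_gt0// subr_gt0.
have Yx0 := Y0 _ x01.
apply: (@near_eq_is_derive _ _ _
  (fun z => p.[z] * (Y.[z])^-1 ^+ k * expR (- (Y.[z])^-1))).
  have := near_in_itvoo (x01 : x \in `]0, 1[).
  by apply: filterS => z; rewrite in_itv/= /expbump Yx => ->.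
have dp q : is_derive x 1 (horner q) q^`().[x] by exact: is_derive_poly.
have dV : is_derive x 1 (fun z => (Y.[z])^-1) (- (Y.[x]) ^- 2 * Y^`().[x]).
  exact: (is_deriveV (lt0r_neq0 Yx0) (dp Y)).
have dE : is_derive x 1 (fun z => expR (- (Y.[z])^-1))
   ((Y.[x]) ^- 2 * Y^`().[x] * expR (- (Y.[x])^-1)).
  have := @is_derive1_comp _ expR (fun z => - (Y.[z])^-1) _ _ _
    (is_derive_expR _) (is_deriveN dV).
  by move=> h; apply: is_derive_eq h _; rewrite mulNr opprK mulrC.
have dX : is_derive x 1 (fun z => (Y.[z])^-1 ^+ k)
    (k%:R * (Y.[x])^-1 ^+ k.-1 * (- Y.[x] ^- 2 * Y^`().[x])).
  rewrite (_ : (fun z => _) = (fun z => (Y.[z])^-1) ^+ k :> (R -> R)).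
    exact: (is_deriveX k dV).
  by apply/funext => z; rewrite fctE.
have h := is_deriveM (is_deriveM (dp p) dX) dE.
apply: (is_derive_eq h).
have Yn := lt0r_neq0 Yx0.
rewrite /expbump x01 Yx; move: (Y) Yn => Q Qn.
rewrite !(hornerD, hornerN, hornerMn, hornerM, horner_exp) /GRing.scale/= fctE.
set y := Q.[x] in Qn *; set e := expR _; set y' := Q^`().[x]; set p' := p^`().[x].
rewrite -mulr_natl; case: k {h dX} => [|k]; rewrite ?expr0 ?exprS /=; field; exact: Qn.
Qed.

End expbump.

Section smooth_step.
Context {R : realType}.
Local Notation mu := (@lebesgue_measure R).

(** On the line the derivative in direction [v] is [v] times the ordinary one, so iterating along
    [vs] gives the product of [vs] times [F (size vs)]. *)
Lemma smooth_derive_seq (F : nat -> R -> R) :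
  (forall n (x : R), is_derive x 1 (F n) (F n.+1 x)) -> smooth (F 0%N).
Proof.
move=> dF.
have dfF n x : differentiable (F n) x.
  by apply/derivable1_diffP; case: (dF n x).
have dZ (c : R) n x : differentiable (c *: F n) x.
  by apply: differentiableZ; exact: dfF.
have fE vs : foldr (fun v g => 'D_v g) (F 0%N) vs = (\prod_(v <- vs) v) *: F (size vs).
  elim: vs => [|v vs ih]; first by rewrite big_nil scale1r.
  rewrite /= ih big_cons; apply/funext => x.
  rewrite deriveE//.
  rewrite -[v in LHS]mulr1 -[v * 1]/(v *: (1 : R)) linearZ/= -deriveE//.
  have := @is_deriveZ _ _ _ (F (size vs)) (\prod_(v <- vs) v) x 1 _ (dF _ x).
  by move=> h; rewrite derive_val; rewrite /GRing.scale/= mulrA.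
by move=> vs x; rewrite fE.
Qed.

Let b : R -> R := expbump 1 0.

Let b_ge0 (x : R) : 0 <= b x.
Proof. by rewrite /b /expbump; case: ifP => // _; rewrite hornerC expr0 !mul1r expR_ge0. Qed.

Let b_out (x : R) : ~~ (0 < x < 1) -> b x = 0.
Proof. by rewrite /b /expbump => /negbTE ->. Qed.

Let b_cont : continuous b.
Proof.
move=> x; apply: differentiable_continuous; apply/derivable1_diffP.
by have [] := expbump_derive 1 0 x.
Qed.

Let b_int D : measurable D -> mu.-integrable D (EFin \o b).
Proof.
move=> mD; apply: integrableS (measurableT) mD _ _ => //.
have -> : EFin \o b = (EFin \o b) \_ `[0, 1].
  apply/funext => x; rewrite patchE; case: ifPn => // /negP x01 /=.
  rewrite b_out//; apply/negP => /andP[x0 x1]; apply: x01.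
  by rewrite inE/= in_itv/= !ltW.
apply/(integrable_mkcond _ _).1 => //; apply: continuous_compact_integrable.
  exact: segment_compact.
by apply: continuous_subspaceT; exact: b_cont.
Qed.

Let B (x : R) : R := \int[mu]_(t in `]-oo, x]) b t.

Let BB (x y : R) : x <= y -> B y - B x = \int[mu]_(t in `]x, y]) b t.
Proof.
move=> xy; rewrite /B Rintegral_itvB//; first exact: b_int.
Qed.

Let B_nd (x y : R) : x <= y -> B x <= B y.
Proof. by move=> xy; rewrite -subr_ge0 BB//; apply: Rintegral_ge0. Qed.

Let B0 (x : R) : x <= 0 -> B x = 0.
Proof.
move=> x0; rewrite /B (@eq_Rintegral _ _ _ _ _ (cst 0)).
  by rewrite Rintegral_cst//= mul0r.
move=> y; rewrite inE/= in_itv/= => yx; rewrite b_out//.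
by rewrite negb_and -leNgt (le_trans yx).
Qed.

Let B1 (x : R) : 1 <= x -> B x = B 1.
Proof.
move=> x1; apply/eqP; rewrite -subr_eq0 BB//; apply/eqP.
rewrite (@eq_Rintegral _ _ _ _ _ (cst 0)).
  by rewrite Rintegral_cst//= mul0r.
move=> y; rewrite inE/= in_itv/= => /andP[y1 yx]; rewrite b_out//.
by rewrite negb_and -!leNgt (ltW y1) orbT.
Qed.

Let B_ge0 (x : R) : 0 <= B x. Proof. exact: Rintegral_ge0. Qed.

Let B_derive (x : R) : is_derive x 1 B (b x).
Proof.
have xu : x < x + 1 by rewrite ltrDl.
have [dB B'] := @continuous_FTC1 R b (BInfty _ true) x (x + 1) xu
  (b_int (measurable_itv _)) (ltNyr x) (@b_cont x).
by apply: DeriveDef; [exact: dB|rewrite -derive1E B'].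
Qed.

(** Otherwise the monotone function [B] would vanish identically, and so would its derivative at
    1/2, where the bump is positive. *)
Let B1_gt0 : 0 < B 1.
Proof.
rewrite lt_neqAle B_ge0 andbT; apply/eqP => B10.
have B_eq0 : B = cst 0.
  apply/funext => x; apply/eqP; rewrite eq_le B_ge0 andbT B10.
  have [x1|/ltW x1] := leP 1 x; first by rewrite (B1 x1).
  exact: B_nd.
have := B_derive 2^-1; rewrite B_eq0 => -[_].
rewrite derive_cst /b /expbump => /esym/eqP; apply/negP.
rewrite ifT; last by rewrite invr_gt0 ltr0n invf_lt1// ltr1n.
by rewrite hornerC expr0 !mul1r gt_eqF// expR_gt0.
Qed.

(** [Phi 0] is the primitive of the bump divided by its total mass. The whole sequence of
    derivatives is recorded so that smoothness can be carried through affine changes of variable. *)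
Lemma smooth_step : exists Phi : nat -> R -> R,
  [/\ forall n (x : R), is_derive x 1 (Phi n) (Phi n.+1 x),
      forall x, x <= 0 -> Phi 0%N x = 0,
      forall x, 1 <= x -> Phi 0%N x = 1,
      forall x, 0 <= Phi 0%N x <= 1 &
      forall x, 0 <= Phi 1%N x /\ (~~ (0 < x < 1) -> Phi 1%N x = 0)].
Proof.
have [beta [beta0 dbeta]] : exists beta : nat -> R -> R,
    beta 0%N = b /\ forall n (x : R), is_derive x 1 (beta n) (beta n.+1 x).
  (* The polynomial and the exponent of the next derivative, as given by [expbump_derive]. *)
  pose next (pk : {poly R} * nat) : {poly R} * nat :=
    let Y := 'X * (1 - 'X) in
    (pk.1^`() * Y ^+ 2 - (pk.1 * Y * Y^`()) *+ pk.2 + pk.1 * Y^`(), pk.2.+2).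
  pose pk n := iter n next (1, 0%N).
  exists (fun n => expbump (pk n).1 (pk n).2); split => // n x.
  exact: expbump_derive.
exists (fun n => if n is m.+1 then (B 1)^-1 *: beta m else (B 1)^-1 *: B); split => [[|n] x|x x0|x x1|x|x].
- rewrite beta0; exact: (is_deriveZ _ (B_derive x)).
- exact: (is_deriveZ _ (dbeta n x)).
- by rewrite /= fctE/= (B0 x0) scaler0.
- by rewrite /= fctE/= (B1 x1) /GRing.scale/= mulVf// gt_eqF.
- rewrite /= fctE/= /GRing.scale/= mulr_ge0 ?invr_ge0 ?(ltW B1_gt0)//=.
  rewrite ler_pdivrMl// mulr1.
  have [x1|/ltW x1] := leP 1 x; first by rewrite (B1 x1).
  exact: B_nd.
- rewrite /= fctE/= beta0 /GRing.scale/=; split.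
    by rewrite mulr_ge0 ?invr_ge0 ?(ltW B1_gt0).
  by move=> /b_out ->; rewrite mulr0.
Qed.

End smooth_step.

(** * Almost everywhere comparison and real-valued integrals *)

Section integral_tools.
Context d (T : measurableType d) (R : realType) (mu : {measure set T -> \bar R}).
Implicit Types (D : set T).

Import HBNNSimple.

Lemma ae_imply (P Q : T -> Prop) :
  {ae mu, forall x, P x} -> (forall x, P x -> Q x) -> {ae mu, forall x, Q x}.
Proof. by move=> aeP PQ; apply: filterS aeP. Qed.

Lemma ae_and (P Q : T -> Prop) : {ae mu, forall x, P x} -> {ae mu, forall x, Q x} ->
  {ae mu, forall x, P x /\ Q x}.
Proof. by move=> aeP aeQ; apply: filterS2 aeP aeQ. Qed.

(* [f] and [g] need not be measurable: the measures used here are not complete, so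
   that measurability is not preserved by almost everywhere equality. *)
Lemma ae_ge0_le_integral_nonmeasurable D (f g : T -> \bar R) :
  (forall x, D x -> (0 <= f x)%E) -> (forall x, D x -> (0 <= g x)%E) ->
  {ae mu, forall x, D x -> (f x <= g x)%E} ->
  (\int[mu]_(x in D) f x <= \int[mu]_(x in D) g x)%E.
Proof.
move=> f0 g0 [N [mN N0 fgN]].
rewrite !ge0_integralE//; apply: ub_ereal_sup => _ [h /= hf <-].
(* A simple function below [f] is cut off on the null set [N]: its integral is unchanged, and it now
   lies below [g] everywhere. *)
pose h' := mul_nnsfun h (indic_nnsfun R (measurableC mN)).
have hh' : sintegral mu h = sintegral mu h'.
  rewrite -!integralT_nnsfun; apply: ge0_ae_eq_integral => //.
  - exact/measurable_EFinP.
  - exact/measurable_EFinP.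
  - by move=> x _; rewrite lee_fin.
  - by move=> x _; rewrite lee_fin.
  exists N; split => // x /= hx; apply: contrapT => xN; apply: hx => _.
  by congr EFin; change (h x = h x * \1_(~` N) x); rewrite indicE mem_set// mulr1.
rewrite hh'; apply: ereal_sup_ubound; exists h' => //= x.
change ((h x * \1_(~` N) x)%:E <= (g \_ D) x)%E; rewrite indicE in_setC.
have [xN|xN] := boolP (x \in N) => /=.
  by rewrite mulr0 patchE; case: ifPn => //; rewrite inE => /g0.
rewrite mulr1 (le_trans (hf x))// !patchE; case: ifPn => //; rewrite inE => Dx.
apply: contrapT => fgx; move/negP: xN; apply; rewrite inE; apply: fgN => /=.
by move=> /(_ Dx).
Qed.

Lemma ae_eq_integral_nonmeasurable D (f g : T -> \bar R) :
  {ae mu, forall x, D x -> f x = g x} ->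
  (\int[mu]_(x in D) f x = \int[mu]_(x in D) g x)%E.
Proof.
move=> fg; rewrite integralE [RHS]integralE.
congr (_ - _)%E; apply/eqP; rewrite eq_le; apply/andP; split;
  apply: ae_ge0_le_integral_nonmeasurable => //; try (by move=> x _; exact: funepos_ge0);
  try (by move=> x _; exact: funeneg_ge0);
  apply: filterS fg => x fg /fg; rewrite ?(funeposE, funenegE) => -> //.
Qed.

Lemma ae_eq_Rintegral D (f g : T -> R) :
  {ae mu, forall x, D x -> f x = g x} ->
  \int[mu]_(x in D) f x = \int[mu]_(x in D) g x.
Proof.
move=> fg; congr fine; apply: ae_eq_integral_nonmeasurable.
by apply: filterS fg => x fg /fg ->.
Qed.

Lemma dominated_integrable_real D (f g : T -> R) : measurable D ->
  measurable_fun D f -> mu.-integrable D (EFin \o g) ->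
  (forall x, D x -> `|f x| <= g x) -> mu.-integrable D (EFin \o f).
Proof.
move=> mD mf ig fg; apply: le_integrable ig => //; first exact/measurable_EFinP.
by move=> x Dx /=; rewrite lee_fin (le_trans (fg x Dx))// ler_norm.
Qed.

Lemma integrableD_real D (f g : T -> R) : measurable D ->
  mu.-integrable D (EFin \o f) -> mu.-integrable D (EFin \o g) ->
  mu.-integrable D (EFin \o (fun x => f x + g x)).
Proof. by move=> mD i i'; exact: integrableD i i'. Qed.

Lemma integrableZ_real D (k : R) (f : T -> R) : measurable D ->
  mu.-integrable D (EFin \o f) -> mu.-integrable D (EFin \o (fun x => k * f x)).
Proof. by move=> mD i; exact: integrableZl i. Qed.

Lemma integrable_sum_real D n (f : 'I_n -> T -> R) : measurable D ->
  (forall i, mu.-integrable D (EFin \o f i)) ->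
  mu.-integrable D (EFin \o (fun x => \sum_(i < n) f i x)).
Proof.
move=> mD fi; have := integrable_sum mD (index_enum 'I_n) (P := xpredT) (fun i _ => fi i).
by apply: eq_integrable => // x _ /=; rewrite sumEFin.
Qed.

Lemma Rintegral_sum D n (f : 'I_n -> T -> R) : measurable D ->
  (forall i, mu.-integrable D (EFin \o f i)) ->
  \int[mu]_(x in D) (\sum_(i < n) f i x) = \sum_(i < n) \int[mu]_(x in D) f i x.
Proof.
move=> mD; elim: n f => [|n IH] f fi.
  rewrite big_ord0 (@eq_Rintegral _ _ _ _ _ (cst 0)) ?Rintegral_cst ?mul0r//.
  by move=> x _; rewrite big_ord0.
under eq_Rintegral do rewrite big_ord_recr/=.
rewrite RintegralD//; last exact: integrable_sum_real.
by rewrite IH// big_ord_recr.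
Qed.

Lemma dominated_cvg_Rintegral D (f_ : nat -> T -> R) (f g : T -> R) :
  measurable D -> (forall n, measurable_fun D (f_ n)) -> measurable_fun D f ->
  mu.-integrable D (EFin \o g) -> (forall n x, D x -> `|f_ n x| <= g x) ->
  {ae mu, forall x, D x -> f_ n x @[n --> \oo] --> f x} ->
  \int[mu]_(x in D) f_ n x @[n --> \oo] --> \int[mu]_(x in D) f x.
Proof.
move=> mD mf_ mf ig fg f_f.
have [||||/=] := @dominated_convergence _ _ _ mu D mD (fun n => EFin \o f_ n)
  (EFin \o f) (EFin \o g) _ _ _ ig _.
- by move=> n; exact/measurable_EFinP.
- exact/measurable_EFinP.
- apply: filterS f_f => x f_f /f_f h; apply: cvg_EFin => //.
  by apply: nearW => n.
- by apply: aeW => x n Dx /=; rewrite lee_fin fg.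
move=> iF _ cv; apply: fine_cvg; rewrite fineK //.
exact: integrable_fin_num.
Qed.

End integral_tools.

(** * The du Bois-Reymond lemma *)

Section du_bois_reymond.
Context {R : realType}.
Local Notation mu := (@lebesgue_measure R).
Variable Phi : nat -> R -> R.
Hypothesis dPhi : forall n (x : R), is_derive x 1 (Phi n) (Phi n.+1 x).
Hypothesis Phi_le0 : forall x, x <= 0 -> Phi 0%N x = 0.
Hypothesis Phi_ge1 : forall x, 1 <= x -> Phi 0%N x = 1.
Hypothesis Phi01 : forall x, 0 <= Phi 0%N x <= 1.
Hypothesis Phi1 : forall x, 0 <= Phi 1%N x /\ (~~ (0 < x < 1) -> Phi 1%N x = 0).

Lemma is_derive_affine (f : R -> R) (a e df x : R) :
  is_derive ((x - a) / e) 1 f df ->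
  is_derive x 1 (fun z => f ((z - a) / e)) (e^-1 * df).
Proof.
move=> fd.
have da : is_derive x 1 (fun z : R => (z - a) / e) e^-1.
  have h : is_derive x 1 (e^-1 *: (id - cst a)) (e^-1 *: (1 - 0)).
    exact: is_deriveZ.
  rewrite (_ : (fun z => _) = e^-1 *: (id - cst a)).
    by apply: (is_derive_eq h); rewrite subr0 /GRing.scale/= mulr1.
  by apply/funext => z; rewrite !fctE mulrC.
have := @is_derive1_comp _ f (fun z : R => (z - a) / e) x _ _ fd da.
by rewrite mulrC.
Qed.

Lemma continuous_Phi_affine n (a e : R) : continuous (fun x => Phi n ((x - a) / e)).
Proof.
move=> x; apply: differentiable_continuous; apply/derivable1_diffP.
by have [] := is_derive_affine (dPhi n ((x - a) / e)).
Qed.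

Lemma integral_step_derive (a e T : R) : 0 < e -> 0 <= a -> a + e <= T ->
  \int[mu]_(x in `]0, T[) (e^-1 * Phi 1%N ((x - a) / e)) = 1.
Proof.
move=> e0 a0 aeT.
have T0 : 0 < T by rewrite (lt_le_trans _ aeT)// ltr_wpDl.
have kc : continuous (fun x => e^-1 * Phi 1%N ((x - a) / e)).
  by move=> x; apply: cvgM; [exact: cvg_cst|exact: continuous_Phi_affine].
rewrite /Rintegral -(@integral_itv_bndoo _ _ _ _ true false); last first.
  apply/measurable_EFinP; apply: measurable_funTS.
  exact: continuous_measurable_fun.
rewrite (@continuous_FTC2 _ _ (fun x => Phi 0%N ((x - a) / e)))//.
- rewrite Phi_ge1; last by rewrite ler_pdivlMr// mul1r lerBrDl.
  rewrite Phi_le0 ?sube0//.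
  by rewrite sub0r mulNr oppr_le0 divr_ge0// ltW.
- exact: continuous_subspaceT.
- have c0 := @continuous_Phi_affine 0%N a e.
  split.
  + by move=> x _; have [] := is_derive_affine (dPhi 0%N ((x - a) / e)).
  + exact: cvg_at_right_filter (c0 _).
  + exact: cvg_at_left_filter (c0 _).
- move=> x _; rewrite derive1E.
  by have [_ ->] := is_derive_affine (dPhi 0%N ((x - a) / e)).
Qed.

(** The weight is nonnegative, has mass 1 and vanishes off [[a, a + e]], so the integral is a mean
    of values of [F] on this window. *)
Lemma step_average (F : R -> R) (a e T c eta : R) : 0 < e -> 0 <= a -> a + e <= T ->
  continuous F -> (forall x, a <= x <= a + e -> `|F x - c| <= eta) ->
  `|\int[mu]_(x in `]0, T[) (F x * (e^-1 * Phi 1%N ((x - a) / e))) - c| <= eta.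
Proof.
move=> e0 a0 aeT Fc FE.
set k := fun x => e^-1 * Phi 1%N ((x - a) / e).
have kc : continuous k.
  by move=> x; apply: cvgM; [exact: cvg_cst|exact: continuous_Phi_affine].
have k0 x : 0 <= k x by rewrite mulr_ge0 ?invr_ge0 ?(ltW e0)//; case: (Phi1 ((x - a) / e)).
have k1 : \int[mu]_(x in `]0, T[) k x = 1 by exact: integral_step_derive.
have cint (f : R -> R) : continuous f -> mu.-integrable `]0, T[ (EFin \o f).
  move=> fc; apply: (@integrableS _ _ R mu `[0, T]) => //; first exact: subset_itv_oo_cc.
  apply: continuous_compact_integrable; first exact: segment_compact.
  exact: continuous_subspaceT.
have -> : c = \int[mu]_(x in `]0, T[) (c * k x).
  by rewrite RintegralZl// ?k1 ?mulr1//; exact: cint.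
rewrite -RintegralB//; last 2 first.
- by apply: cint => x; apply: cvgM; [exact: Fc|exact: kc].
- by apply: cint => x; apply: cvgM; [exact: cvg_cst|exact: kc].
have cFk : continuous (fun x => F x * k x - c * k x).
  move=> x; apply: cvgB; apply: cvgM; [exact: Fc|exact: kc|exact: cvg_cst|exact: kc].
apply: le_trans (le_normr_Rintegral _ _) _ => //; first exact: cint.
rewrite -[leRHS]mulr1 -k1 -RintegralZl//; last exact: cint.
apply: le_Rintegral => //.
- by apply: cint => x; apply: cvg_norm; exact: cFk.
- by apply: cint => x; apply: cvgM; [exact: cvg_cst|exact: kc].
move=> x _; rewrite -mulrBl normrM (ger0_norm (k0 x)).
have [xa|xa] := boolP (a <= x <= a + e); first by rewrite ler_wpM2r// FE.
rewrite (_ : k x = 0) ?mulr0//.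
rewrite /k; case: (Phi1 ((x - a) / e)) => _ ->; rewrite ?mulr0//.
apply: contra xa => /andP[]; rewrite ltr_pdivlMr// mul0r subr_gt0 => /ltW -> /=.
by rewrite ltr_pdivrMr// mul1r ltrBlDl => /ltW.
Qed.

(* The test function climbs from 0 to 1 on [s + e, s + 2e] and back to 0 on
   [t - 2e, t - e]; its derivative tends to the difference of the Dirac masses at
   [s] and [t]. *)
Lemma step_test_function (s t e T : R) : 0 < e -> 0 <= s -> s + e *+ 3 <= t -> t <= T ->
  let psi x := Phi 0%N ((x - (s + e)) / e) - Phi 0%N ((x - (t - e *+ 2)) / e) in
  test_function `]0, T[ psi /\
  forall x, derive1 psi x = e^-1 * Phi 1%N ((x - (s + e)) / e) -
                        e^-1 * Phi 1%N ((x - (t - e *+ 2)) / e).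
Proof.
move=> e0 s0 st tT psi.
have dpsi n (x : R) : is_derive x 1
    (fun z => e^-1 ^+ n * Phi n ((z - (s + e)) / e) - e^-1 ^+ n * Phi n ((z - (t - e *+ 2)) / e))
    (e^-1 ^+ n.+1 * Phi n.+1 ((x - (s + e)) / e) - e^-1 ^+ n.+1 * Phi n.+1 ((x - (t - e *+ 2)) / e)).
  rewrite !exprSr -!mulrA.
  have h a := is_deriveZ (e^-1 ^+ n) (is_derive_affine (dPhi n ((x - a) / e))).
  exact: (is_deriveB (h (s + e)) (h (t - e *+ 2))).
have psiE : psi = fun z => e^-1 ^+ 0 * Phi 0%N ((z - (s + e)) / e) -
    e^-1 ^+ 0 * Phi 0%N ((z - (t - e *+ 2)) / e).
  by apply/funext => z; rewrite expr0 !mul1r.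
split; last first.
  move=> x; rewrite derive1E psiE; have [_ ->] := dpsi 0%N x.
  by rewrite expr1.
split.
  rewrite psiE; exact: (@smooth_derive_seq _ (fun n z =>
    e^-1 ^+ n * Phi n ((z - (s + e)) / e) - e^-1 ^+ n * Phi n ((z - (t - e *+ 2)) / e))).
exists `[s + e, t - e]%classic; split.
- exact: segment_compact.
- move=> x /=; rewrite !in_itv/= => /andP[x1 x2].
  by rewrite (lt_le_trans _ x1) ?(le_lt_trans x2)//; lra.
- move=> x /=; rewrite in_itv/= => /negP; rewrite negb_and -!ltNge => /orP[xs|xt].
    rewrite /psi !Phi_le0 ?subrr// pmulr_lle0 ?invr_gt0//; first lra.
    by move: st; rewrite !mulrS mulr0n; lra.
  rewrite /psi !Phi_ge1 ?subrr// ler_pdivlMr// mul1r; move: st; rewrite !mulrS mulr0n; lra.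
Qed.

(** The steep step functions converge pointwise to the indicator of []s, t[], which settles the side
    of [W] by domination. On the side of [F] their derivatives average [F] near [t] and near [s],
    where continuity applies. *)
Lemma du_bois_reymond_step (F W : R -> R) (T : R) : continuous F ->
  mu.-integrable `]0, T[ (EFin \o W) ->
  (forall psi, test_function `]0, T[ psi ->
    \int[mu]_(t in `]0, T[) (F t * derive1 psi t) = - \int[mu]_(t in `]0, T[) (W t * psi t)) ->
  forall s t : R, 0 <= s -> s <= t -> t <= T -> F t - F s = \int[mu]_(r in `]s, t[) W r.
Proof.
move=> Fc iW FW s t s0; rewrite le_eqVlt => /predU1P[->|st] tT.
  by rewrite subrr set_itvoo0 Rintegral_set0.
(* With [e <= (t - s) / 3] both ramps lie in [[s + e, t - e]], and so does the support of
   [psi n]. *)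
pose e (n : nat) : R := (t - s) / 3 / n.+1%:R.
have e0 n : 0 < e n by rewrite !divr_gt0// ?subr_gt0.
have e3 n : s + e n *+ 3 <= t.
  rewrite -lerBrDl -mulr_natr /e mulrAC mulrVK ?unitfE//.
  by rewrite ler_pdivrMr// ler_peMr ?ler1n// subr_ge0 ltW.
have e_cvg : e n @[n --> \oo] --> 0.
  rewrite /e -[X in _ --> X](mulr0 ((t - s) / 3)); apply: cvgM; first exact: cvg_cst.
  exact: cvg_harmonic.
pose psi n x := Phi 0%N ((x - (s + e n)) / e n) - Phi 0%N ((x - (t - e n *+ 2)) / e n).
have psiT n := step_test_function (e0 n) s0 (e3 n) tT.
have intW : \int[mu]_(x in `]0, T[) (W x * psi n x) @[n --> \oo] -->
    \int[mu]_(x in `]0, T[) (W x * \1_(`]s, t[) x).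
  have mW : measurable_fun `]0, T[ W by apply/measurable_EFinP; exact: measurable_int iW.
  have mpsi n : measurable_fun `]0, T[ (psi n).
    apply: measurable_funTS; apply: continuous_measurable_fun => x.
    by apply: cvgB; exact: continuous_Phi_affine.
  apply: (@dominated_cvg_Rintegral _ _ R mu `]0, T[ (fun n x => W x * psi n x)
    (fun x => W x * \1_(`]s, t[) x) (fun x => `|W x|)) => //.
  - by move=> n; apply: measurable_funM; [exact: mW|exact: mpsi].
  - by apply: measurable_funM => //; exact: measurable_indic.
  - exact: (integrable_norm iW).
  - move=> n x _; rewrite normrM ler_piMr// ler_norml /psi.
    have := Phi01 ((x - (s + e n)) / e n); have := Phi01 ((x - (t - e n *+ 2)) / e n); lra.
  - apply: aeW => x _; apply: cvgM; first exact: cvg_cst.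
    rewrite indicE; have [|] := boolP (x \in _); rewrite ?inE/= ?notin_setE/= in_itv/=.
      move=> /andP[sx xt]; apply: cvg_near_cst.
      have d0 : 0 < Num.min (x - s) (t - x) / 2 by rewrite divr_gt0// lt_min !subr_gt0 sx.
      apply: filterS ((cvgr0Pnorm_lt _).1 e_cvg _ d0) => n.
      rewrite ger0_norm ?ltW// ltr_pdivlMr// lt_min => /andP[h1 h2].
      rewrite /psi Phi_ge1 ?Phi_le0 ?subr0//.
        by rewrite pmulr_lle0 ?invr_gt0// mulr2n; lra.
      by rewrite ler_pdivlMr// mul1r; lra.
    move=> /negP; rewrite negb_and -!leNgt => xst; apply: cvg_near_cst.
    apply: nearW => n; rewrite /psi; have := e3 n; have := e0 n; rewrite !mulrS mulr0n addr0 => e0n e3n.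
    case/orP: xst => xst.
      by rewrite !Phi_le0 ?subr0// pmulr_lle0 ?invr_gt0//; lra.
    by rewrite !Phi_ge1 ?subrr// ler_pdivlMr// mul1r; lra.
have <- : \int[mu]_(x in `]0, T[) (W x * \1_(`]s, t[) x) = \int[mu]_(r in `]s, t[) W r.
  have E : `]0, T[ `&` `]s, t[ = `]s, t[%classic :> set R.
    rewrite setIidr// => x /=; rewrite !in_itv/= => /andP[sx xt].
    by rewrite (le_lt_trans s0)// (lt_le_trans xt).
  rewrite -[in RHS]E Rintegral_mkcondr; apply: eq_Rintegral => x _.
  by rewrite patchE indicE; case: (x \in _); rewrite ?mulr1 ?mulr0.
have FWn n : \int[mu]_(x in `]0, T[) (W x * psi n x) =
    \int[mu]_(x in `]0, T[) (F x * ((e n)^-1 * Phi 1%N ((x - (t - e n *+ 2)) / e n))) -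
    \int[mu]_(x in `]0, T[) (F x * ((e n)^-1 * Phi 1%N ((x - (s + e n)) / e n))).
  have [ptest pd] := psiT n.
  rewrite -[LHS]opprK -(FW _ ptest).
  have cint (a : R) : mu.-integrable `]0, T[ (EFin \o (fun x => F x * ((e n)^-1 * Phi 1%N ((x - a) / e n)))).
    apply: (@integrableS _ _ R mu `[0, T]) => //; first exact: subset_itv_oo_cc.
    apply: continuous_compact_integrable; first exact: segment_compact.
    apply: continuous_subspaceT => x; apply: cvgM; first exact: Fc.
    by apply: cvgM; [exact: cvg_cst|exact: continuous_Phi_affine].
  under eq_Rintegral do rewrite pd mulrBr.
  by rewrite RintegralB// opprB.
apply/eqP; rewrite -subr_eq0 -normr_le0; apply/ler_addgt0Pr => eta eta0.
(* One third each for the average near [s], the average near [t] and the integral of [W]. *)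
have eta3 : 0 < eta / 3 by rewrite divr_gt0.
have Fs : \forall x \near s, `|F s - F x| < eta / 3 by apply: (@cvgrPdist_lt _ R^o _ _ _ _ _).1 (Fc s) _ eta3.
have Ft : \forall x \near t, `|F t - F x| < eta / 3 by apply: (@cvgrPdist_lt _ R^o _ _ _ _ _).1 (Fc t) _ eta3.
have [d1 /= d10 Fs'] := Fs; have [d2 /= d20 Ft'] := Ft.
near \oo => n.
have en : e n < Num.min d1 d2 / 2.
  rewrite -[e n]ger0_norm ?ltW//.
  near: n; apply: (cvgr0Pnorm_lt _).1 e_cvg _ _.
  by rewrite divr_gt0// lt_min d10.
have enn := e0 n; have e3n := e3 n; rewrite !mulrS mulr0n addr0 in e3n.
rewrite ltr_pdivlMr// lt_min in en; case/andP: en => en1 en2.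
have h1 := @step_average F (s + e n) (e n) T (F s) (eta / 3) enn.
have h2 := @step_average F (t - e n *+ 2) (e n) T (F t) (eta / 3) enn.
have hW : `|\int[mu]_(x in `]0, T[) (W x * \1_(`]s, t[) x) -
   \int[mu]_(x in `]0, T[) (W x * psi n x)| < eta / 3.
  by near: n; apply: (@cvgrPdist_lt _ R^o _ _ _ _ _).1 intW _ eta3.
rewrite mulr2n in h2.
have {}h1 := h1 ltac:(lra) ltac:(lra) Fc.
have {}h2 := h2 ltac:(lra) ltac:(lra) Fc.
have {}h1 := h1 ltac:(move=> x xs; rewrite distrC ltW//; apply: Fs'; rewrite /ball_/= ltr_norml; lra).
have {}h2 := h2 ltac:(move=> x xs; rewrite distrC ltW//; apply: Ft'; rewrite /ball_/= ltr_norml; lra).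
rewrite FWn mulr2n in hW.
move: h1 h2 hW.
set A := Rintegral _ _ _; set B := Rintegral _ _ _; set C := Rintegral _ _ _.
rewrite ler_norml => /andP[? ?]; rewrite ler_norml => /andP[? ?].
rewrite ltr_norml => /andP[? ?].
rewrite add0r ler_norml; lra.
Unshelve. all: by end_near. Qed.

End du_bois_reymond.

(** * Steklov averages *)

Section steklov.
Context {R : realType}.
Local Notation mu := (@lebesgue_measure R).
Implicit Types (A : set R) (W E : R -> R).

Definition backward_average (W : R -> R) (e r : R) : R :=
  e^-1 * \int[mu]_(q in `]r - e, r[) W q.

(** Pairs [(r, q)] with [q] in the backward window of [r], equivalently [r] in the forward window of
    [q]. The two readings are [stripE] and [stripE']. *)
Let strip (e : R) : set (R * R) := [set z | z.1 - e < z.2 < z.1].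

Let measurable_strip e : measurable (strip e).
Proof.
have -> : strip e = (fun z : R * R => (z.1 - e < z.2) && (z.2 < z.1)) @^-1` [set true].
  by apply/seteqP; split => z /=.
rewrite -[X in measurable X]setTI.
have mf : measurable_fun [set: R * R] (fun z : R * R => (z.1 - e < z.2) && (z.2 < z.1)).
  apply: measurable_and.
    by apply: measurable_fun_ltr => //; apply: measurable_funB.
  exact: measurable_fun_ltr.
exact: mf.
Qed.

Let stripE e r q : (\1_(strip e) (r, q) : R) = \1_(`]r - e, r[) q.
Proof.
by rewrite !indicE; congr (nat_of_bool _)%:R; apply/idP/idP; rewrite !inE/= in_itv.
Qed.

Let stripE' e r q : (\1_(strip e) (r, q) : R) = \1_(`]q, q + e[) r.
Proof.
rewrite !indicE; congr (nat_of_bool _)%:R.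
by apply/idP/idP; rewrite !inE /strip /= in_itv/= => /andP[h1 h2]; apply/andP; split; lra.
Qed.

Let measure_window A (q e : R) : 0 < e -> measurable A ->
  (mu (A `&` `]q, (q + e)%R[) <= e%:E)%E.
Proof.
move=> e0 mA; rewrite (@le_trans _ _ (mu `]q, q + e[))//.
  by apply: le_measure; rewrite ?inE//; exact: measurableI.
by rewrite lebesgue_measure_itv/= lte_fin ltrDl e0 -EFinB lee_fin addrAC subrr add0r.
Qed.

Let measure_window_fin A (q e : R) : 0 < e -> measurable A ->
  mu (A `&` `]q, q + e[) \is a fin_num.
Proof.
by move=> e0 mA; rewrite ge0_fin_numE// (le_lt_trans (measure_window q e0 mA))// ltry.
Qed.

(** Exchanging the integrals over the strip moves the averaging from [W] to [A]: what multiplies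
    [W q] is the density of [A] in the forward window of [q], a number at most 1. *)
Lemma backward_average_fubini A W (e : R) : 0 < e -> measurable A ->
  mu.-integrable setT (EFin \o W) ->
  mu.-integrable A (EFin \o backward_average W e) /\
  \int[mu]_(r in A) backward_average W e r =
  \int[mu]_q (W q * (e^-1 * fine (mu (A `&` `]q, q + e[)))).
Proof.
move=> e0 mA iW.
have mW : measurable_fun setT W by apply/measurable_EFinP; exact: measurable_int iW.
pose f (z : R * R) : \bar R := (e^-1 * (W z.2 * \1_A z.1 * \1_(strip e) z))%:E.
have mf : measurable_fun setT f.
  apply/measurable_EFinP; apply: measurable_funM => //.
  apply: measurable_funM; last exact: measurable_indic.
  apply: measurable_funM; first exact: measurableT_comp.
  by apply: measurableT_comp => //; exact: measurable_indic.
have fin q := measure_window_fin q e0 mA.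
have FqE q (c : R) : (\int[mu]_r ((c * \1_A r * \1_(strip e) (r, q))%:E) =
    (c * fine (mu (A `&` `]q, q + e[)))%:E)%E.
  have -> : (fun r => (c * \1_A r * \1_(strip e) (r, q))%:E) =
      (fun r => c%:E * (\1_(A `&` `]q, q + e[) r)%:E)%E.
    by apply/funext => r; rewrite stripE' indicI/= -mulrA.
  rewrite integralZl//; last first.
    apply/integrableP; split; first by apply/measurable_EFinP; exact/measurable_indic/measurableI.
    under eq_integral do rewrite /= normr_nat.
    rewrite integral_indic//; last exact: measurableI.
    by rewrite setIT -ge0_fin_numE// fin.
  rewrite integral_indic//; last exact: measurableI.
  by rewrite setIT EFinM fineK ?fin.
have lee q : fine (mu (A `&` `]q, q + e[)) <= e.
  by rewrite -lee_fin fineK ?fin//; exact: measure_window.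
have if_ : (mu \x mu)%E.-integrable setT f.
  apply/integrable21ltyP => //.
  apply: (@le_lt_trans _ _ (\int[mu]_q `|(W q)%:E|)%E); last by case/integrableP : iW.
  apply: ge0_le_integral => //.
  - by move=> q _; exact: integral_ge0.
  - have mabs : measurable_fun setT (abse \o f) by exact: measurableT_comp.
    by have := @measurable_fun_fubini_tonelli_G _ _ _ _ _ mu _ mabs (fun=> abse_ge0 _).
  - by apply/measurable_EFinP; exact: measurableT_comp.
  - move=> q _; rewrite /f.
    have -> : (fun x => `|(e^-1 * (W (x, q).2 * \1_A (x, q).1 * \1_(strip e) (x, q)))%:E|)%E =
        (fun r => (e^-1 * `|W q| * \1_A r * \1_(strip e) (r, q))%:E).
      apply/funext => r /=; rewrite !normrM !normr_nat normfV (gtr0_norm e0).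
      by rewrite !mulrA.
    rewrite FqE lee_fin mulrAC ler_piMl// mulrC ler_pdivrMr// mul1r; exact: lee.
have FE : fubini_F mu f = (fun r => (backward_average W e r * \1_A r)%:E).
  apply/funext => r; rewrite /fubini_F /f /backward_average /Rintegral.
  pose V : R -> R := W \_ `]r - e, r[.
  have iI : mu.-integrable `]r - e, r[ (EFin \o W) by exact: integrableS iW.
  have VE : integral mu [set` `]r - e, r[] (EFin \o W) = integral mu setT (EFin \o V).
    by rewrite integral_mkcond/= restrict_EFin.
  rewrite -mulrA EFinM EFinM fineK; last exact: integrable_fin_num.
  have -> : (fun y => (e^-1 * (W (r, y).2 * \1_A (r, y).1 * \1_(strip e) (r, y)))%:E) =
      (fun y => (e^-1 * \1_A r)%:E * (EFin \o V) y)%E.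
    apply/funext => y /=; rewrite stripE -EFinM; congr (_%:E).
    have -> : V y = W y * \1_(`]r - e, r[) y.
      by rewrite /V patchE indicE; case: (y \in _); rewrite ?mulr1 ?mulr0.
    by rewrite -!mulrA [X in _ * X = _]mulrCA.
  rewrite integralZl//.
    by rewrite VE EFinM -muleA [X in (_ * X)%E]muleC.
  by rewrite -restrict_EFin; apply/(integrable_mkcond _ _).1.
have iF : mu.-integrable setT (fubini_F mu f) by exact: integrable_fubini_F.
have EF := Fubini if_.
rewrite FE in iF.
have AE : (EFin \o backward_average W e) \_ A = (fun r => (backward_average W e r * \1_A r)%:E).
  by apply/funext => r; rewrite patchE indicE; case: ifP => _; rewrite ?mulr1 ?mulr0.
split; first by apply/(integrable_mkcond _ _).2 => //; rewrite AE.
rewrite /Rintegral integral_mkcond AE -FE /fubini_F EF; congr fine.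
apply: eq_integral => q _; rewrite /f.
have -> : (fun x => (e^-1 * (W (x, q).2 * \1_A (x, q).1 * \1_(strip e) (x, q)))%:E) =
        (fun r => (e^-1 * W q * \1_A r * \1_(strip e) (r, q))%:E).
  by apply/funext => r /=; rewrite !mulrA.
by rewrite FqE mulrCA mulrA.
Qed.

Lemma backward_average_le A W (e : R) : 0 < e -> measurable A ->
  mu.-integrable setT (EFin \o W) -> (forall r, 0 <= W r) ->
  mu.-integrable A (EFin \o backward_average W e) /\
  \int[mu]_(r in A) backward_average W e r <= \int[mu]_r W r.
Proof.
move=> e0 mA iW W0; have [iA ->] := backward_average_fubini e0 mA iW; split => //.
have le1 q : e^-1 * fine (mu (A `&` `]q, q + e[)) <= 1.
  rewrite ler_pdivrMl// mulr1 -lee_fin fineK ?measure_window_fin//.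
  exact: measure_window.
rewrite /Rintegral fine_le//; last 2 first.
- exact: integrable_fin_num.
- apply: ae_ge0_le_integral_nonmeasurable.
  + by move=> q _; rewrite lee_fin mulr_ge0// mulr_ge0 ?invr_ge0 ?(ltW e0)// fine_ge0.
  + by move=> q _; rewrite lee_fin.
  + by apply: aeW => q _; rewrite lee_fin ler_piMr.
rewrite ge0_fin_numE; last first.
  apply: integral_ge0 => q _.
  by rewrite lee_fin mulr_ge0// mulr_ge0 ?invr_ge0 ?(ltW e0)// fine_ge0.
apply: (@le_lt_trans _ _ (\int[mu]_r (W r)%:E)%E); last exact: integrable_lty.
apply: ae_ge0_le_integral_nonmeasurable.
- by move=> q _; rewrite lee_fin mulr_ge0// mulr_ge0 ?invr_ge0 ?(ltW e0)// fine_ge0.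
- by move=> q _; rewrite lee_fin.
- by apply: aeW => q _; rewrite lee_fin ler_piMr.
Qed.

(** This is Lebesgue differentiation of the indicator of [A] along one-sided windows. They do not
    contain [q] but shrink nicely to it. *)
Lemma forward_density (A : set R) : measurable A ->
  {ae mu, forall q, n.+1%:R * fine (mu (A `&` `]q, q + n.+1%:R^-1[)) @[n --> \oo] --> (\1_A q : R)}.
Proof.
move=> mA.
have := lebesgue_differentiation (locally_integrable_indic openT mA).
apply: filterS; first exact: (ae_filter_ringOfSetsType mu).
move=> q qA.
pose E (q : R) (n : nat) : set R := `]q, q + n.+1%:R^-1[%classic.
have muE x n : mu (E x n) = (n.+1%:R^-1)%:E.
  by rewrite lebesgue_measure_itv/= lte_fin ltrDl invr_gt0 ltr0n/= -EFinB addrAC subrr add0r.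
have hE x : nicely_shrinking x (E x).
  split; first by move=> n; exact: measurable_itv.
  have n0 n : 0 < n.+1%:R^-1 :> R by rewrite invr_gt0.
  (* The ball around the point with the window's length as radius is twice as long as the window. *)
  exists (2, fun n => PosNum (n0 n)); split => //=.
  - exact: cvg_harmonic.
  - move=> n y; rewrite /E/= in_itv/= /ball/= => /andP[xy yx].
    by rewrite ltr0_norm ?subr_lt0// opprB ltrBlDl.
  - move=> n; rewrite muE lebesgue_measure_ball ?invr_ge0//= lee_fin.
    by rewrite mulr_natl.
have := nice_lebesgue_differentiation hE (locally_integrable_indic openT mA) qA.
move=> /fine_cvg; apply: cvg_trans; apply: near_eq_cvg; apply: nearW => n /=.
rewrite muE integral_indic//; last exact: measurable_itv.
rewrite inver gt_eqF ?invr_gt0// invrK fineM//.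
by apply: measure_window_fin => //; rewrite invr_gt0.
Qed.

(** After Fubini's theorem the integrand is [W] times a density between 0 and 1, so [|W|] dominates
    and [forward_density] gives the pointwise limit. *)
Lemma backward_average_cvg A W : measurable A -> mu.-integrable setT (EFin \o W) ->
  \int[mu]_(r in A) backward_average W n.+1%:R^-1 r @[n --> \oo] --> \int[mu]_(r in A) W r.
Proof.
move=> mA iW.
have mW : measurable_fun setT W by apply/measurable_EFinP; exact: measurable_int iW.
have e0 n : 0 < n.+1%:R^-1 :> R by rewrite invr_gt0.
rewrite (_ : (fun n => _) = fun n => \int[mu]_q
    (W q * (n.+1%:R * fine (mu (A `&` `]q, q + n.+1%:R^-1[))))); last first.
  apply/funext => n; have [_ ->] := backward_average_fubini (e0 n) mA iW.
  by rewrite invrK.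
rewrite Rintegral_mkcond.
apply: (@dominated_cvg_Rintegral _ _ R mu setT
  (fun n q => W q * (n.+1%:R * fine (mu (A `&` `]q, q + n.+1%:R^-1[))))
   (W \_ A) (fun x => `|W x|)) => //.
- move=> n; apply: measurable_funM => //; apply: measurable_funM => //.
  have mG : measurable_fun [set: R] (fun q : R => mu (A `&` `]q, q + n.+1%:R^-1[)).
    have mS : measurable ((A `*` [set: R]) `&` strip n.+1%:R^-1).
      by apply: measurableI => //; exact: measurableX.
    have := measurable_fun_ysection mu mS.
    congr (measurable_fun _ _).
    apply/funext => q /=; congr (mu _); apply/seteqP; split => r /=.
      rewrite /ysection/= inE/= => -[[Ar _]] /andP[h1 h2]; split => //.
      by rewrite in_itv/= h2/= -ltrBlDr.
    rewrite in_itv/= => -[Ar /andP[h1 h2]]; rewrite /ysection/= inE.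
    by split; [split|rewrite /strip/= h1 ltrBlDr h2].
  exact: measurableT_comp.
- by apply/(measurable_restrictT _ _).1 => //; exact: measurable_funTS.
- exact: (integrable_norm iW).
- move=> n q _; rewrite normrM ler_piMr// ger0_norm ?mulr_ge0// ?fine_ge0//.
  rewrite mulrC -ler_pdivlMr// div1r.
  by rewrite -lee_fin fineK; [exact: measure_window|exact: measure_window_fin].
- have := forward_density mA.
  apply: filterS; first exact: (ae_filter_ringOfSetsType mu).
  move=> q hq _.
  rewrite (_ : (W \_ A) q = W q * \1_A q).
    by apply: cvgM => //; exact: cvg_cst.
  by rewrite patchE indicE; case: ifP => _; rewrite ?mulr1 ?mulr0.
Qed.

End steklov.

(** * Gronwall's lemma *)

Section gronwall.
Context {R : realType}.
Local Notation mu := (@lebesgue_measure R).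
Implicit Types (f g : R -> R) (t T M : R).

Lemma bounded_integrable_itv f M (a b : R) : measurable_fun setT f ->
  (forall t, `|f t| <= M) -> mu.-integrable `]a, b[ (EFin \o f).
Proof.
move=> mf fM; apply: (@dominated_integrable_real _ _ _ mu _ f (cst M)) => //.
  exact: measurable_funTS.
apply/integrableP; split; first exact/measurable_EFinP.
rewrite (eq_integral (cst `|M|%:E))// integral_cst//= lte_mul_pinfty ?lee_fin//.
by rewrite lebesgue_measure_itv/=; case: ifP => _; rewrite -?EFinB ltry.
Qed.

Lemma gronwall_eq0 (y : R -> R) T C M : 0 <= C -> measurable_fun setT y ->
  (forall t, 0 <= y t <= M) ->
  (forall t, 0 < t <= T -> y t <= C * \int[mu]_(r in `]0, t[) y r) ->
  forall t, 0 < t <= T -> y t = 0.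
Proof.
move=> C0 my yM yC t tT.
(* Integrating [exp(L r)] costs [1 / L], and [C / L <= 1/2]. The [+ 1] keeps [L] positive when
   [C = 0]. *)
pose L := 2 * C + 1; have L0 : 0 < L by rewrite ltr_wpDl// mulr_ge0.
pose S := [set expR (- (L * s)) * y s | s in `]0, T]%classic].
have T0 : 0 < T by case/andP: tT => /lt_le_trans; apply.
have S0 : has_sup S.
  split; first by exists (expR (- (L * T)) * y T); exists T => //=; rewrite in_itv/= T0 lexx.
  exists M => _ [s sT <-]; move: sT; rewrite /= in_itv/= => /andP[s0 _].
  have /andP[y0 y1] := yM s.
  rewrite (le_trans _ y1)// ler_piMl// -[leRHS]expR0 ler_expR oppr_le0.
  by rewrite mulr_ge0// ltW.
have yS s : 0 < s <= T -> y s <= sup S * expR (L * s).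
  move=> sT; rewrite -ler_pdivrMr ?expR_gt0// -expRN mulrC.
  by apply: (sup_upper_bound S0); exists s => //=; rewrite in_itv/=.
have supS0 : 0 <= sup S.
  have := yS _ tT; have /andP[y0 _] := yM t => h.
  by move: (le_trans y0 h); rewrite pmulr_lge0// expR_gt0.
have expint s : 0 < s -> \int[mu]_(r in `]0, s[) (sup S * expR (L * r)) <= sup S * (expR (L * s) / L).
  move=> s0.
  have dE (r : R) : is_derive r 1 (fun z => sup S * (expR (L * z) / L)) (sup S * expR (L * r)).
    have d1 : is_derive r 1 (fun z : R => L * z) L.
      have h : is_derive r 1 (L *: (id : R -> R)) (L *: 1) by exact: is_deriveZ.
      by apply: (is_derive_eq h); rewrite /GRing.scale/= mulr1.
    have d2 := @is_derive1_comp _ expR (fun z : R => L * z) r _ _ (is_derive_expR _) d1.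
    have d3 := is_deriveZ (sup S / L) d2.
    have -> : (fun z => sup S * (expR (L * z) / L)) = (sup S / L) *: (expR \o (fun z => L * z)).
      apply/funext => z; change (sup S * (expR (L * z) / L) = sup S / L * expR (L * z)).
      by rewrite -[RHS]mulrA [L^-1 * _]mulrC.
    apply: (is_derive_eq d3); rewrite /GRing.scale/= -mulrA; congr (_ * _).
    by rewrite mulrCA mulVf ?mulr1// gt_eqF.
  have ce : continuous (fun r => sup S * expR (L * r)).
    move=> r; apply: cvgM; first exact: cvg_cst.
    apply: continuous_comp; first exact: mulrl_continuous.
    exact: continuous_expR.
  have cE : continuous (fun r => sup S * (expR (L * r) / L)).
    move=> r; apply: differentiable_continuous; apply/derivable1_diffP.
    by have [] := dE r.
  rewrite /Rintegral -(@integral_itv_bndoo _ _ _ _ true false); last first.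
    by apply/measurable_EFinP; apply: measurable_funTS; exact: continuous_measurable_fun.
  rewrite (@continuous_FTC2 _ _ (fun z => sup S * (expR (L * z) / L)))//=.
  - by rewrite lerBlDr lerDl mulr_ge0// divr_ge0 ?expR_ge0// ltW.
  - exact: continuous_subspaceT.
  - split.
    + by move=> r _; have [] := dE r.
    + exact: cvg_at_right_filter (cE _).
    + exact: cvg_at_left_filter (cE _).
  - by move=> r _; rewrite derive1E; have [_ ->] := dE r.
have half s : 0 < s <= T -> expR (- (L * s)) * y s <= sup S / 2.
  move=> sT; have /andP[s0 sT'] := sT.
  rewrite expRN mulrC ler_pdivrMr ?expR_gt0// (le_trans (yC _ sT))//.
  apply: (@le_trans _ _ (C * (sup S * (expR (L * s) / L)))).
    rewrite ler_wpM2l// (le_trans _ (expint _ s0))//.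
    apply: le_Rintegral => //.
    - apply: (bounded_integrable_itv (M := M)) => // r.
      by have /andP[y0 y1] := yM r; rewrite ger0_norm.
    - apply: (@integrableS _ _ R mu `[0, s]) => //; first exact: subset_itv_oo_cc.
      apply: continuous_compact_integrable; first exact: segment_compact.
      apply: continuous_subspaceT => r; apply: cvgM; first exact: cvg_cst.
      apply: continuous_comp; first exact: mulrl_continuous.
      exact: continuous_expR.
    - move=> r /=; rewrite in_itv/= => /andP[r0 rs].
      by apply: yS; rewrite r0 (le_trans (ltW rs)).
  rewrite mulrCA -mulrA ler_wpM2l// mulrCA [leRHS]mulrC ler_wpM2l ?expR_ge0//.
  by rewrite ler_pdivrMr// /L mulrDr mulr1 mulrA mulVf// mul1r lerDl invr_ge0.
have supS_half : sup S <= sup S / 2.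
  apply: ge_sup; first by case: S0.
  by move=> _ [s sT <-]; apply: half; move: sT; rewrite /= in_itv.
have supS : sup S = 0 by lra.
have := yS _ tT; rewrite supS mul0r => yt; apply/eqP; rewrite eq_le yt/=.
by case/andP: (yM t).
Qed.

Definition primitive f t : R := \int[mu]_(r in `]0, t[) f r.

Lemma primitive_nd f : (forall r, 0 <= f r) -> mu.-integrable setT (EFin \o f) ->
  {homo primitive f : s t / s <= t}.
Proof.
move=> f0 iF s t st; rewrite /primitive /Rintegral fine_le//.
- by apply: integrable_fin_num => //; exact: integrableS iF.
- by apply: integrable_fin_num => //; exact: integrableS iF.
- apply: ge0_subset_integral => //.
  + by apply: measurable_funTS; exact: measurable_int iF.
  + by move=> r _; rewrite lee_fin.
  + exact: subset_itvl.
Qed.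

Lemma primitive_ge0 f t : (forall r, 0 <= f r) -> 0 <= primitive f t.
Proof. by move=> f0; exact: Rintegral_ge0. Qed.

Lemma primitive_le f t : (forall r, 0 <= f r) -> mu.-integrable setT (EFin \o f) ->
  primitive f t <= \int[mu]_r f r.
Proof.
move=> f0 iF; rewrite /primitive /Rintegral fine_le//.
- by apply: integrable_fin_num => //; exact: integrableS iF.
- exact: integrable_fin_num.
- apply: ge0_subset_integral => //; first exact: measurable_int iF.
  by move=> r _; rewrite lee_fin.
Qed.

Lemma measurable_primitive f : (forall r, 0 <= f r) ->
  mu.-integrable setT (EFin \o f) -> measurable_fun setT (primitive f).
Proof. by move=> f0 iF; apply: nondecreasing_measurable => //; exact: primitive_nd. Qed.

Lemma integrable_primitive f (s t : R) : (forall r, 0 <= f r) ->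
  mu.-integrable setT (EFin \o f) -> mu.-integrable `]s, t[ (EFin \o primitive f).
Proof.
move=> f0 iF; apply: (bounded_integrable_itv (M := \int[mu]_r f r)).
  exact: measurable_primitive.
by move=> r; rewrite ger0_norm ?primitive_ge0//; exact: primitive_le.
Qed.

(** Here [a], [p], [k] stand for [|u|^2], [|grad u|^2], [|K|^2], and [E] is the continuous version
    of [a]. The bound of [k] is integrated and fed back into the energy inequality, where [- 2 p]
    absorbs every gradient. What remains is a linear integral inequality. *)
Lemma energy_gronwall (a p k E : R -> R) T M C1 :
  0 < T ->
  (forall r, 0 <= a r) -> (forall r, 0 <= p r) -> (forall r, 0 <= k r) ->
  mu.-integrable setT (EFin \o a) -> mu.-integrable setT (EFin \o p) ->
  mu.-integrable setT (EFin \o k) ->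
  measurable_fun setT E -> (forall t, 0 <= E t <= M) ->
  {ae mu, forall t, t \in `]0, T[ -> a t = E t} ->
  (forall e, 0 < e -> exists2 C, 0 <= C & forall t, 0 < t <= T ->
    E t <= \int[mu]_(r in `]0, t[)
      (e * (k r + p r) + C * (a r + primitive a r + primitive k r) - 2 * p r)) ->
  (forall t, k t <= C1 * (primitive k t + a t + p t)) ->
  [/\ forall t, 0 < t <= T -> E t = 0, primitive p T = 0 & primitive k T = 0].
Proof.
move=> T0 a0 p0 k0 ia ip ik mE EM aE HE Hk.
pose C2 := Num.max C1 1.
have C20 : 0 < C2 by rewrite lt_max ltr01 orbT.
have {}Hk t : k t <= C2 * (primitive k t + a t + p t).
  rewrite (le_trans (Hk t))// ler_wpM2r ?le_max ?lexx// !addr_ge0//.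
  exact: primitive_ge0.
(* Then [2 e Q] contains at most [P], and [e P <= P / 2] because [C2 >= 1]. With the [P / 2] kept on
   the left in [key], this uses up exactly the available [2 P]. *)
pose e := (2 * C2)^-1; have e0 : 0 < e by rewrite invr_gt0 mulr_gt0.
have e1 : e <= 1 / 2.
  rewrite /e invfM div1r ler_piMr ?invr_ge0// invf_le1//.
  by rewrite le_max lexx orbT.
have [C C0 {}HE] := HE e e0.
have iS f t : mu.-integrable setT (EFin \o f) -> mu.-integrable `]0, t[ (EFin \o f).
  by move=> i; exact: integrableS i.
have iprim f t : (forall r, 0 <= f r) -> mu.-integrable setT (EFin \o f) ->
   mu.-integrable `]0, t[ (EFin \o primitive f).
  exact: integrable_primitive.
have iZ (f : R -> R) c t : mu.-integrable `]0, t[ (EFin \o f) ->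
   mu.-integrable `]0, t[ (EFin \o (fun r => c * f r)).
  by move=> i; exact: integrableZl i.
have iD (f g : R -> R) t : mu.-integrable `]0, t[ (EFin \o f) ->
   mu.-integrable `]0, t[ (EFin \o g) ->
   mu.-integrable `]0, t[ (EFin \o (fun r => f r + g r)).
  by move=> i j; exact: integrableD i j.
pose A := primitive a; pose P := primitive p; pose Q := primitive k.
have iE t : mu.-integrable `]0, t[ (EFin \o E).
  apply: (bounded_integrable_itv (M := M)) => // r.
  by have /andP[? ?] := EM r; rewrite ger0_norm.
have AE t : 0 < t <= T -> A t = primitive E t.
  move=> /andP[t0 tT]; apply: ae_eq_Rintegral.
  apply: (ae_imply aE) => r h; rewrite /= in_itv/= => /andP[r0 rt].
  by apply: h; rewrite in_itv/= r0 (lt_le_trans rt).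
have HE' t : 0 < t <= T ->
    E t <= e * (Q t + P t) + C * (A t + primitive A t + primitive Q t) - 2 * P t.
  move=> tT; apply: le_trans (HE t tT) _.
  have i1 : mu.-integrable `]0, t[ (EFin \o (fun r => k r + p r)).
    by apply: (iD); exact: iS.
  have i2 : mu.-integrable `]0, t[ (EFin \o (fun r => a r + A r)).
    by apply: (iD); [exact: iS|exact: iprim].
  have i3 : mu.-integrable `]0, t[ (EFin \o (fun r => a r + A r + Q r)).
    by apply: (iD) => //; exact: iprim.
  rewrite RintegralB//; last 2 first.
  - by apply: (iD); exact: iZ.
  - by apply: (iZ); exact: iS.
  rewrite RintegralD//; [|exact: iZ..].
  rewrite !RintegralZl//; last exact: iS.
  by rewrite !RintegralD//; first [exact: iS|exact: iprim].
have HQ t : Q t <= C2 * (primitive Q t + A t + P t).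
  have : Q t <= \int[mu]_(r in `]0, t[) (C2 * (Q r + a r + p r)).
    apply: le_Rintegral => //; first exact: iS.
    by apply: (iZ); apply: (iD); [apply: (iD); [exact: iprim|exact: iS]|exact: iS].
  rewrite RintegralZl//; last by apply: (iD); [apply: (iD); [exact: iprim|exact: iS]|exact: iS].
  by rewrite !RintegralD//; first [exact: iS|exact: iprim|apply: (iD); [exact: iprim|exact: iS]].
have eC2 : e * C2 = 1 / 2 by rewrite /e; field; rewrite gt_eqF.
have HQ' t : e * Q t <= 1 / 2 * (primitive Q t + A t + P t).
  by rewrite -eC2 -mulrA; apply: ler_wpM2l; [exact: ltW|exact: HQ].
have P0 t : 0 <= P t by exact: primitive_ge0.
have A0 t : 0 <= A t by exact: primitive_ge0.
have Q0 t : 0 <= Q t by exact: primitive_ge0.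
have PA0 t : 0 <= primitive A t by exact: primitive_ge0.
have PQ0 t : 0 <= primitive Q t by exact: primitive_ge0.
have key t : 0 < t <= T -> E t + P t / 2 + e * Q t <= (C + 2) * (A t + primitive A t + primitive Q t).
  move=> tT; have h1 := HE' t tT; have h2 := HQ' t.
  have h3 : e * P t <= 1 / 2 * P t by apply: ler_wpM2r; [exact: P0|exact: e1].
  have := A0 t; have := PA0 t; have := PQ0 t; have := P0 t; nra.
(* With [A] and [e * Q] included, the right side of [key] is bounded by the integral of [y] itself.
   As [Q] enters with the factor [e <= 1], the Gronwall constant is divided by [e]. *)
pose y t := E t + A t + e * Q t.
have my : measurable_fun setT y.
  apply: measurable_funD; first apply: measurable_funD => //.
    exact: measurable_primitive.
  by apply: measurable_funM => //; exact: measurable_primitive.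
have iAt t : mu.-integrable `]0, t[ (EFin \o A) by exact: iprim.
have iQt t : mu.-integrable `]0, t[ (EFin \o Q) by exact: iprim.
have y0 : forall t, 0 < t <= T -> y t = 0.
  apply: (@gronwall_eq0 y T ((C + 3) / e) (M + \int[mu]_r a r + e * \int[mu]_r k r)) => //.
  - by rewrite divr_ge0// ?addr_ge0// ltW.
  - move=> t; have /andP[E0 E1] := EM t; rewrite /y.
    rewrite !addr_ge0//=; last by rewrite mulr_ge0// ltW.
    by rewrite !lerD// ?ler_wpM2l ?(ltW e0)//; exact: primitive_le.
  - move=> t tT.
    have -> : \int[mu]_(r in `]0, t[) y r = primitive E t + primitive A t + e * primitive Q t.
      rewrite RintegralD//; [|by apply: iD|exact: iZ].
      by rewrite RintegralD// RintegralZl.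
    have h := key t tT; have hA := AE t tT.
    have E0 : 0 <= primitive E t by rewrite -hA.
    have h1 : y t <= (C + 3) * (primitive E t + primitive A t + primitive Q t).
      rewrite /y; have := P0 t; have := PA0 t; have := PQ0 t; nra.
    rewrite (le_trans h1)// -mulrA ler_wpM2l ?addr_ge0// ler_pdivlMl//.
    have := PA0 t; have := e1; have := PQ0 t; nra.
have y0T := y0 T; rewrite T0 lexx in y0T; have {y0T} yT := y0T isT.
have Ey t : 0 < t <= T -> E t = 0 /\ A t = 0 /\ Q t = 0.
  move=> tT; have := y0 t tT; rewrite /y.
  have /andP[E0 _] := EM t; have := A0 t; have := Q0 t => Qt At h.
  have eQ : 0 <= e * Q t by rewrite mulr_ge0// ltW.
  have eQ0 : e * Q t = 0 by lra.
  move/eqP : eQ0; rewrite mulf_eq0 (gt_eqF e0)/= => /eqP ->.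
  by split; [lra|split; lra].
have TT : 0 < T <= T by rewrite T0 lexx.
have pz f : (forall r, 0 < r <= T -> f r = 0) -> primitive f T = 0.
  move=> f0; rewrite /primitive (@eq_Rintegral _ _ _ _ _ (cst 0)).
    by rewrite Rintegral_cst//= mul0r.
  by move=> r; rewrite inE/= in_itv/= => /andP[r0 rT]; rewrite f0// r0 ltW.
split.
- by move=> t /Ey[].
- have [E0 [A00 Q00]] := Ey T TT.
  have zA : primitive A T = 0 by apply: pz => r /Ey[_ []].
  have zQ : primitive Q T = 0 by apply: pz => r /Ey[_ []].
  have := key T TT; rewrite E0 A00 Q00 zA zQ; have := P0 T; rewrite -/P; lra.
- by have [_ []] := Ey T TT.
Qed.

End gronwall.

(** * Shifted and reflected integrals in time *)

Section time_shift.
Context {R : realType}.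
Local Notation mu := (@lebesgue_measure R).

Lemma dominated_integrable_lebesgue (D : set R) (f g : R -> R) : measurable D ->
  measurable_fun D f -> mu.-integrable D (EFin \o g) ->
  (forall x, D x -> `|f x| <= g x) -> mu.-integrable D (EFin \o f).
Proof. exact: (@dominated_integrable_real _ _ R mu D f g). Qed.

Lemma integrableD_lebesgue (D : set R) (f g : R -> R) : measurable D ->
  mu.-integrable D (EFin \o f) -> mu.-integrable D (EFin \o g) ->
  mu.-integrable D (EFin \o (fun x => f x + g x)).
Proof. exact: (@integrableD_real _ _ R mu D f g). Qed.

Lemma integrableZ_lebesgue (D : set R) (k : R) (f : R -> R) : measurable D ->
  mu.-integrable D (EFin \o f) -> mu.-integrable D (EFin \o (fun x => k * f x)).
Proof. exact: (@integrableZ_real _ _ R mu D k f). Qed.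

Lemma integrableB_lebesgue (D : set R) (f g : R -> R) : measurable D ->
  mu.-integrable D (EFin \o f) -> mu.-integrable D (EFin \o g) ->
  mu.-integrable D (EFin \o (fun x => f x - g x)).
Proof. by move=> mD i i'; exact: integrableB i i'. Qed.

Lemma integrable_subset_lebesgue (D : set R) (f : R -> R) : measurable D ->
  mu.-integrable setT (EFin \o f) -> mu.-integrable D (EFin \o f).
Proof. by move=> mD; apply: integrableS. Qed.

Lemma cvg_shift_quotient (G : R -> R) (t e : R) : is_derive t 1 G e ->
  n.+1%:R * (G t - G (t - n.+1%:R^-1)) @[n --> \oo] --> e.
Proof.
move=> [dG Ge].
have h0 : (fun n : nat => - n.+1%:R^-1 : R) @ \oo --> (0 : R)^'.
  move=> P [d /= d0 dP].
  have : \forall n \near \oo, `|n.+1%:R^-1 : R| < d.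
    exact: (cvgr0Pnorm_lt _).1 (@cvg_harmonic R) _ d0.
  apply: filterS => n hn; apply: dP => /=; first by rewrite sub0r opprK.
  by rewrite oppr_eq0 invr_eq0.
have dq : h^-1 *: ((G \o shift t) (h *: 1) - G t) @[h --> 0^'] --> e.
  by rewrite -Ge; exact: dG.
have := cvg_comp _ _ h0 dq; apply: cvg_trans; apply: near_eq_cvg; apply: nearW => n /=.
rewrite invrN invrK /GRing.scale/= mulr1 mulNr -mulrN opprB.
by rewrite [_ + t]addrC.
Qed.

(** The integral telescopes to that of [E] over [[t - d, t]] minus that over [[- d, 0]], so the
    quotient is a difference of two backward difference quotients of a primitive of [E]. *)
Lemma shift_average (E : R -> R) (t : R) : continuous E -> 0 < t ->
  n.+1%:R * \int[mu]_(r in `]0, t[) (E r - E (r - n.+1%:R^-1)) @[n --> \oo] --> E t - E 0.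
Proof.
move=> cE t0.
(* The shift is at most 1, so every point at which [G] is differentiated is at least -1, to the
   right of the base point. *)
pose G (x : R) := \int[mu]_(r in `[-2, x]) E r.
have dG (x : R) : -2 < x -> is_derive x 1 G (E x).
  move=> x2; have xx : x < x + 1 by rewrite ltrDl.
  have iE : mu.-integrable `[-2, x + 1] (EFin \o E).
    apply: continuous_compact_integrable; first exact: segment_compact.
    exact: continuous_subspaceT.
  have [dG G'] := continuous_FTC1_closed xx iE x2 (cE x).
  by apply: DeriveDef; [exact: dG|rewrite -derive1E].
have cvgt : n.+1%:R * (G t - G (t - n.+1%:R^-1)) @[n --> \oo] --> E t.
  by apply/cvg_shift_quotient/dG; lra.
have cvg0 : n.+1%:R * (G 0 - G (0 - n.+1%:R^-1)) @[n --> \oo] --> E 0.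
  by apply/cvg_shift_quotient/dG; lra.
rewrite (_ : (fun n => _) = (fun n => n.+1%:R * (G t - G (t - n.+1%:R^-1)) -
    n.+1%:R * (G 0 - G (0 - n.+1%:R^-1)))); first exact: (cvgB cvgt cvg0).
apply/funext => n; rewrite -mulrBr; congr (_ * _).
have d1 : n.+1%:R^-1 <= 1 :> R by rewrite invf_le1// ler1n.
set d := n.+1%:R^-1 in d1 *.
pose F (r : R) := G r - G (r - d).
have dF (r : R) : 0 <= r -> is_derive r 1 F (E r - E (r - d)).
  move=> r0; have d2 : is_derive r 1 (fun z : R => z - d) 1.
    have h : is_derive r 1 ((id : R -> R) - cst d) (1 - 0) by exact: is_deriveB.
    by apply: (is_derive_eq h); rewrite subr0.
  have d3 : is_derive (r - d) 1 G (E (r - d)) by apply: dG; lra.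
  have d4 := @is_derive1_comp _ G (fun z : R => z - d) r _ _ d3 d2.
  rewrite mulr1 in d4.
  by have d5 : is_derive r 1 G (E r); [apply: dG; lra|exact: (is_deriveB d5 d4)].
have cF (r : R) : 0 <= r -> {for r, continuous F}.
  move=> r0; apply: differentiable_continuous; apply/derivable1_diffP.
  by have [] := dF r r0.
have cEE : continuous (fun r => E r - E (r - d)).
  move=> r; apply: cvgB; first exact: cE.
  apply: (@continuous_comp _ _ _ (fun z => z - d) E); last exact: cE.
  by apply: cvgB; [exact: cvg_id|exact: cvg_cst].
rewrite /Rintegral -(@integral_itv_bndoo _ _ _ _ true false); last first.
  by apply/measurable_EFinP; apply: measurable_funTS; exact: continuous_measurable_fun.
rewrite (@continuous_FTC2 _ _ F)//=.
- exact: continuous_subspaceT.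
- split.
  + by move=> r; rewrite in_itv/= => /andP[/ltW r0 _]; have [] := dF r r0.
  + exact: cvg_at_right_filter (cF _ _).
  + by apply: cvg_at_left_filter (cF _ _); exact: ltW.
- move=> r; rewrite in_itv/= => /andP[/ltW r0 _]; rewrite derive1E.
  by have [_ ->] := dF r r0.
Qed.

(** The reflection preserves the length of half-open intervals, and Lebesgue measure is determined
    by these lengths. *)
Lemma ge0_integral_reflection (f : R -> \bar R) (t : R) :
  measurable_fun setT f -> (forall r, (0 <= f r)%E) ->
  (\int[mu]_(s in `]0%R, t[) f (t - s)%R = \int[mu]_(s in `]0%R, t[) f s)%E.
Proof.
move=> mf f0.
pose phi : measurableTypeR R -> measurableTypeR R := fun s => t - s.
have mphi : measurable_fun setT phi.
  by apply: measurable_funB => //; exact: measurable_id.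
have pre (a b : R) (x y : bool) : phi @^-1` [set` Interval (BSide x a) (BSide y b)] =
    [set` Interval (BSide (~~ y) (t - b)) (BSide (~~ x) (t - a))].
  apply/seteqP; split => s; rewrite /phi /= !in_itv/=; case: x; case: y => /=;
    move=> /andP[? ?]; apply/andP; split; lra.
have inv (A : set R) : measurable A -> mu A = pushforward mu phi A.
  move=> mA; apply: (@lebesgue_measure_unique _ (pushforward mu phi)) => //.
  move=> _ [[a b]] _ <-; change (mu `]a, b] = mu (phi @^-1` `]a, b])).
  rewrite (pre a b false false) !lebesgue_measure_itv/= !lte_fin ltrD2l ltrN2.
  by case: ifP => // _; rewrite -!EFinB; congr (_%:E); ring.
have tE : `]0, t[%classic = phi @^-1` `]0, t[ by rewrite pre subrr subr0.
rewrite [in LHS]tE -(@ge0_integral_pushforward _ _ _ _ _ phi mphi mu `]0%R, t[%classic f)//.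
- by apply: eq_measure_integral => A mA _; first [exact: inv|exact: esym (inv A mA)].
- exact: measurable_funTS.
Qed.

End time_shift.

(** * Semi-inner products and simple curves *)

(** The form may be degenerate because vectors are functions and not classes. Its laws are required
    on [S] only, since additivity of an integral may fail for functions that are not integrable. *)
Record semi_inner_product (R : realType) (V : lmodType R) (S : set V)
    (ip : V -> V -> R) : Prop := SemiInnerProduct {
  semi_ip_dom0 : S 0 ;
  semi_ip_domP : forall (a : R) v w, S v -> S w -> S (a *: v + w) ;
  semi_ipC : forall v w, S v -> S w -> ip v w = ip w v ;
  semi_ipP : forall (a : R) v w x, S v -> S w -> S x ->
    ip (a *: v + w) x = a * ip v x + ip w x ;
  semi_ip_ge0 : forall v, S v -> 0 <= ip v v }.

Section semi_inner_product.
Context {R : realType} {V : lmodType R} {S : set V} {ip : V -> V -> R}.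
Hypothesis H : semi_inner_product S ip.
Implicit Types v w x : V.

Definition semi_norm (ip : V -> V -> R) v : R := Num.sqrt (ip v v).
Local Notation nrm := (semi_norm ip).

Definition linear_on (S : set V) (l : V -> R) :=
  forall (a : R) v w, S v -> S w -> l (a *: v + w) = a * l v + l w.

Lemma dom0 : S 0. Proof. exact: semi_ip_dom0 H. Qed.

Lemma domZ a v : S v -> S (a *: v).
Proof. by move=> Sv; rewrite -[_ *: _]addr0; apply: (semi_ip_domP H) => //; exact: dom0. Qed.

Lemma domD v w : S v -> S w -> S (v + w).
Proof. by move=> Sv Sw; rewrite -[v]scale1r; exact: semi_ip_domP H _ _ _ _ _. Qed.

Lemma domN v : S v -> S (- v).
Proof. by rewrite -scaleN1r; exact: domZ. Qed.

Lemma domB v w : S v -> S w -> S (v - w).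
Proof. by move=> Sv /domN; exact: domD. Qed.

Lemma linear_on0 l : linear_on S l -> l 0 = 0.
Proof.
move=> ll; have := ll 1 0 0 dom0 dom0; rewrite scaler0 addr0 mul1r; lra.
Qed.

Lemma linear_onZ l a v : linear_on S l -> S v -> l (a *: v) = a * l v.
Proof.
by move=> ll Sv; have := ll a v 0 Sv dom0; rewrite addr0 (linear_on0 ll) addr0.
Qed.

Lemma linear_onD l v w : linear_on S l -> S v -> S w -> l (v + w) = l v + l w.
Proof. by move=> ll Sv Sw; have := ll 1 v w Sv Sw; rewrite scale1r mul1r. Qed.

Lemma linear_onB l v w : linear_on S l -> S v -> S w -> l (v - w) = l v - l w.
Proof.
move=> ll Sv Sw; rewrite (linear_onD ll)//; last exact: domN.
by rewrite -scaleN1r (linear_onZ _ ll)// mulN1r.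
Qed.

Lemma dom_sum n (a : 'I_n -> R) (v : 'I_n -> V) : (forall i, S (v i)) ->
  S (\sum_(i < n) a i *: v i).
Proof.
move=> Sv; elim/big_ind : _ => //; first exact: dom0.
  exact: domD.
by move=> i _; exact: domZ.
Qed.

Lemma linear_on_sum l n (a : 'I_n -> R) (v : 'I_n -> V) : linear_on S l ->
  (forall i, S (v i)) -> l (\sum_(i < n) a i *: v i) = \sum_(i < n) a i * l (v i).
Proof.
move=> ll; elim: n a v => [|n IH] a v Sv; first by rewrite !big_ord0 (linear_on0 ll).
rewrite !big_ord_recr/= (linear_onD ll)//; last exact: domZ.
  by rewrite IH// (linear_onZ _ ll).
exact: dom_sum.
Qed.

Lemma ip_linear x : S x -> linear_on S (ip x).
Proof.
move=> Sx a v w Sv Sw; rewrite !(semi_ipC H Sx)//.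
  exact: (semi_ipP H).
exact: (semi_ip_domP H).
Qed.

Lemma ip_linearl x : S x -> linear_on S (ip ^~ x).
Proof. by move=> Sx a v w Sv Sw; exact: (semi_ipP H). Qed.

Lemma ip_ge0 v : S v -> 0 <= ip v v. Proof. exact: (semi_ip_ge0 H). Qed.

Lemma nrm_ge0 v : 0 <= nrm v. Proof. exact: sqrtr_ge0. Qed.

Lemma nrm_sqr v : S v -> nrm v ^+ 2 = ip v v.
Proof. by move=> Sv; rewrite sqr_sqrtr// ip_ge0. Qed.

Lemma ip_sqrD v w : S v -> S w -> ip (v + w) (v + w) = ip v v + 2 * ip v w + ip w w.
Proof.
move=> Sv Sw; rewrite (linear_onD (ip_linear (domD Sv Sw)))//.
rewrite !(linear_onD (ip_linearl _) Sv Sw)// (semi_ipC H Sw Sv); lra.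
Qed.

Lemma ip_sqrB v w : S v -> S w -> ip (v - w) (v - w) = ip v v - 2 * ip v w + ip w w.
Proof.
move=> Sv Sw; rewrite ip_sqrD//; last exact: domN.
rewrite -(scaleN1r w) (linear_onZ _ (ip_linear (domZ (-1) Sw)))//.
rewrite (linear_onZ _ (ip_linearl Sw))// (linear_onZ _ (ip_linear Sv))//; lra.
Qed.

Lemma ip_sqrZ a v : S v -> ip (a *: v) (a *: v) = a ^+ 2 * ip v v.
Proof.
move=> Sv; rewrite (linear_onZ _ (ip_linear (domZ a Sv)))//.
by rewrite (linear_onZ _ (ip_linearl Sv))// mulrA expr2.
Qed.

Lemma cauchy_schwarz_sqr v w : S v -> S w -> ip v w ^+ 2 <= ip v v * ip w w.
Proof.
move=> Sv Sw.
have q (a : R) : 0 <= a ^+ 2 * ip v v + 2 * a * ip v w + ip w w.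
  have := ip_ge0 (domD (domZ a Sv) Sw).
  by rewrite ip_sqrD//; [rewrite ip_sqrZ// (linear_onZ _ (ip_linearl Sw))// mulrA|exact: domZ].
have [v0|v0] := eqVneq (ip v v) 0.
  have [->|vw0] := eqVneq (ip v w) 0; first by rewrite expr0n/= v0 mul0r.
  (* When [ip v v = 0] the quadratic is affine in [a], and at this [a] it equals -1. *)
  have := q (- (ip w w + 1) / (2 * ip v w)); rewrite v0 mulr0 add0r.
  have -> : 2 * (- (ip w w + 1) / (2 * ip v w)) * ip v w = - (ip w w + 1) by field.
  lra.
have vp : 0 < ip v v by rewrite lt_neqAle eq_sym v0 ip_ge0.
have := q (- ip v w / ip v v).
have -> : (- ip v w / ip v v) ^+ 2 * ip v v + 2 * (- ip v w / ip v v) * ip v w + ip w w =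
  (ip v v * ip w w - ip v w ^+ 2) / ip v v by field.
by rewrite pmulr_lge0 ?invr_gt0// subr_ge0.
Qed.

Lemma cauchy_schwarz v w : S v -> S w -> `|ip v w| <= nrm v * nrm w.
Proof.
move=> Sv Sw; rewrite -(@ler_pXn2r _ 2)// ?nnegrE ?mulr_ge0 ?nrm_ge0//.
rewrite real_normK ?num_real// exprMn !nrm_sqr//.
exact: cauchy_schwarz_sqr.
Qed.

Lemma nrmD v w : S v -> S w -> nrm (v + w) <= nrm v + nrm w.
Proof.
move=> Sv Sw; rewrite -(@ler_pXn2r _ 2)// ?nnegrE ?addr_ge0 ?nrm_ge0//.
rewrite nrm_sqr ?ip_sqrD//; last exact: domD.
rewrite sqrrD !nrm_sqr//.
have := cauchy_schwarz Sv Sw; rewrite ler_norml => /andP[_ h].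
rewrite mulr2n; lra.
Qed.

Lemma nrmZ a v : S v -> nrm (a *: v) = `|a| * nrm v.
Proof. by move=> Sv; rewrite /semi_norm ip_sqrZ// sqrtrM ?sqr_ge0// sqrtr_sqr. Qed.

Lemma nrmN v : S v -> nrm (- v) = nrm v.
Proof. by move=> Sv; rewrite -scaleN1r nrmZ// normrN1 mul1r. Qed.

Lemma nrmBC v w : S v -> S w -> nrm (v - w) = nrm (w - v).
Proof. by move=> Sv Sw; rewrite -opprB nrmN//; exact: domB. Qed.

Lemma nrmB_dist v w : S v -> S w -> `|nrm v - nrm w| <= nrm (v - w).
Proof.
move=> Sv Sw; have h1 : nrm v <= nrm (v - w) + nrm w.
  by rewrite -{1}(subrK w v) nrmD//; exact: domB.
have h2 : nrm w <= nrm (v - w) + nrm v.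
  by rewrite nrmBC// -{1}(subrK v w) nrmD//; exact: domB.
by rewrite ler_norml; apply/andP; split; lra.
Qed.

Lemma nrm0 : nrm 0 = 0.
Proof. by rewrite /semi_norm (linear_on0 (ip_linear dom0)) sqrtr0. Qed.

Section simple_curves.
Local Notation simple := (@simple_curve R V S).

Lemma simple_curve_dom s t : simple s -> S (s t).
Proof. by move=> [k [A [v [_ Sv ->]]]]; exact: dom_sum. Qed.

Lemma simple_curve_indic s (B : set R) : measurable B -> simple s ->
  simple (fun t => \1_B t *: s t).
Proof.
move=> mB [k [A [v [mA Sv ->]]]].
exists k, (fun i => B `&` A i), v; split => //.
  by move=> i; exact: measurableI.
by apply/funext => t; rewrite scaler_sumr; apply: eq_bigr => i _; rewrite indicI scalerA.
Qed.

Lemma simple_curveB s1 s2 : simple s1 -> simple s2 -> simple (fun t => s1 t - s2 t).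
Proof.
move=> [k1 [A1 [v1 [mA1 Sv1 ->]]]] [k2 [A2 [v2 [mA2 Sv2 ->]]]].
exists (k1 + k2)%N, (fun i => match fintype.split i with inl i => A1 i | inr i => A2 i end),
  (fun i => match fintype.split i with inl i => v1 i | inr i => - v2 i end); split.
- by move=> i; case: fintype.split.
- by move=> i; case: fintype.split => // j; exact: domN.
- apply/funext => t; rewrite big_split_ord/=; congr (_ + _).
    by apply: eq_bigr => i _; have -> : fintype.split (lshift k2 i) = inl i by exact: (unsplitK (inl i)).
  rewrite -sumrN; apply: eq_bigr => i _.
  by have -> : fintype.split (rshift k1 i) = inr i by [exact: (unsplitK (inr i))]; rewrite scalerN.
Qed.

Lemma measurable_linear_simple (L : R -> V -> R) s : (forall t, linear_on S (L t)) ->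
  (forall phi, S phi -> measurable_fun setT (fun t => L t phi)) ->
  simple s -> measurable_fun setT (fun t => L t (s t)).
Proof.
move=> ll mL [k [A [v [mA Sv ->]]]].
rewrite (_ : (fun t => _) = (fun t => \sum_(i < k) \1_(A i) t * L t (v i))); last first.
  by apply/funext => t; rewrite linear_on_sum.
apply: measurable_sum => i; apply: measurable_funM; last exact: mL.
exact: measurable_indic.
Qed.

(** Strong measurability with convergence at every time instead of almost every time. *)
Definition simple_limit (u : R -> V) :=
  exists s : nat -> R -> V, (forall n, simple (s n)) /\
    forall t, nrm (s n t - u t) @[n --> \oo] --> (0 : R).

Lemma cvg_linear_simple (l : V -> R) C (s : nat -> V) u : linear_on S l ->
  (forall v, S v -> `|l v| <= C * nrm v) -> (forall n, S (s n)) -> S u ->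
  nrm (s n - u) @[n --> \oo] --> (0 : R) -> l (s n) @[n --> \oo] --> l u.
Proof.
move=> ll lC Ss Su su.
have h : C * nrm (s n - u) @[n --> \oo] --> (0 : R).
  by rewrite -[X in _ --> X](mulr0 C); apply: cvgM su; exact: cvg_cst.
apply/subr_cvg0; apply/norm_cvg0P.
apply: (squeeze_cvgr _ (cvg_cst 0) h); apply: nearW => n.
rewrite normr_ge0/= -(linear_onB ll)// lC//; exact: domB.
Qed.

(** Continuity of each [L t] passes to the limit along simple curves. [C] is an arbitrary function
    of [t], so that it can be a norm whose measurability is not yet known. *)
Lemma measurable_linear_limit (L : R -> V -> R) (C : R -> R) u :
  (forall t, linear_on S (L t)) ->
  (forall phi, S phi -> measurable_fun setT (fun t => L t phi)) ->
  (forall t v, S v -> `|L t v| <= C t * nrm v) ->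
  (forall t, S (u t)) -> simple_limit u -> measurable_fun setT (fun t => L t (u t)).
Proof.
move=> ll mL LC Su [s [ss su]].
apply: (measurable_fun_cvg (h := fun n t => L t (s n t))).
  by move=> n; exact: measurable_linear_simple.
move=> t _; apply: cvg_linear_simple (ll t) (LC t) _ (Su t) (su t) => n.
exact: simple_curve_dom.
Qed.

(** [measurable_linear_limit] is applied in each argument: first with the functionals [ip (u1 t)],
    whose measurability at a fixed vector is a second instance of the lemma. *)
Lemma measurable_ip u1 u2 : (forall t, S (u1 t)) -> simple_limit u1 ->
  (forall t, S (u2 t)) -> simple_limit u2 ->
  measurable_fun setT (fun t => ip (u1 t) (u2 t)).
Proof.
move=> S1 s1 S2 s2.
apply: (@measurable_linear_limit (fun t => ip (u1 t)) (fun t => nrm (u1 t))) => //.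
- by move=> t; exact: ip_linear.
- move=> phi Sphi.
  apply: (@measurable_linear_limit (fun t => ip ^~ phi) (fun t => nrm phi)) => //.
  + by move=> t; exact: ip_linearl.
  + by move=> t v Sv; rewrite mulrC; exact: cauchy_schwarz.
- by move=> t v Sv; exact: cauchy_schwarz.
Qed.

Lemma simple_limit_simple s : simple s -> simple_limit s.
Proof.
move=> ss; exists (fun=> s); split => // t.
by rewrite subrr nrm0; exact: cvg_cst.
Qed.

Lemma simple_limitB u1 u2 : (forall t, S (u1 t)) -> (forall t, S (u2 t)) ->
  simple_limit u1 -> simple_limit u2 -> simple_limit (fun t => u1 t - u2 t).
Proof.
move=> S1 S2 [s1 [ss1 su1]] [s2 [ss2 su2]].
exists (fun n t => s1 n t - s2 n t); split; first by move=> n; exact: simple_curveB.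
move=> t; have h : nrm (s1 n t - u1 t) + nrm (s2 n t - u2 t) @[n --> \oo] --> (0 : R).
  by rewrite -[X in _ --> X](addr0 0); exact: (cvgD (su1 t) (su2 t)).
apply: (squeeze_cvgr _ (cvg_cst 0) h); apply: nearW => n.
have D1 := simple_curve_dom t (ss1 n); have D2 := simple_curve_dom t (ss2 n).
have S1t := domB D1 (S1 t); have S2t := domB D2 (S2 t).
have -> : s1 n t - s2 n t - (u1 t - u2 t) = (s1 n t - u1 t) - (s2 n t - u2 t).
  by rewrite !opprB -!addrA; congr (_ + _); rewrite addrCA [in RHS]addrCA; congr (_ + _); rewrite addrC.
rewrite nrm_ge0/= -[X in _ <= _ + X](nrmN S2t).
exact: nrmD S1t (domN S2t).
Qed.

Local Notation mu := (@lebesgue_measure R).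

(** The approximating simple curves need not be dominated. Keeping them only where their norm is at
    most twice that of [u] preserves both simplicity and convergence and makes dominated convergence
    applicable. *)
Lemma simple_dense u (e : R) : 0 < e -> (forall t, S (u t)) -> simple_limit u ->
  mu.-integrable setT (EFin \o (fun t => ip (u t) (u t))) ->
  exists v : R -> V, [/\ simple v,
    mu.-integrable setT (EFin \o (fun t => ip (u t - v t) (u t - v t))) &
    \int[mu]_t ip (u t - v t) (u t - v t) < e].
Proof.
move=> e0 Su su iu; have [s [ss su']] := su.
pose B n := [set t | nrm (s n t) <= 2 * nrm (u t)].
have mnrm f : (forall t, S (f t)) -> simple_limit f -> measurable_fun setT (fun t => nrm (f t)).
  move=> Sf sf; apply: measurableT_comp; last exact: measurable_ip.
  by apply: continuous_measurable_fun; exact: sqrt_continuous.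
have Ss n t : S (s n t) by exact: simple_curve_dom.
have mB n : measurable (B n).
  have m1 : measurable_fun [set: R] (fun t => nrm (s n t) <= 2 * nrm (u t)).
    apply: measurable_fun_ler; first by apply: mnrm => //; exact: simple_limit_simple.
    by apply: measurable_funM => //; exact: mnrm.
  have := m1 measurableT [set true] (ltac:(by [])).
  by rewrite setTI; congr (measurable _); apply/seteqP; split.
pose v n t := \1_(B n) t *: s n t.
have sv n : simple (v n) by exact: simple_curve_indic.
have Sv n t : S (v n t) by exact: simple_curve_dom.
have Suv n t : S (u t - v n t) by exact: domB.
have vB n t : nrm (v n t) <= 2 * nrm (u t).
  rewrite /v indicE; case: (boolP (t \in B n)) => [|_]; first by rewrite inE/= scale1r.
  by rewrite scale0r nrm0 mulr_ge0// nrm_ge0.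
(* The norm of the difference is at most [|u| + 2 |u|]. *)
have dom n t : `|ip (u t - v n t) (u t - v n t)| <= 9 * ip (u t) (u t).
  rewrite ger0_norm ?ip_ge0// -!nrm_sqr// -[9](_ : 3 ^+ 2 = _ :> R); last by rewrite -natrX.
  rewrite -exprMn lerXn2r ?nnegrE ?mulr_ge0 ?nrm_ge0//.
  rewrite (le_trans (nrmD _ _))//; first exact: domN.
  rewrite nrmN//; have := vB n t; lra.
have muv n : measurable_fun setT (fun t => ip (u t - v n t) (u t - v n t)).
  have h : simple_limit (fun t => u t - v n t).
    by apply: simple_limitB => //; exact: simple_limit_simple.
  exact: measurable_ip.
have i9 : mu.-integrable setT (EFin \o (fun t => 9 * ip (u t) (u t))).
  exact: integrableZl iu.
have : \int[mu]_t ip (u t - v n t) (u t - v n t) @[n --> \oo] --> \int[mu]_(t in [set: R]) (0 : R).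
  apply: (@dominated_cvg_Rintegral _ _ R mu setT (fun n t => ip (u t - v n t) (u t - v n t))
    (cst 0) (fun t => 9 * ip (u t) (u t))) => //.
  apply: aeW => t _.
  have h0 : nrm (u t - v n t) @[n --> \oo] --> (0 : R).
    (* If [u t] is a null vector the truncation makes [v n t] null as well. Otherwise the truncation
       is eventually inactive at [t]. *)
    have [u0|u0] := eqVneq (nrm (u t)) 0.
      rewrite (_ : (fun n => _) = cst 0); first exact: cvg_cst.
      apply/funext => n; apply/eqP; rewrite eq_le nrm_ge0 andbT.
      rewrite (le_trans (nrmD _ _))//; first exact: domN.
      by rewrite nrmN// u0 add0r (le_trans (vB n t))// u0 mulr0.
    have up : 0 < nrm (u t) by rewrite lt_neqAle eq_sym u0 nrm_ge0.
    have := su' t; apply: cvg_trans; apply: near_eq_cvg.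
    apply: filterS ((cvgr0Pnorm_lt _).1 (su' t) _ up) => n.
    rewrite ger0_norm ?nrm_ge0// => hn.
    have -> : v n t = s n t.
      rewrite /v indicE mem_set ?scale1r// /B/=.
      have := nrmB_dist (Ss n t) (Su t); rewrite ler_norml => /andP[_ h]; lra.
    by rewrite nrmBC.
  rewrite (_ : (fun n => _) = (fun n => nrm (u t - v n t) * nrm (u t - v n t))).
    by rewrite -[X in _ --> X](mulr0 0); exact: cvgM.
  by apply/funext => n; rewrite -expr2 nrm_sqr.
rewrite Rintegral_cst// mul0r => cv0.
have [n hn] := filter_ex ((cvgr0Pnorm_lt _).1 cv0 _ e0).
exists (v n); split => //.
  by apply: (dominated_integrable_lebesgue _ (muv n) i9) => // t _; exact: dom.
by apply: le_lt_trans hn; exact: ler_norm.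
Qed.

End simple_curves.

End semi_inner_product.

(** * The energy inequality *)

Lemma weighted_young (R : realFieldType) (eta x y : R) : 0 < eta ->
  x * y <= eta * x ^+ 2 + eta^-1 * y ^+ 2.
Proof.
move=> eta0; have etan : eta != 0 by rewrite gt_eqF.
have -> : eta * x ^+ 2 + eta^-1 * y ^+ 2 =
    eta * (x - y / (2 * eta)) ^+ 2 + x * y + 3 / 4 * eta^-1 * y ^+ 2 by field.
have h1 : 0 <= eta * (x - y / (2 * eta)) ^+ 2 by apply: mulr_ge0; [exact: ltW|exact: sqr_ge0].
have h2 : 0 <= 3 / 4 * eta^-1 * y ^+ 2.
  by apply: mulr_ge0; [rewrite mulr_ge0// invr_ge0 ltW|exact: sqr_ge0].
lra.
Qed.

Section energy.
Context {R : realType} {V W : lmodType R}.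
Local Notation mu := (@lebesgue_measure R).
Variables (S : set V) (ipV : V -> V -> R) (SW : set W) (ip : W -> W -> R).
Hypothesis HV : semi_inner_product S ipV.
Hypothesis HW : semi_inner_product SW ip.
Variable j : V -> W.
Hypothesis jP : forall (a : R) v w, j (a *: v + w) = a *: j v + j w.
Hypothesis jS : forall v, S v -> SW (j v).
Hypothesis j_le : forall v, S v -> ip (j v) (j v) <= ipV v v.
Local Notation nrm := (semi_norm ipV).

Variables (T : R) (u : R -> V) (w : R -> V -> R) (b : R -> R) (c : R -> W).
Hypothesis Su : forall t, S (u t).
Hypothesis su : simple_limit (S := S) (ip := ipV) u.
Hypothesis iu : mu.-integrable setT (EFin \o (fun t => ipV (u t) (u t))).
Hypothesis lw : forall t, linear_on S (w t).
Hypothesis wb : forall t v, S v -> `|w t v| <= b t * nrm v.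
Hypothesis mw : forall v, S v -> measurable_fun setT (w^~ v).
Hypothesis ib : mu.-integrable setT (EFin \o b).
Hypothesis ib2 : mu.-integrable setT (EFin \o (fun t => b t ^+ 2)).
Hypothesis Sc : forall t, SW (c t).
Hypothesis cc : forall t, semi_norm ip (c s - c t) @[s --> t] --> (0 : R).
Hypothesis c_init : ip (c 0) (c 0) = 0.
Hypothesis cw : forall phi, S phi -> forall s t, s <= t -> t <= T ->
  ip (c t) (j phi) - ip (c s) (j phi) = \int[mu]_(r in `]s, t[) w r phi.
Hypothesis cu : {ae mu, forall t, t \in `]0, T[ ->
  ip (c t - j (u t)) (c t - j (u t)) = 0}.

Let iw phi : S phi -> mu.-integrable setT (EFin \o w^~ phi).
Proof.
move=> Sphi.
have ibn : mu.-integrable setT (EFin \o (fun t => nrm phi * b t)) by exact: integrableZl ib.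
apply: (dominated_integrable_lebesgue _ _ ibn) => //; first exact: mw.
by move=> t _; rewrite mulrC wb.
Qed.

(** The backward difference quotient of [c] as a functional, where [V], [W] and [j] stand for H^1,
    L^2 and the inclusion. For [r <= T] it is a backward average of [w], which bounds it uniformly
    in [n] after integration. Written through [c] it is linear and continuous in [phi] at every [r],
    which gives measurability along curves. *)
Let D (n : nat) (r : R) (phi : V) : R :=
  n.+1%:R * (ip (c r) (j phi) - ip (c (r - n.+1%:R^-1)) (j phi)).

Let DE n r phi : S phi -> r <= T -> D n r phi = backward_average (w^~ phi) n.+1%:R^-1 r.
Proof.
move=> Sphi rT; rewrite /D cw//; first by rewrite /backward_average invrK.
by rewrite lerBlDr lerDl invr_ge0.
Qed.

Let window_cst (n : nat) (r k : R) :
  n.+1%:R * \int[mu]_(q in `]r - n.+1%:R^-1, r[) k = k.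
Proof.
rewrite Rintegral_cst//= lebesgue_measure_itv/= lte_fin ltrBlDr ltrDl invr_gt0 ltr0n/=.
by rewrite opprB addrC subrK mulrCA divff ?mulr1.
Qed.

(** Young's inequality is applied under the average, where [phi] is constant. It separates [b] from
    [phi], and the part in [b] integrates in [r] to at most the integral of [b ^+ 2], whatever [n]
    is. *)
Let D_bound n r phi eta : 0 < eta -> S phi -> r <= T ->
  `|D n r phi| <= eta * backward_average (fun t => b t ^+ 2) n.+1%:R^-1 r + eta^-1 * ipV phi phi.
Proof.
move=> eta0 Sphi rT; rewrite DE// /backward_average invrK normrM ger0_norm//.
have iS (f : R -> R) : mu.-integrable setT (EFin \o f) ->
   mu.-integrable `]r - n.+1%:R^-1, r[ (EFin \o f) by exact: integrableS.
have ic (k : R) : mu.-integrable `]r - n.+1%:R^-1, r[ (EFin \o (fun=> k)).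
  by apply: (bounded_integrable_itv (M := `|k|)) => //; exact: measurable_cst.
rewrite -[X in _ <= _ + X](window_cst n r) mulrCA -RintegralZl//; last exact: iS.
rewrite -mulrDr -RintegralD//; last exact: integrableZ_lebesgue (iS _ ib2).
rewrite ler_wpM2l//.
apply: le_trans (le_normr_Rintegral _ _) _ => //; first exact/iS/iw.
apply: le_Rintegral => //.
- exact/integrable_norm/iS/iw.
- by apply: integrableD_lebesgue => //; exact: integrableZ_lebesgue (iS _ ib2).
move=> q _; rewrite (le_trans (wb _ Sphi))// -(nrm_sqr HV Sphi).
exact: weighted_young.
Qed.

Let w_bound r phi eta : 0 < eta -> S phi ->
  `|w r phi| <= eta * b r ^+ 2 + eta^-1 * ipV phi phi.
Proof.
move=> eta0 Sphi; rewrite (le_trans (wb _ Sphi))// -(nrm_sqr HV Sphi).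
exact: weighted_young.
Qed.

Let D_lin n r : linear_on S (D n r).
Proof.
move=> a v v' Sv Sv'; rewrite /D jP.
rewrite !(ip_linear HW (Sc _) a (jS Sv) (jS Sv')); ring.
Qed.

Lemma continuous_ip psi : SW psi -> continuous (fun t => ip (c t) psi).
Proof.
move=> Spsi t; apply/subr_cvg0/norm_cvg0P.
have h : semi_norm ip (c s - c t) * semi_norm ip psi @[s --> t] --> (0 : R).
  by rewrite -[X in _ --> X](mul0r (semi_norm ip psi)); apply: cvgM (cc t) _; exact: cvg_cst.
apply: (squeeze_cvgr _ (cvg_cst 0) h); apply: nearW => s.
rewrite normr_ge0/= -(linear_onB HW (ip_linearl HW Spsi))//.
by apply: (cauchy_schwarz HW) => //; exact: (domB HW).
Qed.

Let mD n phi : S phi -> measurable_fun setT (fun t => D n t phi).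
Proof.
move=> Sphi; apply: continuous_measurable_fun => t; apply: cvgM; first exact: cvg_cst.
have cp := continuous_ip (jS Sphi).
apply: cvgB; first exact: cp.
pose G (z : R) : R := ip (c z) (j phi).
apply: (@continuous_comp _ _ _ (fun z : R => z - n.+1%:R^-1) G); last exact: cp.
by apply: cvgB; [exact: cvg_id|exact: cvg_cst].
Qed.

Let D_cont n r phi : S phi -> `|D n r phi| <=
  n.+1%:R * (semi_norm ip (c r) + semi_norm ip (c (r - n.+1%:R^-1))) * nrm phi.
Proof.
move=> Sphi; rewrite /D normrM ger0_norm// -mulrA ler_wpM2l// mulrDl.
have jn : semi_norm ip (j phi) <= nrm phi by rewrite ler_sqrt ?(ip_ge0 HV)//; exact: j_le.
rewrite (le_trans (ler_normB _ _))// lerD//;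
  apply: le_trans (cauchy_schwarz HW (Sc _) (jS Sphi)) _; exact: ler_wpM2l (sqrtr_ge0 _) _ _ jn.
Qed.

Let mDf n f : (forall t, S (f t)) -> simple_limit (S := S) (ip := ipV) f ->
  measurable_fun setT (fun t => D n t (f t)).
Proof.
move=> Sf sf; apply: (measurable_linear_limit HV (D_lin n) (mD n) _ Sf sf).
by move=> t v Sv; exact: D_cont.
Qed.

Let mwf f : (forall t, S (f t)) -> simple_limit (S := S) (ip := ipV) f ->
  measurable_fun setT (fun t => w t (f t)).
Proof. by move=> Sf sf; exact: (measurable_linear_limit HV lw mw wb Sf sf). Qed.

Let avg_b2 n t : mu.-integrable `]0, t[ (EFin \o backward_average (fun t => b t ^+ 2) n.+1%:R^-1) /\
  \int[mu]_(r in `]0, t[) backward_average (fun t => b t ^+ 2) n.+1%:R^-1 r <= \int[mu]_r b r ^+ 2.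
Proof.
have e0 : 0 < n.+1%:R^-1 :> R by rewrite invr_gt0.
exact: (backward_average_le e0 (measurable_itv _) ib2 (fun r => sqr_ge0 (b r))).
Qed.

Let iDf n f t : t <= T -> (forall t, S (f t)) -> simple_limit (S := S) (ip := ipV) f ->
  mu.-integrable setT (EFin \o (fun t => ipV (f t) (f t))) ->
  mu.-integrable `]0, t[ (EFin \o (fun r => D n r (f r))).
Proof.
move=> tT Sf sf iff; have [i1 _] := avg_b2 n t.
have i2 : mu.-integrable `]0, t[ (EFin \o (fun r => ipV (f r) (f r))) by exact: integrableS iff.
have i12 := integrableD_lebesgue (measurable_itv `]0, t[) i1 i2.
apply: (dominated_integrable_lebesgue _ _ i12) => //.
  by apply: measurable_funTS; exact: mDf.
move=> r /=; rewrite in_itv/= => /andP[_ /ltW rt].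
have := @D_bound n r (f r) 1 ltr01 (Sf r) (le_trans rt tT).
by rewrite invr1 !mul1r.
Qed.

Let iwf f : (forall t, S (f t)) -> simple_limit (S := S) (ip := ipV) f ->
  mu.-integrable setT (EFin \o (fun t => ipV (f t) (f t))) ->
  mu.-integrable setT (EFin \o (fun r => w r (f r))).
Proof.
move=> Sf sf iff; have i12 := integrableD_lebesgue measurableT ib2 iff.
apply: (dominated_integrable_lebesgue _ _ i12) => //.
  exact: mwf.
move=> r _; have := @w_bound r (f r) 1 ltr01 (Sf r).
by rewrite invr1 !mul1r.
Qed.

(* On a simple curve the difference quotients are backward averages of the
   functionals at finitely many fixed vectors. *)
Let D_cvg_simple v t : t <= T -> simple_curve S v ->
  \int[mu]_(r in `]0, t[) D n r (v r) @[n --> \oo] --> \int[mu]_(r in `]0, t[) w r (v r).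
Proof.
move=> tT [k [A [phi [mA Sphi ->]]]].
have lsum (l : R -> V -> R) : (forall r, linear_on S (l r)) ->
    (forall i, mu.-integrable `]0, t[ (EFin \o l^~ (phi i))) ->
    \int[mu]_(r in `]0, t[) l r (\sum_(i < k) \1_(A i) r *: phi i) =
    \sum_(i < k) \int[mu]_(r in `]0, t[ `&` A i) l r (phi i).
  move=> ll il.
  under eq_Rintegral do rewrite (linear_on_sum HV _ (ll _) Sphi).
  have il' i : mu.-integrable `]0, t[ (EFin \o (fun r => \1_(A i) r * l r (phi i))).
    apply: (dominated_integrable_lebesgue _ _ (integrable_norm (il i))) => //.
      apply: measurable_funM; first exact: measurable_indic.
      by apply/measurable_EFinP; exact: measurable_int (il i).
    by move=> r _; rewrite normrM ler_piMl// indicE; case: (_ \in _); rewrite ?normr1 ?normr0.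
  have -> : \int[mu]_(x in `]0, t[) (\sum_(i < k) \1_(A i) x * l x (phi i)) =
      \sum_(i < k) \int[mu]_(x in `]0, t[) (\1_(A i) x * l x (phi i)).
    exact: Rintegral_sum.
  apply: eq_bigr => i _; rewrite Rintegral_mkcondr; apply: eq_Rintegral => r _.
  by rewrite patchE indicE; case: (_ \in _); rewrite ?mul1r ?mul0r.
rewrite lsum//; last by move=> i; exact: integrableS (iw (Sphi i)).
rewrite (_ : (fun n => _) = (fun n => \sum_(i < k) \int[mu]_(r in `]0, t[ `&` A i)
    backward_average (w^~ (phi i)) n.+1%:R^-1 r)); last first.
  apply/funext => n; rewrite lsum//; last first.
    move=> i; have [h _] := @backward_average_fubini _ `]0, t[%classic _ n.+1%:R^-1
      ltac:(by rewrite invr_gt0) (measurable_itv _) (iw (Sphi i)).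
    apply: eq_integrable h => // r; rewrite inE/= in_itv/= => /andP[_ /ltW rt].
    by rewrite DE// (le_trans rt).
  apply: eq_bigr => i _; apply: eq_Rintegral => r; rewrite inE/= in_itv/= => -[/andP[_ /ltW rt] _].
  by rewrite DE// (le_trans rt).
apply: cvg_big => [|i _]; first exact: add_continuous.
apply: backward_average_cvg; last exact: iw.
exact: measurableI.
Qed.

(** Stated for a general [l] because it serves both [w] and every [D n], with an error that does not
    depend on [n]. *)
Let integral_perturb (l : R -> V -> R) (g : R -> R) (f v : R -> V) t eta :
  0 < eta -> (forall r, linear_on S (l r)) -> (forall r, S (f r)) -> (forall r, S (v r)) ->
  mu.-integrable `]0, t[ (EFin \o (fun r => l r (f r))) ->
  mu.-integrable `]0, t[ (EFin \o (fun r => l r (v r))) ->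
  mu.-integrable `]0, t[ (EFin \o g) ->
  mu.-integrable setT (EFin \o (fun r => ipV (f r - v r) (f r - v r))) ->
  (forall r, 0 < r < t -> `|l r (f r - v r)| <= eta * g r + eta^-1 * ipV (f r - v r) (f r - v r)) ->
  `|\int[mu]_(r in `]0, t[) l r (f r) - \int[mu]_(r in `]0, t[) l r (v r)| <=
  eta * \int[mu]_(r in `]0, t[) g r + eta^-1 * \int[mu]_r ipV (f r - v r) (f r - v r).
Proof.
move=> eta0 ll Sf Sv ilf ilv ig ifv lg.
have ifv' : mu.-integrable `]0, t[ (EFin \o (fun r => ipV (f r - v r) (f r - v r))).
  exact: integrable_subset_lebesgue.
have Sfv r : S (f r - v r) by exact: (domB HV).
rewrite -RintegralB//.
have il : mu.-integrable `]0, t[ (EFin \o (fun r => l r (f r) - l r (v r))).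
  exact: integrableB_lebesgue.
apply: le_trans (le_normr_Rintegral _ il) _ => //.
have ig' := integrableZ_lebesgue eta (measurable_itv `]0, t[) ig.
have iv' := integrableZ_lebesgue eta^-1 (measurable_itv `]0, t[) ifv'.
apply: (@le_trans _ _ (\int[mu]_(r in `]0, t[) (eta * g r + eta^-1 * ipV (f r - v r) (f r - v r)))).
  apply: le_Rintegral => //; first exact: (integrable_norm il).
    exact: integrableD_lebesgue.
  move=> r /=; rewrite in_itv/= => rt.
  by rewrite -(linear_onB HV (ll r) (Sf r) (Sv r)); exact: lg.
rewrite RintegralD// !RintegralZl// lerD2l ler_wpM2l ?invr_ge0 ?(ltW eta0)//.
by apply: primitive_le => // r; exact: (ip_ge0 HV).
Qed.

Let D_cvg t : t <= T ->
  \int[mu]_(r in `]0, t[) D n r (u r) @[n --> \oo] --> \int[mu]_(r in `]0, t[) w r (u r).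
Proof.
move=> tT; apply/cvgrPdist_lt => e e0.
pose B := \int[mu]_r b r ^+ 2.
have B0 : 0 <= B by apply: Rintegral_ge0 => r _; exact: sqr_ge0.
(* Both error terms of [integral_perturb] become at most [e / 8]: the first by this [eta], the
   second by taking [v] within [eta * (e / 8)] of [u]. Replacing [u] by [v] on both sides costs
   [e / 2], and convergence along [v] costs less than [e / 4]. *)
pose eta := e / (8 * (B + 1)).
have eta0 : 0 < eta by rewrite divr_gt0// mulr_gt0// ltr_wpDl.
have etaB : eta * B <= e / 8.
  rewrite /eta invfM mulrA -mulrA ler_piMr ?divr_ge0 ?(ltW e0)//.
  by rewrite mulrC ler_pdivrMr ?ltr_wpDl// mul1r lerDl.
have [v [sv iuv uv]] := simple_dense HV (mulr_gt0 eta0 (divr_gt0 e0 (ltr0n R 8))) Su su iu.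
have Sv r : S (v r) by exact: (simple_curve_dom HV).
have svl := simple_limit_simple HV sv.
have iv : mu.-integrable setT (EFin \o (fun r => ipV (v r) (v r))).
  have i4 := integrableD_lebesgue measurableT (integrableZ_lebesgue 2 measurableT iu)
    (integrableZ_lebesgue 2 measurableT iuv).
  apply: (dominated_integrable_lebesgue _ _ i4) => //; first exact: (measurable_ip HV).
  move=> r _; rewrite ger0_norm ?(ip_ge0 HV)//.
  have h1 := ip_sqrB HV (Su r) (Sv r).
  have Suv : S (u r + (u r - v r)) by apply: (domD HV) => //; exact: (domB HV).
  have h2 := ip_ge0 HV Suv.
  rewrite (ip_sqrD HV) ?(linear_onB HV (ip_linear HV (Su r)))// in h2; last exact: (domB HV).
  lra.
have uv8 : eta^-1 * \int[mu]_r ipV (u r - v r) (u r - v r) <= e / 8.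
  by rewrite ler_pdivrMl//; exact: ltW.
have ibt : mu.-integrable `]0, t[ (EFin \o (fun r => b r ^+ 2)).
  exact: integrable_subset_lebesgue.
have hw : `|\int[mu]_(r in `]0, t[) w r (u r) - \int[mu]_(r in `]0, t[) w r (v r)| <= e / 8 + e / 8.
  apply: le_trans (integral_perturb eta0 lw Su Sv _ _ ibt iuv _) _.
  - by apply: integrable_subset_lebesgue => //; exact: iwf.
  - by apply: integrable_subset_lebesgue => //; exact: iwf.
  - by move=> r _; apply: w_bound => //; exact: (domB HV).
  rewrite lerD// (le_trans _ etaB)// ler_wpM2l ?(ltW eta0)//.
  by apply: primitive_le => // r; exact: sqr_ge0.
have hD n : `|\int[mu]_(r in `]0, t[) D n r (u r) - \int[mu]_(r in `]0, t[) D n r (v r)| <= e / 8 + e / 8.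
  have [i1 i2] := avg_b2 n t.
  apply: le_trans (integral_perturb eta0 (D_lin n) Su Sv _ _ i1 iuv _) _.
  - exact: iDf.
  - exact: iDf.
  - move=> r /andP[_ /ltW rt]; apply: D_bound => //; first exact: (domB HV).
    exact: le_trans rt tT.
  by rewrite lerD// (le_trans _ etaB)// ler_wpM2l ?(ltW eta0).
have e4 : 0 < e / 4 by rewrite divr_gt0.
apply: filterS ((@cvgrPdist_lt _ R^o _ _ _ _ _).1 (D_cvg_simple tT sv) _ e4) => n hv.
have hDn := hD n.
move: hw hDn hv.
set x1 := \int[mu]_(r in `]0, t[) w r (u r); set x2 := \int[mu]_(r in `]0, t[) w r (v r).
set x3 := \int[mu]_(r in `]0, t[) D n r (u r); set x4 := \int[mu]_(r in `]0, t[) D n r (v r).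
rewrite !ler_norml !ltr_norml => /andP[? ?] /andP[? ?] /andP[? ?].
by apply/andP; split; lra.
Qed.

Let continuous_nrm : continuous (fun t => semi_norm ip (c t)).
Proof.
move=> t; apply/subr_cvg0/norm_cvg0P.
apply: (squeeze_cvgr _ (cvg_cst 0) (cc t)); apply: nearW => s.
by rewrite normr_ge0/=; exact: (nrmB_dist HW).
Qed.

Lemma continuous_energy : continuous (fun t => ip (c t) (c t)).
Proof.
rewrite (_ : (fun t => _) = (fun t => semi_norm ip (c t) * semi_norm ip (c t))).
  by move=> t; apply: cvgM; exact: continuous_nrm.
by apply/funext => t; rewrite -expr2 (nrm_sqr HW).
Qed.

Lemma integrable_power : mu.-integrable setT (EFin \o (fun r => w r (u r))).
Proof. exact: iwf. Qed.

Lemma energy_inequality t : 0 < t -> t <= T ->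
  ip (c t) (c t) <= 2 * \int[mu]_(r in `]0, t[) w r (u r).
Proof.
move=> t0 tT; pose E r := ip (c r) (c r).
have cE : continuous E by exact: continuous_energy.
have lim1 := shift_average cE t0.
have lim2 : 2 * \int[mu]_(r in `]0, t[) D n r (u r) @[n --> \oo] -->
    2 * \int[mu]_(r in `]0, t[) w r (u r) by apply: cvgM (D_cvg tT); exact: cvg_cst.
rewrite /E c_init subr0 in lim1.
apply: (ler_cvg_to lim1 lim2); apply: nearW => n.
have iEE : mu.-integrable `]0, t[ (EFin \o (fun r => E r - E (r - n.+1%:R^-1))).
  apply: (@integrableS _ _ R mu `[0, t]) => //; first exact: subset_itv_oo_cc.
  apply: continuous_compact_integrable; first exact: segment_compact.
  apply: continuous_subspaceT => r; apply: cvgB; first exact: cE.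
  apply: (@continuous_comp _ _ _ (fun z : R => z - n.+1%:R^-1) E); last exact: cE.
  by apply: cvgB; [exact: cvg_id|exact: cvg_cst].
have iD := iDf n tT Su su iu.
rewrite -[leLHS]RintegralZl// -[leRHS]RintegralZl// -subr_ge0.
have iD2 := integrableZ_lebesgue 2 (measurable_itv `]0, t[) iD.
have iE2 := integrableZ_lebesgue n.+1%:R (measurable_itv `]0, t[) iEE.
rewrite -RintegralB//.
(* The integrand is nonnegative only almost everywhere, hence equal almost everywhere to its
   absolute value, whose integral is nonnegative. *)
rewrite (@ae_eq_Rintegral _ _ _ mu _ _ (fun r => `|2 * D n r (u r) - n.+1%:R * (E r - E (r - n.+1%:R^-1))|)).
  exact: Rintegral_ge0.
apply: (ae_imply cu) => r hr; rewrite /= in_itv/= => /andP[r0 rt].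
rewrite ger0_norm//.
have {}hr : ip (c r - j (u r)) (c r - j (u r)) = 0.
  by apply: hr; rewrite in_itv/= r0 (lt_le_trans rt).
have Sju : SW (j (u r)) by exact: jS.
(* [c r - j (u r)] is a null vector, hence orthogonal to everything by Cauchy-Schwarz. *)
have key x : SW x -> ip x (j (u r)) = ip x (c r).
  move=> Sx; apply/esym/eqP; rewrite -subr_eq0 -(linear_onB HW (ip_linear HW Sx))//.
  have := cauchy_schwarz_sqr HW Sx (domB HW (Sc r) Sju).
  rewrite hr mulr0 => h; rewrite -sqrf_eq0 eq_le h/= sqr_ge0 //.
rewrite /D !key// mulrCA -mulrBr mulr_ge0//.
have := ip_ge0 HW (domB HW (Sc r) (Sc (r - n.+1%:R^-1))).
rewrite (ip_sqrB HW)// (semi_ipC HW (Sc (r - n.+1%:R^-1)) (Sc r)) /E; lra.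
Qed.

End energy.

(** * Borel sets of R^n *)

Section countable_base.
Context d (X : measurableType d) (R : realType) (J : finType).
Variables (D : set X) (w : J -> X -> R).
Hypothesis mD : measurable D.
Hypothesis mw : forall i, measurable_fun D (w i).

(* D `&` P is the union of the countably many sets of points whose w-coordinates lie
   in a rational cube contained in P. *)
Lemma measurable_coord_open (P : set X) :
  (forall x, D x -> P x -> exists2 e : R, 0 < e &
    forall y, D y -> (forall i, `|w i y - w i x| < e) -> P y) ->
  measurable (D `&` P).
Proof.
move=> oP.
pose C (p : {ffun J -> rat} * nat) : set X :=
  D `&` [set x | forall i, `|w i x - ratr (p.1 i)| < p.2.+1%:R^-1].
pose F p : set X := if `[< C p `<=` P >] then C p else set0.
have mC p : measurable (C p).
  have -> : C p = D `&` \bigcap_(i in [set: J]) (D `&` (w i) @^-1`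
      `]ratr (p.1 i) - p.2.+1%:R^-1, ratr (p.1 i) + p.2.+1%:R^-1[).
    apply/seteqP; split => x [Dx h]; split => //.
      by move=> i _; split => //=; rewrite in_itv/=; have := h i; rewrite ltr_distl.
    by move=> i; have [_ /=] := h i I; rewrite in_itv/= ltr_distl.
  apply: measurableI => //; apply: fin_bigcap_measurable => // i _.
  exact: mw.
have -> : D `&` P = \bigcup_p F p.
  apply/seteqP; split => [x [Dx Px]|x [p _]]; last first.
    by rewrite /F; case: asboolP => // CP Cx; split; [case: Cx|exact: CP].
  have [e e0 eP] := oP x Dx Px.
  (* Two points of one cube differ in each coordinate by less than twice this radius. *)
  have [k ke] : exists k, k.+1%:R^-1 < e / 2.
    have e2 : 0 < e / 2 by rewrite divr_gt0.
    have [k hk] := filter_ex ((cvgr0Pnorm_lt _).1 (@cvg_harmonic R) _ e2).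
    by exists k; apply: le_lt_trans hk; exact: ler_norm.
  have k0 : 0 < k.+1%:R^-1 :> R by rewrite invr_gt0.
  have q_ i : exists q : rat, `|w i x - ratr q| < k.+1%:R^-1.
    have /rat_in_itvoo[q] : w i x - k.+1%:R^-1 < w i x + k.+1%:R^-1.
      by rewrite ltrBlDr -addrA ltrDl addr_gt0.
    by rewrite in_itv/= -ltr_distl distrC => hq; exists q.
  pose q := [ffun i => sval (cid (q_ i))].
  have Cx : C (q, k) x.
    by split => // i /=; rewrite ffunE; exact: (svalP (cid (q_ i))).
  exists (q, k) => //; rewrite /F asboolT// => y [Dy hy]; apply: eP => // i.
  have h1 := hy i; have h2 := Cx.2 i; rewrite /= in h1 h2.
  rewrite -(subrKA (ratr (q i))) (le_lt_trans (ler_normD _ _))//.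
  rewrite [`|ratr _ - _|]distrC (lt_trans (ltrD h1 h2))// [ltRHS]splitr.
  exact: ltrD.
apply: countable_bigcupT_measurable => // p.
by rewrite /F; case: asboolP.
Qed.

(** Superlevel sets are open in the coordinates [w], which are merely measurable. This covers
    continuous functions on ['rV[R]_n] as well as [f] composed with a Sobolev function and its
    gradient. *)
Lemma measurable_coord_continuous (g : X -> R) :
  (forall x e, D x -> 0 < e -> exists2 d : R, 0 < d &
    forall y, D y -> (forall i, `|w i y - w i x| < d) -> `|g y - g x| < e) ->
  measurable_fun D g.
Proof.
move=> gc; apply: (measurability _ (RGenOInfty.measurableE R)) => //.
move=> _ [_ [r ->] <-]; apply: measurable_coord_open => x Dx /=.
rewrite in_itv/= andbT => rg.
have [|d0 d00 dg] := gc x (g x - r) Dx; first by rewrite subr_gt0.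
exists d0 => // y Dy hy; rewrite in_itv/= andbT.
have := dg y Dy hy; rewrite ltr_distl; lra.
Qed.

End countable_base.

Section rV_topology.
Context {R : realType} {n : nat}.
Implicit Types (v : 'rV[R]_n).

Lemma rV_norm_lt v (e : R) : 0 < e -> (forall i, `|v ord0 i| < e) -> `|v| < e.
Proof.
move=> e0 ve; rewrite /Num.norm/= mx_normrE; apply/bigmax_ltP; split => // -[i k] _ /=.
by rewrite (ord1 i).
Qed.

Lemma open_measurable_rV (U : set 'rV[R]_n) : open U -> measurable U.
Proof.
move=> oU; rewrite -[U]setTI.
apply: (@measurable_coord_open _ _ R 'I_n setT (fun i => rV_coord i)) => //.
  by move=> i; exact: measurable_rV_coord.
move=> x _ Ux; have /nbhs_ballP[e /= e0 eU] := open_nbhs_nbhs (conj oU Ux).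
exists e => // y _ yx; apply: eU; rewrite mx_norm_ball /ball_/=.
by apply: rV_norm_lt => // i; rewrite !mxE distrC; exact: yx.
Qed.

Lemma continuous_measurable_rV (f : 'rV[R]_n -> R) : continuous f -> measurable_fun setT f.
Proof.
move=> cf; apply: (@measurable_coord_continuous _ _ R 'I_n setT (fun i => rV_coord i)) => //.
  by move=> i; exact: measurable_rV_coord.
move=> x e _ e0; have [d0 /= d00 dU] := (nbhs_ballP _ _).1 ((@cvgrPdist_lt _ R^o _ _ _ _ _).1 (cf x) _ e0).
exists d0 => // y _ yx; rewrite distrC; apply: dU; rewrite mx_norm_ball /ball_/=.
by apply: rV_norm_lt => // i; rewrite !mxE distrC; exact: yx.
Qed.

End rV_topology.

Section rV_measure.
Context {R : realType}.

Definition rV_cube n (M : R) : set 'rV[R]_n := [set v | forall i, `|v ord0 i| <= M].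

Lemma measurable_rV_cube n M : measurable (@rV_cube n M).
Proof.
have -> : @rV_cube n M = \bigcap_(i in [set: 'I_n]) (setT `&` (rV_coord i) @^-1` `[- M, M]).
  apply/seteqP; split => v h.
    by move=> i _; split => //=; rewrite in_itv/= -ler_norml; exact: h.
  by move=> i; have [_ /=] := h i I; rewrite in_itv/= -ler_norml.
by apply: fin_bigcap_measurable => // i _; exact: measurable_rV_coord.
Qed.

Lemma lebesgue_rV_cube_lty n M : (lebesgue_rV n (@rV_cube n M) < +oo)%E.
Proof.
elim: n => [|n IH]; first by rewrite /= diracE; case: (_ \in _); rewrite ltry.
rewrite /= /lebesgue_rV_step /pushforward.
have -> : @rV_cons R n @^-1` rV_cube M = `[- M, M] `*` rV_cube M.
  apply/seteqP; split => -[x v] /= h.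
    split; first by have := h ord0; rewrite mxE unlift_none/= in_itv/= -ler_norml.
    by move=> i; have := h (lift ord0 i); rewrite mxE liftK.
  case: h => /= hx hv i; rewrite mxE; case: (unliftP ord0 i) => [k _|_] /=; first exact: hv.
  by move: hx; rewrite in_itv/= -ler_norml.
rewrite product_measure1E//; last exact: measurable_rV_cube.
have fin : @lebesgue_measure R `[- M, M] \is a fin_num.
  by rewrite lebesgue_measure_itv/=; case: ifP => _; rewrite -?EFinB.
by rewrite lte_mul_pinfty.
Qed.

Lemma bounded_lebesgue_rV_lty n (A : set 'rV[R]_n) : measurable A -> bounded_set A ->
  (lebesgue_rV n A < +oo)%E.
Proof.
move=> mA [M [_ AM]].
apply: le_lt_trans (lebesgue_rV_cube_lty n (M + 1)).
apply: le_measure; rewrite ?inE//; first exact: measurable_rV_cube.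
move=> v Av i; have := AM (M + 1) (ltr_pwDr ltr01 (lexx M)) v Av.
by apply: le_trans; rewrite /Num.norm/= mx_normrE; apply/bigmax_geP; right; exists (ord0, i).
Qed.

End rV_measure.

(** * The spaces L^2 and H^1 *)

Section L2_space.
Context d (T : measurableType d) (R : realType) (mu : {measure set T -> \bar R}).
Variable D : set T.
Hypothesis mD : measurable D.
Local Notation L2 := (L2 mu D).
Local Notation L2ip := (L2ip mu D).
Implicit Types f g : T -> R.

Lemma L2_integrable_sqr f : L2 f -> mu.-integrable D (EFin \o (fun x => f x ^+ 2)).
Proof.
move=> [mf f2]; apply/integrableP; split.
  by apply/measurable_EFinP; exact: measurable_funX.
by under eq_integral do rewrite /= ger0_norm ?sqr_ge0//.
Qed.

Lemma L2_of_le f g : measurable_fun D f -> mu.-integrable D (EFin \o g) ->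
  (forall x, D x -> f x ^+ 2 <= g x) -> L2 f.
Proof.
move=> mf ig fg; split => //.
have : mu.-integrable D (EFin \o (fun x => f x ^+ 2)).
  apply: dominated_integrable_real ig _ => //; first exact: measurable_funX.
  by move=> x Dx; rewrite ger0_norm ?sqr_ge0// fg.
exact: integrable_lty.
Qed.

Lemma L2_integrableM f g : L2 f -> L2 g -> mu.-integrable D (EFin \o (fun x => f x * g x)).
Proof.
move=> Lf Lg.
have ifg := integrableD_real mD (L2_integrable_sqr Lf) (L2_integrable_sqr Lg).
apply: (dominated_integrable_real _ _ ifg) => //.
  by apply: measurable_funM; [case: Lf|case: Lg].
move=> x _; rewrite normrM.
have := weighted_young `|f x| `|g x| (@ltr01 R).
by rewrite invr1 !mul1r !real_normK ?num_real.
Qed.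

Lemma L2_semi_inner : semi_inner_product L2 L2ip.
Proof.
split.
- split; first exact: measurable_cst.
  by rewrite integral0_eq ?ltry// => x _; rewrite [X in X%:E](_ : _ = 0 ^+ 2)// expr0n.
- move=> a f g Lf Lg.
  have i1 := integrableZ_real (2 * a ^+ 2) mD (L2_integrable_sqr Lf).
  have i2 := integrableZ_real 2 mD (L2_integrable_sqr Lg).
  apply: L2_of_le (integrableD_real mD i1 i2) _.
    apply: measurable_funD; last by case: Lg.
    by apply: measurable_funM; [exact: measurable_cst|case: Lf].
  move=> x _; rewrite [X in X ^+ 2 <= _](_ : _ = a * f x + g x)//.
  have -> : 2 * a ^+ 2 * f x ^+ 2 + 2 * g x ^+ 2 =
    (a * f x + g x) ^+ 2 + (a * f x - g x) ^+ 2 by ring.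
  by rewrite lerDl sqr_ge0.
- by move=> f g _ _; apply: eq_Rintegral => x _; rewrite mulrC.
- move=> a f g k Lf Lg Lk; rewrite /L2ip.
  rewrite -RintegralZl//; last exact: L2_integrableM.
  rewrite -RintegralD//; last 2 first.
  + exact: integrableZ_real (L2_integrableM Lf Lk).
  + exact: L2_integrableM.
  by apply: eq_Rintegral => x _; rewrite fctE /GRing.scale/= mulrDl mulrA.
- by move=> f _; apply: Rintegral_ge0 => x _; rewrite -expr2 sqr_ge0.
Qed.

Lemma L2ip_ae f g f' g' : {ae mu, forall x, D x -> f x = f' x} ->
  {ae mu, forall x, D x -> g x = g' x} -> L2ip f g = L2ip f' g'.
Proof.
move=> ff gg; apply: ae_eq_Rintegral; apply: (ae_imply (ae_and ff gg)) => x [fx gx] Dx.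
by rewrite fx// gx.
Qed.

Lemma L2ip_ae0 f : {ae mu, forall x, D x -> f x = 0} -> L2ip f f = 0.
Proof.
move=> f0; rewrite (L2ip_ae (f' := cst 0) (g' := cst 0) f0 f0).
by rewrite /L2ip; under eq_Rintegral do rewrite mul0r; rewrite Rintegral_cst// mul0r.
Qed.

Lemma L2_ae f g : measurable_fun D g -> L2 f -> {ae mu, forall x, D x -> f x = g x} -> L2 g.
Proof.
move=> mg [mf f2] fg; split => //.
rewrite -(@ae_eq_integral_nonmeasurable _ _ _ mu D (fun x => (f x ^+ 2)%:E))//.
by apply: (ae_imply fg) => x h Dx; rewrite h.
Qed.

Lemma L2ip0_ae f : L2 f -> L2ip f f = 0 -> {ae mu, forall x, D x -> f x = 0}.
Proof.
move=> Lf f0.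
have i2 := L2_integrable_sqr Lf.
have : (\int[mu]_(x in D) `|(f x ^+ 2)%:E| = 0)%E.
  under eq_integral do rewrite /= ger0_norm ?sqr_ge0//.
  rewrite -[LHS]fineK; last exact: integrable_fin_num.
  by congr (_%:E); rewrite -[RHS]f0; apply: eq_Rintegral => x _; rewrite expr2.
move/ae_eq_integral_abs => h.
have {}h := h mD (measurable_int _ i2).
by apply: (ae_imply h) => x hx Dx; have := hx Dx => -[] /eqP; rewrite sqrf_eq0 => /eqP.
Qed.

Lemma L2_cst (k : R) : (mu D < +oo)%E -> L2 (cst k).
Proof.
move=> muD; apply: (@L2_of_le _ (cst (k ^+ 2))) => //.
apply/integrableP; split; first exact/measurable_EFinP.
rewrite (eq_integral (cst (`|k ^+ 2|)%:E))// integral_cst//= lte_mul_pinfty//.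
Qed.

Lemma L2_bounded f M : (mu D < +oo)%E -> measurable_fun D f ->
  (forall x, D x -> `|f x| <= M) -> L2 f.
Proof.
move=> muD mf fM; apply: (@L2_of_le _ (cst (M ^+ 2))) => //.
  apply/integrableP; split; first exact/measurable_EFinP.
  rewrite (eq_integral (cst (`|M ^+ 2|)%:E))// integral_cst//= lte_mul_pinfty//.
move=> x Dx; rewrite -real_normK ?num_real//= lerXn2r ?nnegrE ?fM//.
exact: le_trans (normr_ge0 _) (fM x Dx).
Qed.

End L2_space.

Section H1_space.
Context {R : realType} {n : nat}.
Variable Om : set 'rV[R]_n.
Hypothesis oOm : open Om.
Hypothesis bOm : bounded_set Om.
Local Notation leb := (@lebesgue_rV R n).
Local Notation ip := (L2ip leb Om).

Let mOm : measurable Om. Proof. exact: open_measurable_rV. Qed.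

Let fOm : (leb Om < +oo)%E. Proof. exact: bounded_lebesgue_rV_lty. Qed.

(** Its [semi_norm] unfolds to [H1norm Om], so results on semi-inner products apply to the given
    spaces by conversion. *)
Definition H1ip (v w : sobolev_pair R n) : R := ip v.1 w.1 + gradip Om v w.

Definition partial_component (i : 'I_n) (v : sobolev_pair R n) : 'rV[R]_n -> R :=
  fun x => v.2 x ord0 i.

Lemma H1_L2 v : H1 Om v -> L2 leb Om v.1. Proof. by case. Qed.

Lemma H1_partial_L2 i v : H1 Om v -> L2 leb Om (partial_component i v).
Proof. by case=> _ h _; exact: h. Qed.

Lemma gradipE v w : H1 Om v -> H1 Om w ->
  gradip Om v w = \sum_(i < n) ip (partial_component i v) (partial_component i w).
Proof.
move=> Hv Hw; rewrite /gradip -Rintegral_sum// => i.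
by apply: L2_integrableM => //; exact: H1_partial_L2.
Qed.

(** Off the compact [K] every iterated derivative is that of a function vanishing nearby, because
    the complement is open; on [K] continuity bounds it. *)
Lemma test_function_bounded (psi : 'rV[R]_n -> R) vs : test_function Om psi ->
  let f := foldr (fun v g => 'D_v g) psi vs in continuous f /\ exists M, forall x, `|f x| <= M.
Proof.
move=> [spsi [K [cK KO psiK]]] f.
have cf : continuous f by move=> x; apply: differentiable_continuous; exact: spsi.
split => //.
have clK : closed K by apply: compact_closed => //; exact: norm_hausdorff.
have fK x : ~ K x -> f x = 0.
  move=> nKx; have : \forall y \near x, ~ K y.
    by apply: open_nbhs_nbhs; split => //; exact: closed_openC.
  rewrite /f; elim: vs {f cf} x nKx => [x /psiK//|v vs IH] x nKx nK /=.
  rewrite (@near_eq_derive _ _ _ _ (cst 0)); first by rewrite derive_cst.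
  by apply: filterS nK => y nKy; rewrite IH//; apply: open_nbhs_nbhs; split => //; exact: closed_openC.
have [M [_ KM]] := compact_bounded (continuous_compact (continuous_subspaceT cf) cK).
exists (`|M| + 1) => x; have [Kx|nKx] := pselect (K x); last by rewrite fK// normr0.
by apply: KM; [rewrite (le_lt_trans (ler_norm M))// ltrDl|exists x].
Qed.

Lemma test_function_L2 psi vs : test_function Om psi ->
  L2 leb Om (foldr (fun v g => 'D_v g) psi vs).
Proof.
move=> tpsi; have [cf [M fM]] := test_function_bounded vs tpsi.
apply: (@L2_bounded _ _ _ _ _ _ _ M) => //.
by apply: measurable_funTS; exact: continuous_measurable_rV.
Qed.

(** The weak gradient identity is stable under linear combinations because the integrals are
    additive. Their integrability comes from the test functions and their partial derivatives lying
    in L^2. *)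
Lemma H1_semi_inner : semi_inner_product (H1 Om) H1ip.
Proof.
have HL := L2_semi_inner leb mOm.
have cmpP i a v w : partial_component i (a *: v + w) =
    a *: partial_component i v + partial_component i w.
  by apply/funext => x; rewrite /partial_component !fctE !mxE.
have H1P (a : R) v w : H1 Om v -> H1 Om w -> H1 Om (a *: v + w).
  move=> Hv Hw; split.
  - exact: (semi_ip_domP HL a (H1_L2 Hv) (H1_L2 Hw)).
  - move=> i; have := semi_ip_domP HL a (H1_partial_L2 i Hv) (H1_partial_L2 i Hw).
    by rewrite -cmpP.
  - move=> psi tpsi i.
    have Lpsi := test_function_L2 [::] tpsi.
    have Ldpsi := test_function_L2 [:: delta_mx ord0 i] tpsi.
    have h1 := semi_ipP HL a (H1_L2 Hv) (H1_L2 Hw) Ldpsi.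
    have h2 := semi_ipP HL a (H1_partial_L2 i Hv) (H1_partial_L2 i Hw) Lpsi.
    rewrite -cmpP in h2.
    case: Hv => _ _ /(_ psi tpsi i) hv; case: Hw => _ _ /(_ psi tpsi i) hw.
    transitivity (ip (a *: v.1 + w.1) (rV_partial i psi)) => //.
    rewrite [LHS]h1.
    transitivity (- ip (partial_component i (a *: v + w)) psi) => //.
    rewrite [X in - X]h2 /L2ip.
    by rewrite [X in a * X]hv [X in _ + X]hw mulrN opprD.
have H10 : H1 Om 0.
  split.
  - exact: (semi_ip_dom0 HL).
  - move=> i; rewrite (_ : (fun x => _) = 0); first exact: (semi_ip_dom0 HL).
    by apply/funext => x; rewrite /= mxE.
  - move=> psi _ i; rewrite [LHS](@eq_Rintegral _ _ _ _ _ (cst 0)); last first.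
      by move=> x _; rewrite mul0r.
    rewrite [X in - X](@eq_Rintegral _ _ _ _ _ (cst 0)); last first.
      by move=> x _; rewrite mxE mul0r.
    by rewrite Rintegral_cst// mul0r oppr0.
split => //.
- move=> v w Hv Hw; rewrite /H1ip (semi_ipC HL (H1_L2 Hv) (H1_L2 Hw)); congr (_ + _).
  by rewrite !gradipE//; apply: eq_bigr => i _; apply: (semi_ipC HL); exact: H1_partial_L2.
- move=> a v w x Hv Hw Hx; rewrite /H1ip (semi_ipP HL a (H1_L2 Hv) (H1_L2 Hw) (H1_L2 Hx)).
  rewrite !gradipE//; last exact: H1P.
  rewrite [X in _ + X = _](_ : _ = a * \sum_(i < n) ip (partial_component i v) (partial_component i x) +
      \sum_(i < n) ip (partial_component i w) (partial_component i x)); first by ring.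
  rewrite mulr_sumr -big_split/=; apply: eq_bigr => i _.
  by rewrite cmpP; apply: (semi_ipP HL); exact: H1_partial_L2.
- move=> v Hv; rewrite addr_ge0 ?(semi_ip_ge0 HL (H1_L2 Hv))//.
  by rewrite gradipE// sumr_ge0// => i _; apply: (semi_ip_ge0 HL); exact: H1_partial_L2.
Qed.

Lemma gradip_semi_inner : semi_inner_product (H1 Om) (gradip Om).
Proof.
have HL := L2_semi_inner leb mOm; have HH := H1_semi_inner.
have E v w : gradip Om v w = H1ip v w - ip v.1 w.1 by rewrite /H1ip addrAC subrr add0r.
split.
- exact: semi_ip_dom0 HH.
- exact: semi_ip_domP HH.
- by move=> v w Hv Hw; rewrite !E (semi_ipC HH Hv Hw) (semi_ipC HL (H1_L2 Hv) (H1_L2 Hw)).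
- move=> a v w x Hv Hw Hx; rewrite !E (semi_ipP HH a Hv Hw Hx).
  by rewrite (semi_ipP HL a (H1_L2 Hv) (H1_L2 Hw) (H1_L2 Hx)); ring.
- move=> v Hv; rewrite gradipE// sumr_ge0// => i _.
  by apply: (semi_ip_ge0 HL); exact: H1_partial_L2.
Qed.

End H1_space.

(** * The nonlinear term *)

Section source_term.
Context {R : realType} {n : nat}.
Variables (Om : set 'rV[R]_n) (T : R) (f : 'rV[R]_n -> R -> R -> 'rV[R]_n -> R).
Hypothesis oOm : open Om.
Hypothesis bOm : bounded_set Om.
Local Notation leb := (@lebesgue_rV R n).
Local Notation ip := (L2ip leb Om).

Let mOm : measurable Om. Proof. exact: open_measurable_rV. Qed.

Let fOm : (leb Om < +oo)%E. Proof. exact: bounded_lebesgue_rV_lty. Qed.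

Lemma lipschitz_cst :
  [lipschitz (f z.1.1.1 z.1.1.2 z.1.2 z.2) | z in
     [set z : 'rV[R]_n * R * R * 'rV[R]_n | Om z.1.1.1 /\ z.1.1.2 \in `[0, T]] ] ->
  exists2 L : R, 0 < L & forall (t : R) x y a b p q, t \in `[0, T] -> Om x -> Om y ->
    `|f x t a p - f y t b q| <= L * Num.max `|x - y| (Num.max `|a - b| `|p - q|).
Proof.
move=> hf; near (pinfty_nbhs R) => L; exists L => // t x y a b p q tT Ox Oy.
pose A := [set z : 'rV[R]_n * R * R * 'rV[R]_n | Om z.1.1.1 /\ z.1.1.2 \in `[0, T]].
pose F (z : 'rV[R]_n * R * R * 'rV[R]_n) := f z.1.1.1 z.1.1.2 z.1.2 z.2.
have hL : forall zz, (A `*` A) zz -> `|F zz.1 - F zz.2| <= L * `|zz.1 - zz.2|.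
  by near: L; exact: hf.
have /= := hL ((x, t, a, p), (y, t, b, q)) (conj (conj Ox tT) (conj Oy tT)).
move/le_trans; apply; rewrite ler_wpM2l// !prod_normE/= subrr normr0.
by rewrite !maxA [Num.max _ 0]max_l// maxA.
Unshelve. all: by end_near. Qed.

Variable L : R.
Hypothesis L0 : 0 < L.
Hypothesis fL : forall (t : R) x y a b p q, t \in `[0, T] -> Om x -> Om y ->
    `|f x t a p - f y t b q| <= L * Num.max `|x - y| (Num.max `|a - b| `|p - q|).

(** The norm on the left is the supremum norm of the Lipschitz condition; the sum is the Euclidean
    square behind [gradip]. *)
Lemma rV_norm_sqr_le (p : 'rV[R]_n) : `|p| ^+ 2 <= \sum_(i < n) p ord0 i ^+ 2.
Proof.
have [->|p0] := eqVneq p 0; first by rewrite normr0 expr0n sumr_ge0// => i _; exact: sqr_ge0.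
have [[k i] /= pE] : exists i, `|p| = `|p i.1 i.2|.
  by apply: mx_norm_neq0; move: p0; rewrite -normr_eq0.
rewrite pE (ord1 k) real_normK ?num_real// (bigD1 i)//= lerDl sumr_ge0// => l _.
exact: sqr_ge0.
Qed.

Lemma source_sqr_le (t : R) x a b p q : t \in `[0, T] -> Om x ->
  (f x t a p - f x t b q) ^+ 2 <=
  L ^+ 2 * ((a - b) ^+ 2 + \sum_(i < n) (p ord0 i - q ord0 i) ^+ 2).
Proof.
move=> tT Ox; have := @fL t x x a b p q tT Ox Ox.
rewrite subrr normr0 max_r; last by rewrite le_max normr_ge0.
move=> h; rewrite -[leLHS]real_normK ?num_real//.
have h2 : `|f x t a p - f x t b q| ^+ 2 <= (L * Num.max `|a - b| `|p - q|) ^+ 2.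
  by rewrite lerXn2r ?nnegrE// mulr_ge0 ?(ltW L0)// le_max normr_ge0.
rewrite (le_trans h2)// exprMn ler_wpM2l ?sqr_ge0//.
have hp : `|p - q| ^+ 2 <= \sum_(i < n) (p ord0 i - q ord0 i) ^+ 2.
  by rewrite (le_trans (rV_norm_sqr_le _))// ler_sum// => i _; rewrite !mxE.
have s0 : 0 <= \sum_(i < n) (p ord0 i - q ord0 i) ^+ 2.
  by rewrite sumr_ge0// => i _; exact: sqr_ge0.
have [_|_] := leP `|a - b| `|p - q|; first by rewrite (le_trans hp)// lerDr sqr_ge0.
by rewrite real_normK ?num_real// lerDl.
Qed.

Lemma measurable_source (t : R) (v : sobolev_pair R n) : t \in `[0, T] -> H1 Om v ->
  measurable_fun Om (fun x => f x t (v.1 x) (v.2 x)).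
Proof.
move=> tT [[mv _] Hv _].
pose w (i : 'I_n + (unit + 'I_n)) : 'rV[R]_n -> R := match i with
  | inl i => rV_coord i | inr (inl _) => v.1 | inr (inr i) => fun x => v.2 x ord0 i end.
apply: (@measurable_coord_continuous _ _ R _ Om w) => //.
  case=> [i|[_|i]] /=; [|exact: mv|by case: (Hv i)].
  by apply: measurable_funTS; exact: measurable_rV_coord.
move=> x e Ox e0; exists (e / (L + 1)); first by rewrite divr_gt0// addr_gt0.
have d0 : 0 < e / (L + 1) by rewrite divr_gt0// addr_gt0.
move=> y Oy hy.
apply: le_lt_trans (fL _ _ _ _ tT Oy Ox) _.
have : Num.max `|y - x| (Num.max `|v.1 y - v.1 x| `|v.2 y - v.2 x|) < e / (L + 1).
  rewrite !gt_max; apply/and3P; split.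
  - by apply: rV_norm_lt => // i; rewrite !mxE; exact: (hy (inl i)).
  - exact: (hy (inr (inl tt))).
  - by apply: rV_norm_lt => // i; rewrite !mxE; exact: (hy (inr (inr i))).
rewrite ltr_pdivlMr ?addr_gt0// mulrDr mulr1 [L * _]mulrC => h.
by apply: le_lt_trans h; rewrite lerDl !le_max normr_ge0.
Qed.

Lemma source_L2 (t : R) (v : sobolev_pair R n) : t \in `[0, T] -> H1 Om v ->
  L2 leb Om (fun x => f x t (v.1 x) (v.2 x)).
Proof.
move=> tT Hv; have HL := L2_semi_inner leb mOm.
have H0 : H1 Om 0 by exact: (semi_ip_dom0 (H1_semi_inner oOm bOm)).
have m0 := measurable_source tT H0; have mv := measurable_source tT Hv.
(* [f(x, t, v, grad v)] is split at [f(x, t, 0, 0)]: this part is bounded, as [Om] is bounded and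
   [f] is Lipschitz in [x], and the rest is controlled by [v] in H^1. *)
have LG : L2 leb Om (fun x => f x t 0 0).
  have [->|/set0P[x0 Ox0]] := eqVneq Om set0.
    by split; [exact: measurable_fun_set0|rewrite integral_set0 ltry].
  have [M [_ OM]] := bOm.
  apply: (@L2_bounded _ _ _ _ _ mOm _ (`|f x0 t 0 0| + L * ((`|M| + 1) + `|x0|))) => //.
  move=> x Ox; have := fL 0 0 0 0 tT Ox Ox0; rewrite !subrr !normr0 maxxx max_l// => h.
  rewrite -(subrK (f x0 t 0 0) (f x t 0 0)) (le_trans (ler_normD _ _))// addrC lerD2l.
  rewrite (le_trans h)// ler_wpM2l ?(ltW L0)// (le_trans (ler_normB _ _))// lerD2r.
  by apply: OM => //; rewrite (le_lt_trans (ler_norm M))// ltrDl.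
have LD : L2 leb Om (fun x => f x t (v.1 x) (v.2 x) - f x t 0 0).
  have i1 := L2_integrable_sqr (H1_L2 Hv).
  have i2 := integrable_sum_real mOm (fun i => L2_integrable_sqr (H1_partial_L2 i Hv)).
  apply: L2_of_le (integrableZ_real (L ^+ 2) mOm (integrableD_real mOm i1 i2)) _ => //.
    exact: measurable_funB.
  move=> x Ox; apply: le_trans (source_sqr_le _ _ _ _ tT Ox) _.
  by rewrite subr0 ler_wpM2l ?sqr_ge0// lerD2l ler_sum// => i _; rewrite mxE subr0.
have := semi_ip_domP HL 1 LD LG; congr (L2 leb Om _).
by apply/funext => x; rewrite scale1r !fctE subrK.
Qed.

Lemma source_lipschitz (t : R) (v w : sobolev_pair R n) : t \in `[0, T] -> H1 Om v -> H1 Om w ->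
  ip ((fun x => f x t (v.1 x) (v.2 x)) - (fun x => f x t (w.1 x) (w.2 x)))
     ((fun x => f x t (v.1 x) (v.2 x)) - (fun x => f x t (w.1 x) (w.2 x))) <=
  L ^+ 2 * H1ip Om (v - w) (v - w).
Proof.
move=> tT Hv Hw; have HL := L2_semi_inner leb mOm; have HH := H1_semi_inner oOm bOm.
have LF := domB HL (source_L2 tT Hv) (source_L2 tT Hw).
have Hvw : H1 Om (v - w) by exact: (domB HH).
have i1 := L2_integrableM mOm (H1_L2 Hvw) (H1_L2 Hvw).
have i2 i := L2_integrableM mOm (H1_partial_L2 i Hvw) (H1_partial_L2 i Hvw).
rewrite /H1ip gradipE// {2 3}/L2ip -Rintegral_sum// -RintegralD//; last exact: integrable_sum_real.
rewrite -RintegralZl//; last first.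
  by apply: integrableD_real => //; exact: integrable_sum_real.
apply: le_Rintegral => //.
- exact: L2_integrableM.
- by apply: integrableZ_real => //; apply: integrableD_real => //; exact: integrable_sum_real.
move=> x Ox; rewrite -expr2; apply: le_trans (source_sqr_le _ _ _ _ tT Ox) _.
rewrite ler_wpM2l ?sqr_ge0//= -expr2 lerD2l ler_sum// => i _.
by rewrite -expr2 /partial_component /= !mxE.
Qed.

End source_term.

(** * Convolution in time *)

Lemma L2_cauchy_schwarz_abs d (T : measurableType d) (R : realType)
    (mu : {measure set T -> \bar R}) (D : set T) (f g : T -> R) : measurable D ->
  L2 mu D f -> L2 mu D g ->
  (\int[mu]_(x in D) `|f x * g x|%:E <=
    (semi_norm (L2ip mu D) f * semi_norm (L2ip mu D) g)%:E)%E.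
Proof.
move=> mD Lf Lg; have HL := L2_semi_inner mu mD.
have Labs h : L2 mu D h -> L2 mu D (fun x => `|h x|).
  move=> [mh hh]; split; first exact: measurableT_comp.
  by under eq_integral do rewrite real_normK ?num_real//.
have nabs h : semi_norm (L2ip mu D) (fun x => `|h x|) = semi_norm (L2ip mu D) h.
  congr Num.sqrt; apply: eq_Rintegral => x _.
  by rewrite -!expr2 real_normK ?num_real.
have := cauchy_schwarz HL (Labs _ Lf) (Labs _ Lg); rewrite !nabs => h.
have ifg := L2_integrableM mD (Labs _ Lf) (Labs _ Lg).
apply: (@le_trans _ _ (L2ip mu D (fun x => `|f x|) (fun x => `|g x|))%:E).
  rewrite /L2ip /Rintegral fineK; last exact: integrable_fin_num.
  by rewrite le_eqVlt; apply/orP; left; apply/eqP; apply: eq_integral => x _; rewrite normrM.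
by rewrite lee_fin (le_trans (ler_norm _)).
Qed.

Section convolution.
Context {R : realType} {n : nat}.
Variable Om : set 'rV[R]_n.
Hypothesis oOm : open Om.
Hypothesis bOm : bounded_set Om.
Local Notation leb := (@lebesgue_rV R n).
Local Notation mu := (@lebesgue_measure R).
Local Notation ip := (L2ip leb Om).
Local Notation nrm := (semi_norm ip).

Let mOm : measurable Om. Proof. exact: open_measurable_rV. Qed.

Let fOm : (leb Om < +oo)%E. Proof. exact: bounded_lebesgue_rV_lty. Qed.

Variables (k a : R -> R) (v : R -> 'rV[R]_n -> R) (t C : R).
Hypothesis mk : measurable_fun setT k.
Hypothesis mv : measurable_fun setT (fun z : R * 'rV[R]_n => v z.1 z.2).
Hypothesis ma : measurable_fun setT a.
Hypothesis a0 : forall s, 0 <= a s.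
Hypothesis ha : {ae mu, forall s, s \in `]0, t[ -> L2 leb Om (v s) /\ nrm (v s) <= a s}.
Hypothesis hC : (\int[mu]_(s in `]0%R, t[) (`|k (t - s)| * a s)%:E <= C%:E)%E.

(** The window is open so that a kernel and a curve set to zero outside []0, T[] give the same value
    as the originals; [conv_window] makes the link. *)
Definition window_conv (x : 'rV[R]_n) : R := \int[mu]_(s in `]0, t[) (k (t - s) * v s x).

Let F (phi : 'rV[R]_n -> R) (z : R * 'rV[R]_n) : R :=
  \1_(`]0, t[) z.1 * k (t - z.1) * (v z.1 z.2 * (phi \_ Om) z.2).

Let mF phi : L2 leb Om phi -> measurable_fun setT (F phi).
Proof.
move=> [mphi _]; apply: measurable_funM.
  apply: measurable_funM; first by apply: measurableT_comp => //; exact: measurable_indic.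
  apply: measurableT_comp => //; apply: measurable_funB => //.
apply: measurable_funM => //; apply: measurableT_comp => //.
exact/(measurable_restrictT _ _).1.
Qed.

(** Integrating in [x] first, Cauchy-Schwarz leaves [|k (t - s)| * a s] times the norm of [phi].
    Joint integrability follows, and with it, by Fubini's theorem, the bound of the convolution
    tested with [phi]. *)
Let F_bound phi : L2 leb Om phi ->
  (\int[mu]_s \int[leb]_x `|(F phi (s, x))%:E| <= (C * nrm phi)%:E)%E.
Proof.
move=> Lphi; have mphi : measurable_fun setT (phi \_ Om).
  by apply/(measurable_restrictT _ _).1 => //; case: Lphi.
have mvs s : measurable_fun setT (v s).
  exact: (measurable_fun_pair2 s mv).
apply: (@le_trans _ _ (\int[mu]_s ((`|k (t - s)| * a s)%:E * (nrm phi)%:E * (\1_(`]0%R, t[) s)%:E))%E).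
  apply: ae_ge0_le_integral_nonmeasurable.
  - by move=> s _; exact: integral_ge0.
  - by move=> s _; rewrite -!EFinM lee_fin !mulr_ge0// nrm_ge0.
  apply: (ae_imply ha) => s hs _; rewrite /F /=.
  have [st|st] := boolP (s \in `]0, t[); last first.
    rewrite indicE memNset ?mule0; last by move=> /= h; move/negP: st.
    by rewrite (eq_integral (cst 0%E)) ?integral0// => x _; rewrite !mul0r normr0.
  have [Lv nv] := hs st.
  rewrite indicE mem_set// mule1.
  under eq_integral do rewrite mul1r normrM EFinM.
  rewrite ge0_integralZl//; last first.
    by apply/measurable_EFinP; apply: measurableT_comp => //; apply: measurable_funM.
  rewrite (EFinM `|k (t - s)| (a s)) -muleA lee_wpmul2l//.
  have -> : (\int[leb]_x `|v s x * (phi \_ Om) x|%:E = \int[leb]_(x in Om) `|v s x * phi x|%:E)%E.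
    rewrite [RHS]integral_mkcond; apply: eq_integral => x _.
    by rewrite !patchE; case: (x \in Om); rewrite ?mulr0 ?normr0.
  apply: le_trans (L2_cauchy_schwarz_abs mOm Lv Lphi) _.
  by rewrite -EFinM lee_fin ler_wpM2r// nrm_ge0.
rewrite (_ : (fun s => _) = (fun s => (nrm phi)%:E *
    ((fun s => (`|k (t - s)| * a s)%:E) \_ `]0%R, t[) s)%E); last first.
  apply/funext => s; rewrite patchE indicE; case: (s \in _) => /=.
    by rewrite mule1 muleC.
  by rewrite !mule0.
rewrite ge0_integralZl_EFin ?nrm_ge0//.
- rewrite -integral_mkcond mulrC EFinM lee_wpmul2l// ?lee_fin ?nrm_ge0//.
- by move=> s _; rewrite patchE; case: ifP => // _; rewrite lee_fin mulr_ge0.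
- apply/(measurable_restrictT _ _).1 => //; apply/measurable_EFinP.
  apply: measurable_funM; last exact: measurable_funTS.
  apply: measurable_funTS; apply: measurableT_comp => //.
  by apply: measurableT_comp => //; exact: measurable_funB.
Qed.

Let iF phi : L2 leb Om phi -> (mu \x leb)%E.-integrable setT (EFin \o F phi).
Proof.
move=> Lphi; apply/integrable12ltyP; first by apply/measurable_EFinP; exact: mF.
exact: le_lt_trans (F_bound Lphi) (ltry _).
Qed.

Let L1 : L2 leb Om (cst 1). Proof. exact: L2_cst. Qed.

Let F1E x : Om x -> (fun s => (F (cst 1) (s, x))%:E) =
  (EFin \o (fun s => k (t - s) * v s x)) \_ `]0, t[.
Proof.
move=> Ox; apply/funext => s; rewrite /F /= !patchE mem_set// mulr1 indicE.
by case: (s \in _); rewrite ?mul1r ?mul0r.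
Qed.

(** Fubini's theorem for [F (cst 1)], the constant being in L^2 because [Om] has finite measure. *)
Lemma window_conv_integrable :
  {ae leb, forall x, Om x -> mu.-integrable `]0, t[ (EFin \o (fun s => k (t - s) * v s x))}.
Proof.
have ae2 := ae_integrable2 (iF L1); apply: (ae_imply ae2) => x h Ox.
apply/(integrable_mkcond _ _).2 => //; rewrite -F1E//; exact: h.
Qed.

Lemma measurable_window_conv : measurable_fun Om window_conv.
Proof.
have mG := measurable_fubini_G (iF L1).
apply: (@eq_measurable_fun _ _ _ _ _ (fine \o fubini_G mu (EFin \o F (cst 1)))).
  move=> x; rewrite inE => Ox; rewrite /= /fubini_G /window_conv /Rintegral.
  rewrite (_ : (fun y => _) = (fun s => (F (cst 1) (s, x))%:E))// F1E//.
  by rewrite -integral_mkcond.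
by apply: measurable_funTS; exact: measurableT_comp.
Qed.

Let abs_bound phi : L2 leb Om phi ->
  (\int[leb]_(x in Om) `|(window_conv x * phi x)%:E| <= (C * nrm phi)%:E)%E.
Proof.
move=> Lphi; apply: le_trans _ (F_bound Lphi).
have mFa : measurable_fun setT (abse \o (EFin \o F phi)).
  by apply: measurableT_comp => //; apply/measurable_EFinP; exact: mF.
rewrite (@fubini_tonelli _ _ _ _ R mu leb (abse \o (EFin \o F phi)) mFa (fun=> abse_ge0 _)).
rewrite [leLHS]integral_mkcond; apply: ae_ge0_le_integral_nonmeasurable.
- by move=> x _; rewrite patchE; case: ifP => // _; exact: abse_ge0.
- by move=> x _; apply: integral_ge0 => s _; exact: abse_ge0.
apply: aeW => x _; rewrite patchE; case: ifPn => [|_]; last by apply: integral_ge0 => s _; exact: abse_ge0.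
rewrite inE => Ox.
have mkv : measurable_fun `]0, t[ (fun s => k (t - s) * v s x).
  apply: measurable_funTS; apply: measurable_funM; last exact: (measurable_fun_pair1 x mv).
  by apply: measurableT_comp => //; apply: measurable_funB.
apply: (@le_trans _ _ (`|phi x|%:E * \int[mu]_(s in `]0%R, t[) `|(k (t - s) * v s x)%:E|)%E).
  rewrite EFinM abseM muleC lee_wpmul2l// /window_conv.
  apply: (@le_trans _ _ `|\int[mu]_(s in `]0%R, t[) (k (t - s) * v s x)%:E|%E).
    (* [fine] sends infinite values to 0, so the inequality also holds at points where the integral
       is infinite. *)
    rewrite /Rintegral; case: (integral _ _ _) => [r| |] //=.
      by rewrite normr0 leey.
    by rewrite normr0 leey.
  by apply: le_abse_integral => //; exact/measurable_EFinP.
rewrite -ge0_integralZl//; last first.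
  by apply/measurable_EFinP; exact: measurableT_comp.
rewrite integral_mkcond; apply: ae_ge0_le_integral_nonmeasurable.
- by move=> s _; rewrite patchE; case: ifP => // _; rewrite mule_ge0.
- by move=> s _; exact: abse_ge0.
- apply: aeW => s _; rewrite patchE.
  have FE : F phi (s, x) = \1_(`]0, t[) s * (k (t - s) * v s x * phi x).
    by rewrite /F /= [(phi \_ Om) x]patchE mem_set// !mulrA.
  rewrite [leRHS](_ : _ = `|(F phi (s, x))%:E|%E)// FE.
  rewrite indicE; case: (s \in _); last by rewrite mul0r abse0.
  by rewrite mul1r -EFinM -normrM mulrC.
Qed.

Lemma window_conv_bound phi : L2 leb Om phi ->
  leb.-integrable Om (EFin \o (fun x => window_conv x * phi x)) /\
  `|ip window_conv phi| <= C * nrm phi.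
Proof.
move=> Lphi.
have i1 : leb.-integrable Om (EFin \o (fun x => window_conv x * phi x)).
  apply/integrableP; split.
    apply/measurable_EFinP; apply: measurable_funM; first exact: measurable_window_conv.
    by case: Lphi.
  exact: le_lt_trans (abs_bound Lphi) (ltry _).
split => //; apply: le_trans (le_normr_Rintegral mOm i1) _.
rewrite -lee_fin /Rintegral fineK; first exact: abs_bound.
exact: integrable_fin_num (integrable_norm i1).
Qed.

End convolution.

(** * Curves extended by zero *)

Section full_sets.
Context {R : realType}.
Local Notation mu := (@lebesgue_measure R).

(* Curves and functionals are set to 0 outside a Borel set of full measure on which
   all the almost everywhere conditions hold; they then hold everywhere and the
   modified objects are Borel measurable. *)
Lemma ae_full_set (T : R) (P : R -> Prop) :
  {ae mu, forall t, t \in `]0, T[ -> P t} ->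
  exists D : set R, [/\ measurable D, D `<=` `]0, T[, forall t, D t -> P t &
    {ae mu, forall t, t \in `]0, T[ -> D t}].
Proof.
move=> [N [mN N0 NP]]; exists (`]0, T[ `\` N); split.
- exact: measurableD.
- by move=> t [].
- move=> t [tT tN]; apply: contrapT => nP; apply: tN; apply: NP => /= h.
  exact: nP (h tT).
- exists N; split => // t /= h; apply: contrapT => tN; apply: h => tT; split => //.
Qed.

End full_sets.

Section patched_curves.
Context {R : realType} {V : lmodType R} {S : set V} {ip : V -> V -> R}.
Local Notation mu := (@lebesgue_measure R).
Hypothesis HV : semi_inner_product S ip.
Local Notation nrm := (semi_norm ip).
Variables (T : R) (D : set R) (u : R -> V).
Hypothesis mD : measurable D.
Hypothesis DT : D `<=` `]0, T[.
Hypothesis aeD : {ae mu, forall t, t \in `]0, T[ -> D t}.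
Hypothesis Su : forall t, D t -> S (u t).

Definition restrict_curve (t : R) : V := \1_D t *: u t.

Lemma restrict_curve_in t : D t -> restrict_curve t = u t.
Proof. by move=> Dt; rewrite /restrict_curve indicE mem_set// scale1r. Qed.

Lemma restrict_curve_out t : ~ D t -> restrict_curve t = 0.
Proof. by move=> Dt; rewrite /restrict_curve indicE memNset// scale0r. Qed.

Lemma restrict_curve_dom t : S (restrict_curve t).
Proof.
have [Dt|Dt] := pselect (D t); first by rewrite restrict_curve_in//; exact: Su.
by rewrite restrict_curve_out//; exact: (dom0 HV).
Qed.

Lemma restrict_curve_simple_limit (s : nat -> R -> V) :
  (forall n, simple_curve S (s n)) ->
  (forall t, D t -> nrm (s n t - u t) @[n --> \oo] --> (0 : R)) ->
  simple_limit (S := S) (ip := ip) restrict_curve.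
Proof.
move=> ss su; exists (fun n t => \1_D t *: s n t); split.
  by move=> n; exact: (simple_curve_indic mD (ss n)).
move=> t; have [Dt|Dt] := pselect (D t).
  by rewrite indicE mem_set// restrict_curve_in//; under eq_fun do rewrite scale1r; exact: su.
rewrite restrict_curve_out// indicE memNset//.
under eq_fun do rewrite scale0r subrr (nrm0 HV).
exact: cvg_cst.
Qed.

Lemma restrict_curve_integrable :
  simple_limit (S := S) (ip := ip) restrict_curve ->
  (\int[mu]_(t in `]0%R, T[) (nrm (u t) ^+ 2)%:E < +oo)%E ->
  mu.-integrable setT (EFin \o (fun t => ip (restrict_curve t) (restrict_curve t))).
Proof.
move=> su iu; apply/integrableP; split.
  by apply/measurable_EFinP; exact: (measurable_ip HV restrict_curve_dom su restrict_curve_dom su).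
apply: le_lt_trans iu; rewrite [leRHS]integral_mkcond.
apply: ae_ge0_le_integral_nonmeasurable => //.
- by move=> t _; rewrite patchE; case: ifP => // _; rewrite lee_fin sqr_ge0.
- apply: aeW => t _ /=; have [Dt|Dt] := pselect (D t).
    rewrite restrict_curve_in// patchE mem_set; last exact: DT.
    by rewrite ger0_norm ?(ip_ge0 HV) ?(nrm_sqr HV)//; exact: Su.
  rewrite restrict_curve_out// (linear_on0 HV (ip_linear HV (dom0 HV))) normr0.
  by rewrite patchE; case: ifP => // _; rewrite lee_fin sqr_ge0.
Qed.

Section dual_curves.
Variable l : R -> V -> R.
Hypothesis Sl : forall t, D t -> dual S nrm (l t).

Lemma dual_norm_ub (k : V -> R) v : dual S nrm k -> S v -> nrm v <= 1 ->
  `|k v| <= dual_norm S nrm k.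
Proof.
move=> [lk [C kC]] Sv nv; apply: sup_upper_bound; last by exists v.
split; first by exists `|k v|; exists v.
exists `|C| => _ [x [Sx nx] <-]; apply: le_trans (kC x Sx) _.
apply: (@le_trans _ _ (`|C| * nrm x)); first by rewrite ler_wpM2r ?ler_norm// (nrm_ge0 (ip := ip)).
by rewrite ler_piMr.
Qed.

(** Normalising [v] reduces to the unit ball. A null vector cannot be normalised, but there any
    continuity constant of [k] forces [k v = 0]. *)
Lemma dual_norm_le (k : V -> R) v : dual S nrm k -> S v ->
  `|k v| <= dual_norm S nrm k * nrm v.
Proof.
move=> dk Sv; have [lk [C kC]] := dk.
have [v0|v0] := eqVneq (nrm v) 0.
  by have := kC v Sv; rewrite v0 !mulr0.
have vp : 0 < nrm v by rewrite lt_neqAle eq_sym v0 (nrm_ge0 (ip := ip)).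
rewrite -ler_pdivrMr//.
have -> : `|k v| / nrm v = `|k ((nrm v)^-1 *: v)|.
  by rewrite (linear_onZ HV _ lk)// normrM (gtr0_norm (_ : 0 < (nrm v)^-1)) ?invr_gt0// mulrC.
have SZ : S ((nrm v)^-1 *: v) by exact: (domZ HV).
have nZ : nrm ((nrm v)^-1 *: v) <= 1.
  by rewrite (nrmZ HV)// gtr0_norm ?invr_gt0// mulVf.
exact: dual_norm_ub.
Qed.

Lemma dual_norm_ge0 (k : V -> R) : dual S nrm k -> 0 <= dual_norm S nrm k.
Proof.
move=> dk; apply: le_trans (normr_ge0 (k 0)) (dual_norm_ub dk (dom0 HV) _).
by rewrite (nrm0 HV).
Qed.

Lemma dualB (k1 k2 : V -> R) : dual S nrm k1 -> dual S nrm k2 -> dual S nrm (k1 - k2).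
Proof.
move=> [l1 [C1 h1]] [l2 [C2 h2]].
have E x : (k1 - k2) x = k1 x - k2 x by [].
split; first by move=> a v w Sv Sw; rewrite !E l1// l2//; ring.
exists (C1 + C2) => v Sv; rewrite E.
by rewrite (le_trans (ler_normB _ _))// mulrDl lerD ?h1 ?h2.
Qed.

Lemma dual_sum n (a : 'I_n -> R) (k : 'I_n -> V -> R) : (forall i, dual S nrm (k i)) ->
  dual S nrm (\sum_(i < n) a i *: k i).
Proof.
move=> dk; elim/big_ind : _.
- by split; [move=> b v w _ _; rewrite mulr0 addr0|exists 0 => v _; rewrite normr0 mul0r].
- move=> k1 k2 d1 d2; rewrite -[k2]opprK; apply: dualB => //.
  rewrite -sub0r; apply: dualB => //.
  by split; [move=> b v w _ _; rewrite mulr0 addr0|exists 0 => v _; rewrite normr0 mul0r].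
- move=> i _; have [li [C kC]] := dk i.
  have E x : (a i *: k i) x = a i * k i x by [].
  split; first by move=> b v w Sv Sw; rewrite !E li//; ring.
  exists (`|a i| * C) => v Sv; rewrite E normrM -mulrA.
  by rewrite ler_wpM2l// kC.
Qed.

Definition restrict_functional (t : R) (v : V) : R := \1_D t * l t v.

Lemma restrict_functional_in t v : D t -> restrict_functional t v = l t v.
Proof. by move=> Dt; rewrite /restrict_functional indicE mem_set// mul1r. Qed.

Lemma restrict_functional_out t v : ~ D t -> restrict_functional t v = 0.
Proof. by move=> Dt; rewrite /restrict_functional indicE memNset// mul0r. Qed.

Lemma restrict_functional_linear t : linear_on S (restrict_functional t).
Proof.
move=> a v w Sv Sw; have [Dt|Dt] := pselect (D t).
  by have [ll _] := Sl Dt; rewrite !restrict_functional_in// ll.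
by rewrite !restrict_functional_out// mulr0 addr0.
Qed.

Lemma measurable_restrict_functional (s : nat -> R -> V -> R) v : S v ->
  (forall n, simple_curve (dual S nrm) (s n)) ->
  (forall t, D t -> dual_norm S nrm (s n t - l t) @[n --> \oo] --> (0 : R)) ->
  measurable_fun setT (restrict_functional ^~ v).
Proof.
move=> Sv ss sl.
apply: (measurable_fun_cvg (h := fun n t => \1_D t * s n t v)).
  move=> n; apply: measurable_funM; first exact: measurable_indic.
  have [k [A [w [mA Sw ->]]]] := ss n.
  rewrite (_ : (fun t => _) = (fun t => \sum_(i < k) \1_(A i) t * w i v)).
    by apply: measurable_sum => i; apply: measurable_funM; [exact: measurable_indic|exact: measurable_cst].
  by apply/funext => t; rewrite fct_sumE; apply: eq_bigr => i _; rewrite fctE.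
move=> t _; have [Dt|Dt] := pselect (D t); last first.
  rewrite restrict_functional_out//; under eq_fun do rewrite indicE memNset// mul0r.
  exact: cvg_cst.
rewrite restrict_functional_in//; under eq_fun do rewrite indicE mem_set// mul1r.
have h : dual_norm S nrm (s n t - l t) * nrm v @[n --> \oo] --> (0 : R).
  by rewrite -[X in _ --> X](mul0r (nrm v)); apply: cvgM (sl t Dt) _; exact: cvg_cst.
apply/subr_cvg0/norm_cvg0P.
apply: (squeeze_cvgr _ (cvg_cst 0) h); apply: nearW => n.
rewrite normr_ge0/=.
have dsl : dual S nrm (s n t - l t).
  apply: dualB; last exact: Sl.
  by have [k [A [w [mA Sw ->]]]] := ss n; exact: dual_sum.
exact: dual_norm_le dsl Sv.
Qed.

Lemma integrable_restrict_functional (s : nat -> R -> V -> R) v : S v ->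
  (forall n, simple_curve (dual S nrm) (s n)) ->
  (forall t, D t -> dual_norm S nrm (s n t - l t) @[n --> \oo] --> (0 : R)) ->
  (\int[mu]_(t in `]0%R, T[) (dual_norm S nrm (l t) ^+ 2)%:E < +oo)%E ->
  mu.-integrable setT (EFin \o restrict_functional ^~ v).
Proof.
move=> Sv ss sl il.
(* On the unit ball [|l t v'|] is at most the dual norm, so its square integral is compared directly
   with that of the dual norm, whose measurability in [t] is not known. The [+ 1] allows null
   vectors. *)
pose v' := (nrm v + 1)^-1 *: v.
have n1 : 0 < nrm v + 1 by rewrite ltr_wpDl// (nrm_ge0 (ip := ip)).
have Sv' : S v' by exact: (domZ HV).
have nv' : nrm v' <= 1.
  rewrite (nrmZ HV)// gtr0_norm ?invr_gt0// ler_pdivrMl// mulr1.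
  by rewrite lerDl.
have E : restrict_functional ^~ v = (fun t => (nrm v + 1) * restrict_functional t v').
  apply/funext => t; rewrite (linear_onZ HV _ (@restrict_functional_linear t))//.
  by rewrite mulrA divff ?mul1r// gt_eqF.
rewrite E; apply: integrableZ_lebesgue => //.
have mv' := measurable_restrict_functional Sv' ss sl.
have L2v : L2 mu `]0, T[ (restrict_functional ^~ v').
  split; first exact: measurable_funTS.
  apply: le_lt_trans il; apply: ae_ge0_le_integral_nonmeasurable.
  - by move=> t _; rewrite lee_fin sqr_ge0.
  - by move=> t _; rewrite lee_fin sqr_ge0.
  apply: aeW => t _; rewrite lee_fin.
  have [Dt|Dt] := pselect (D t); last by rewrite restrict_functional_out// expr0n sqr_ge0.
  rewrite restrict_functional_in// -real_normK ?num_real//.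
  have h1 := dual_norm_le (Sl Dt) Sv'.
  have d0 := dual_norm_ge0 (Sl Dt).
  by rewrite lerXn2r ?nnegrE// (le_trans h1)// ler_piMr.
(* On a bounded interval, pairing with 1 turns square integrability into integrability. *)
have L1 : L2 mu `]0, T[ (cst 1).
  apply: (@L2_cst _ _ R mu _ _ 1) => //.
  by have := lebesgue_measure_itv `]0, T[; rewrite /= => ->; case: ifP => _; rewrite -?EFinB ltry.
have := @L2_integrableM _ _ R mu `]0, T[%classic (measurable_itv _) _ _ L2v L1.
under [X in _ (EFin \o X)]eq_fun do rewrite mulr1.
move=> /(integrable_mkcond _ _).1 h.
have {}h := h (measurable_itv _).
move: h; congr (mu.-integrable _ _); apply/funext => t /=.
rewrite patchE; case: ifPn => // tT; rewrite restrict_functional_out// => Dt.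
by move/negP: tT; apply; rewrite inE; exact: DT.
Qed.

End dual_curves.

End patched_curves.

(** * The abstract uniqueness estimate *)

Section closing.
Context {R : realType} {n : nat}.
Local Notation mu := (@lebesgue_measure R).
Local Notation leb := (@lebesgue_rV R n).
Variables (Om : set 'rV[R]_n) (T : R).
Hypothesis oOm : open Om.
Hypothesis bOm : bounded_set Om.
Hypothesis T0 : 0 < T.
Local Notation ip := (L2ip leb Om).

Let mOm : measurable Om. Proof. exact: open_measurable_rV. Qed.
Let HL := L2_semi_inner leb mOm.
Let HH := H1_semi_inner oOm bOm.
Let HG := gradip_semi_inner oOm bOm.

(** The L^2 form pulled back to H^1. It lets the theory of simple limits prove [|u(t)|^2] measurable
    from approximation in H^1. *)
Lemma fst_semi_inner :
  semi_inner_product (H1 Om) (fun v w : sobolev_pair R n => ip v.1 w.1).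
Proof.
split.
- exact: semi_ip_dom0 HH.
- exact: semi_ip_domP HH.
- by move=> v w Hv Hw; exact: (semi_ipC HL (H1_L2 Hv) (H1_L2 Hw)).
- by move=> k v w x Hv Hw Hx; exact: (semi_ipP HL k (H1_L2 Hv) (H1_L2 Hw) (H1_L2 Hx)).
- by move=> v Hv; exact: (semi_ip_ge0 HL (H1_L2 Hv)).
Qed.

Lemma fst_norm_le v : H1 Om v -> semi_norm ip v.1 <= semi_norm (H1ip Om) v.
Proof. by move=> Hv; rewrite ler_sqrt ?(ip_ge0 HH)// lerDl (ip_ge0 HG). Qed.

Variables (u : R -> sobolev_pair R n).
Hypothesis Su : forall t, H1 Om (u t).
Hypothesis su : simple_limit (S := H1 Om) (ip := H1ip Om) u.
Hypothesis iu : mu.-integrable setT (EFin \o (fun t => H1ip Om (u t) (u t))).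

Let a t := ip (u t).1 (u t).1.
Let p t := gradip Om (u t) (u t).

Lemma measurable_fst_energy : measurable_fun setT (fun t => ip (u t).1 (u t).1).
Proof.
have sl : simple_limit (S := H1 Om) (ip := fun v w : sobolev_pair R n => ip v.1 w.1) u.
  have [s [ss sv]] := su; exists s; split => // t.
  apply: (squeeze_cvgr _ (cvg_cst 0) (sv t)); apply: nearW => k.
  rewrite sqrtr_ge0/=.
  apply: (@fst_norm_le (s k t - u t)); apply: (domB HH) => //; exact: (simple_curve_dom HH _ (ss k)).
exact: (measurable_ip fst_semi_inner Su sl Su sl).
Qed.

Lemma integrable_fst_energy : mu.-integrable setT (EFin \o a).
Proof.
apply: (dominated_integrable_lebesgue _ _ iu) => //; first exact: measurable_fst_energy.
move=> t _; rewrite ger0_norm ?(ip_ge0 fst_semi_inner)//.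
by rewrite lerDl (ip_ge0 HG).
Qed.

Lemma integrable_gradient_energy : mu.-integrable setT (EFin \o p).
Proof.
rewrite (_ : p = fun t => H1ip Om (u t) (u t) - a t).
  exact: (integrableB_lebesgue measurableT iu integrable_fst_energy).
by apply/funext => t; rewrite /H1ip addrAC subrr add0r.
Qed.

Variables (w : R -> sobolev_pair R n -> R) (c : R -> 'rV[R]_n -> R) (K : R -> R).
Variables (L Mh Cq C1 M : R).
Hypothesis L0 : 0 <= L.
Hypothesis Mh0 : 0 <= Mh.
Hypothesis Cq0 : 0 <= Cq.
Hypothesis lw : forall t, linear_on (H1 Om) (w t).
Hypothesis mw : forall v, H1 Om v -> measurable_fun setT (w^~ v).
Hypothesis w_out : forall t v, t \notin `]0, T[ -> w t v = 0.
Hypothesis Sc : forall t, L2 leb Om (c t).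
Hypothesis cc : forall t, semi_norm ip (c s - c t) @[s --> t] --> (0 : R).
Hypothesis c_init : ip (c 0) (c 0) = 0.
Hypothesis cM : forall t, ip (c t) (c t) <= M.
Hypothesis cw : forall phi, H1 Om phi -> forall s t, s <= t -> t <= T ->
  ip (c t) phi.1 - ip (c s) phi.1 = \int[mu]_(r in `]s, t[) w r phi.
Hypothesis cu : {ae mu, forall t, t \in `]0, T[ ->
  ip (c t - (u t).1) (c t - (u t).1) = 0}.
Hypothesis mK : measurable_fun setT K.
Hypothesis iK : mu.-integrable setT (EFin \o (fun t => K t ^+ 2)).

Let k t := K t ^+ 2.
(** Its root bounds the convolution difference in [wE]. Young's inequality brings back [q] itself,
    which is linear in the primitives. *)
Let q t := Cq * (primitive a t + primitive k t).

Hypothesis wE : forall t v, H1 Om v -> t \in `]0, T[ -> `|w t v + gradip Om (u t) v| <=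
  (L * semi_norm (H1ip Om) (u t) + Mh * `|K t| + Num.sqrt (q t)) * semi_norm ip v.1.
Hypothesis kE : forall t, k t <= C1 * (primitive k t + a t + p t).

Let a0 t : 0 <= a t. Proof. exact: (ip_ge0 fst_semi_inner). Qed.
Let p0 t : 0 <= p t. Proof. exact: (ip_ge0 HG). Qed.
Let k0 t : 0 <= k t. Proof. exact: sqr_ge0. Qed.
Let q0 t : 0 <= q t. Proof. by rewrite mulr_ge0// addr_ge0// primitive_ge0. Qed.

(** The bound of [w t] in the dual of H^1. The [+ 1] pays for the gradient term, estimated by
    Cauchy-Schwarz. *)
Let b t := \1_(`]0, T[) t *
  ((L + 1) * semi_norm (H1ip Om) (u t) + Mh * `|K t| + Num.sqrt (q t)).

Let wb t v : H1 Om v -> `|w t v| <= b t * semi_norm (H1ip Om) v.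
Proof.
move=> Hv; rewrite /b; have [tT|tT] := boolP (t \in `]0, T[); last first.
  by rewrite w_out// normr0 indicE memNset ?mul0r//= => h; move/negP: tT.
rewrite indicE mem_set// mul1r.
rewrite -(addrK (gradip Om (u t) v) (w t v)) (le_trans (ler_normB _ _))//.
have h1 := wE Hv tT; have h2 := cauchy_schwarz HG (Su t) Hv.
have n1 := fst_norm_le Hv.
have g1 x : H1 Om x -> semi_norm (gradip Om) x <= semi_norm (H1ip Om) x.
  by move=> Hx; rewrite ler_sqrt ?(ip_ge0 HH)// lerDr (ip_ge0 HL)//; exact: H1_L2.
have s0 x : 0 <= semi_norm (H1ip Om) x by exact: sqrtr_ge0.
have c0 : 0 <= L * semi_norm (H1ip Om) (u t) + Mh * `|K t| + Num.sqrt (q t).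
  by rewrite !addr_ge0 ?mulr_ge0// sqrtr_ge0.
have -> : ((L + 1) * semi_norm (H1ip Om) (u t) + Mh * `|K t| + Num.sqrt (q t)) * semi_norm (H1ip Om) v =
  (L * semi_norm (H1ip Om) (u t) + Mh * `|K t| + Num.sqrt (q t)) * semi_norm (H1ip Om) v +
  semi_norm (H1ip Om) (u t) * semi_norm (H1ip Om) v by ring.
apply: lerD; first by rewrite (le_trans h1)// ler_wpM2l.
by rewrite (le_trans h2)// ler_pM ?sqrtr_ge0// g1.
Qed.

Let mq : measurable_fun setT q.
Proof.
apply: measurable_funM => //; apply: measurable_funD; apply: measurable_primitive => //.
exact: integrable_fst_energy.
Qed.

Let mb : measurable_fun setT b.
Proof.
apply: measurable_funM; first exact: measurable_indic.
apply: measurable_funD; last by apply: measurableT_comp => //;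
  exact: (continuous_measurable_fun (@sqrt_continuous R)).
apply: measurable_funD; apply: measurable_funM => //; last exact: measurableT_comp.
apply: (measurableT_comp (continuous_measurable_fun (@sqrt_continuous R)));
  exact: (measurable_ip HH Su su Su su).
Qed.

Let qT : R := Cq * (primitive a T + primitive k T).

Let ib2 : mu.-integrable setT (EFin \o (fun t => b t ^+ 2)).
Proof.
have i1 := integrableD_lebesgue measurableT
  (integrableZ_lebesgue (3 * (L + 1) ^+ 2) measurableT iu)
  (integrableZ_lebesgue (3 * Mh ^+ 2) measurableT iK).
have iI : mu.-integrable setT (EFin \o (fun t => 3 * qT * \1_(`]0, T[) t)).
  by apply: integrableZ_lebesgue => //; exact: integrable_indic_itv.
have i2 := integrableD_lebesgue measurableT i1 iI.
apply: (dominated_integrable_lebesgue _ _ i2) => //; first exact: measurable_funX.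
move=> t _; rewrite ger0_norm ?sqr_ge0// /b indicE.
have x0 : 0 <= 3 * (L + 1) ^+ 2 * H1ip Om (u t) (u t).
  by apply: mulr_ge0; [apply: mulr_ge0 => //; exact: sqr_ge0|exact: (ip_ge0 HH)].
have y0 : 0 <= 3 * Mh ^+ 2 * k t by apply: mulr_ge0 => //; apply: mulr_ge0 => //; exact: sqr_ge0.
case: (boolP (t \in _)) => [|_]; last first.
  by rewrite mul0r expr0n mulr0 addr0 addr_ge0.
rewrite inE => /= /andP[t0 tT]; rewrite mul1r mulr1.
have q1 : q t <= qT.
  rewrite ler_wpM2l// lerD//; apply: primitive_nd => //; try exact: ltW.
  exact: integrable_fst_energy.
have e1 : ((L + 1) * semi_norm (H1ip Om) (u t)) ^+ 2 = (L + 1) ^+ 2 * H1ip Om (u t) (u t).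
  by rewrite exprMn (nrm_sqr HH).
have e2 : (Mh * `|K t|) ^+ 2 = Mh ^+ 2 * k t by rewrite exprMn real_normK ?num_real.
have e3 : Num.sqrt (q t) ^+ 2 = q t by rewrite sqr_sqrtr.
have sq3 (x y z : R) : (x + y + z) ^+ 2 <= 3 * x ^+ 2 + 3 * y ^+ 2 + 3 * z ^+ 2.
  have : 0 <= (x - y) ^+ 2 + (y - z) ^+ 2 + (x - z) ^+ 2 by rewrite !addr_ge0// sqr_ge0.
  by lra.
apply: le_trans (sq3 _ _ _) _.
rewrite e1 e2 e3.
by rewrite /= -!(mulrA 3) -!mulrDr ler_wpM2l// lerD2l.
Qed.

Let ib : mu.-integrable setT (EFin \o b).
Proof.
have iI : mu.-integrable setT (EFin \o (fun t => \1_(`]0, T[) t)) by exact: integrable_indic_itv.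
apply: (dominated_integrable_lebesgue _ _ (integrableD_lebesgue measurableT ib2 iI)) => //.
move=> t _; rewrite /b indicE; case: (t \in _); last first.
  by rewrite !mul0r normr0 expr0n addr0.
rewrite /= !mul1r; set x := _ + Num.sqrt _.
have : 0 <= (`|x| - 1) ^+ 2 + x ^+ 2 + 1 by rewrite !addr_ge0// sqr_ge0.
by rewrite sqrrB1 real_normK ?num_real//; lra.
Qed.

(** Young's inequality with weight [e / 2] for the source and kernel terms and weight 1 for the
    convolution. After doubling these give [4 / e], [2] and [2 * Cq]; the remaining [e] comes from
    the L^2 part of the H^1 norm. *)
Let power_le (e : R) t : 0 < e -> t \in `]0, T[ -> 2 * w t (u t) <=
  e * (k t + p t) +
  (e + 4 / e * (L ^+ 2 + Mh ^+ 2) + 2 + 2 * Cq) * (a t + primitive a t + primitive k t) - 2 * p t.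
Proof.
move=> e0 tT.
have h := le_trans (ler_norm _) (wE (Su t) tT).
have -> : w t (u t) = w t (u t) + p t - p t by rewrite addrK.
set N := semi_norm ip (u t).1 in h *.
have N2 : N ^+ 2 = a t by rewrite (nrm_sqr HL)//; exact: H1_L2.
have e2 : 0 < e / 2 by rewrite divr_gt0.
have y1 := weighted_young (semi_norm (H1ip Om) (u t)) (L * N) e2.
have y2 := weighted_young `|K t| (Mh * N) e2.
have y3 := weighted_young (Num.sqrt (q t)) N ltr01.
have E1 : semi_norm (H1ip Om) (u t) ^+ 2 = a t + p t by rewrite (nrm_sqr HH).
have E2 : `|K t| ^+ 2 = k t by rewrite real_normK ?num_real.
have E3 : Num.sqrt (q t) ^+ 2 = q t by rewrite sqr_sqrtr.
rewrite E1 exprMn N2 in y1; rewrite E2 exprMn N2 in y2; rewrite E3 N2 invr1 !mul1r in y3.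
have A0 := primitive_ge0 t a0; have k0' := primitive_ge0 t k0.
have e4 : 0 <= 4 / e * (L ^+ 2 + Mh ^+ 2) by rewrite mulr_ge0 ?divr_ge0 ?addr_ge0 ?sqr_ge0 ?(ltW e0).
have e5 : (e / 2)^-1 = 2 / e by rewrite invf_div.
have h2 : 0 <= (e + 4 / e * (L ^+ 2 + Mh ^+ 2) + 2) * (primitive a t + primitive k t).
  by rewrite mulr_ge0 ?addr_ge0 ?(ltW e0).
have h3 : 0 <= 2 * Cq * a t by rewrite !mulr_ge0.
rewrite e5 in y1 y2.
have {h} h : w t (u t) + p t <= e / 2 * (a t + p t) + 2 / e * (L ^+ 2 * a t) +
    (e / 2 * k t + 2 / e * (Mh ^+ 2 * a t)) + (q t + a t).
  apply: (le_trans h).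
  rewrite [leLHS](_ : _ = semi_norm (H1ip Om) (u t) * (L * N) + `|K t| * (Mh * N) +
    Num.sqrt (q t) * N); last by ring.
  by rewrite !lerD.
rewrite /q in h.
have -> : 4 / e = 2 * (2 / e) by rewrite mulrA -natrM.
rewrite (_ : 4 / e = 2 * (2 / e)) in h2; last by rewrite mulrA -natrM.
set i := 2 / e in h h2 *.
nra.
Qed.

Lemma vanishing_estimate :
  [/\ forall t, 0 < t <= T -> ip (c t) (c t) = 0, primitive p T = 0 & primitive k T = 0].
Proof.
have ia := integrable_fst_energy; have ipp := integrable_gradient_energy.
apply: (@energy_gronwall R a p k (fun t => ip (c t) (c t)) T M C1) => //.
- apply: continuous_measurable_fun; exact: (continuous_energy HL Sc cc).
- by move=> t; rewrite cM (ip_ge0 HL).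
- apply: (ae_imply cu) => t h tT.
  have Lu := H1_L2 (Su t).
  have n0 : semi_norm ip (c t - (u t).1) = 0 by rewrite /semi_norm h// sqrtr0.
  have := nrmB_dist HL (Sc t) Lu; rewrite n0 normr_le0 subr_eq0 => /eqP E.
  by rewrite /a -!(nrm_sqr HL)// E.
move=> e e0.
exists (e + 4 / e * (L ^+ 2 + Mh ^+ 2) + 2 + 2 * Cq).
  have s2 : 0 <= 4 / e * (L ^+ 2 + Mh ^+ 2).
    by apply: mulr_ge0; [exact: divr_ge0 (ltW e0)|apply: addr_ge0; exact: sqr_ge0].
  by apply: addr_ge0; [apply: addr_ge0 => //; apply: addr_ge0 => //; exact: ltW|exact: mulr_ge0].
move=> t /andP[t0 tT].
have jP (d : R) (v v' : sobolev_pair R n) : (d *: v + v').1 = d *: v.1 + v'.1 by [].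
have jS (v : sobolev_pair R n) : H1 Om v -> L2 leb Om v.1 by exact: H1_L2.
have jle (v : sobolev_pair R n) : H1 Om v -> ip v.1 v.1 <= H1ip Om v v.
  by move=> Hv; rewrite lerDl (ip_ge0 HG).
have := energy_inequality HH HL jP jS jle Su su iu lw wb mw ib ib2 Sc cc c_init cw cu t0 tT.
move=> /le_trans; apply.
have iw := integrable_power HH Su su iu lw wb mw ib2.
have i0 f : mu.-integrable setT (EFin \o f) -> mu.-integrable `]0, t[ (EFin \o f).
  by move=> h; exact: integrable_subset_lebesgue (measurable_itv _) h.
rewrite -RintegralZl//; last exact: i0.
apply: le_Rintegral => //.
- by apply: integrableZ_lebesgue => //; exact: i0.
- apply: integrableB_lebesgue => //; last by apply: integrableZ_lebesgue => //; exact: i0.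
  apply: integrableD_lebesgue => //; apply: integrableZ_lebesgue => //.
    by apply: integrableD_lebesgue => //; exact: i0.
  apply: integrableD_lebesgue => //; last exact: integrable_primitive.
  by apply: integrableD_lebesgue => //; [exact: i0|exact: integrable_primitive].
move=> r; rewrite /= in_itv/= => /andP[r0 rt]; apply: power_le => //.
by rewrite in_itv/= r0 (lt_le_trans rt).
Qed.

End closing.

(** * Evolution of the continuous representative *)

Section clamp.
Context {R : realType}.
Variable T : R.
Hypothesis T0 : 0 < T.

(** Composing with [clamp] extends a curve on [[0, T]] by its end values, so that it is continuous
    on the line and can be evaluated at the shifted times [r - d < 0]. *)
Definition clamp (t : R) : R := Num.max 0 (Num.min t T).

Lemma clamp_itv t : clamp t \in `[0, T].
Proof. by rewrite in_itv/= le_max lexx/= ge_max (ltW T0)/= ge_min lexx orbT. Qed.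

Lemma clamp_id t : t \in `[0, T] -> clamp t = t.
Proof. by rewrite in_itv/= /clamp => /andP[t0 tT]; rewrite min_l// max_r. Qed.

Lemma clamp_max t : t <= T -> clamp t = Num.max 0 t.
Proof. by move=> tT; rewrite /clamp min_l. Qed.

Lemma continuous_clamp : continuous clamp.
Proof.
move=> t; apply: (@continuous_max _ _ (cst 0) (fun s => Num.min s T)); first exact: cvg_cst.
by apply: (@continuous_min _ _ id (cst T)); [exact: cvg_id|exact: cvg_cst].
Qed.

Lemma clamped_compact (F : R -> R) : continuous (F \o clamp) ->
  exists M, forall t, `|F (clamp t)| <= M.
Proof.
move=> cF.
have [M [_ HM]] := compact_bounded
  (continuous_compact (continuous_subspaceT cF) (@segment_compact R 0 T)).
exists (`|M| + 1) => t; apply: (HM (`|M| + 1)).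
  by rewrite (le_lt_trans (ler_norm M))// ltrDl.
exists (clamp t); first exact: clamp_itv.
by rewrite /= clamp_id//; exact: clamp_itv.
Qed.

Lemma clamp_within t : clamp s @[s --> t] --> within `[0, T] (nbhs (clamp t)).
Proof.
move=> A hA; have h : clamp s @[s --> t] --> nbhs (clamp t) by exact: continuous_clamp.
have {h}hB := h _ hA; rewrite nbhs_simpl/= in hB *.
apply: filterS hB => s /= hs; apply: hs; exact: clamp_itv.
Qed.

Context {W : lmodType R} {SW : set W} {ip : W -> W -> R}.
Hypothesis HW : semi_inner_product SW ip.
Variable c : R -> W.
Hypothesis cc : continuous_curve SW (semi_norm ip) T c.

Lemma clamped_dom t : SW (c (clamp t)).
Proof. by have [h _] := cc; apply: h; exact: clamp_itv. Qed.

Lemma clamped_cvg t : semi_norm ip (c (clamp s) - c (clamp t)) @[s --> t] --> (0 : R).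
Proof.
have [_ h] := cc; apply: (cvg_comp clamp (fun s => semi_norm ip (c s - c (clamp t)))).
  exact: clamp_within.
by apply: h; exact: clamp_itv.
Qed.

Lemma clamped_bound : exists M, forall t, ip (c (clamp t)) (c (clamp t)) <= M.
Proof.
have cE := continuous_energy HW clamped_dom clamped_cvg.
have [M hM] := @clamped_compact (fun t => ip (c t) (c t)) cE.
by exists M => t; exact: le_trans (ler_norm _) (hM t).
Qed.

Lemma continuous_clamped_pairing phi : SW phi -> continuous (fun t => ip (c (clamp t)) phi).
Proof. exact: (continuous_ip HW clamped_dom clamped_cvg). Qed.

End clamp.

Section evolution.
Context {R : realType} {n : nat}.
Local Notation mu := (@lebesgue_measure R).
Local Notation leb := (@lebesgue_rV R n).
Variables (Om : set 'rV[R]_n) (T : R) (D : set R).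
Hypothesis oOm : open Om.
Hypothesis bOm : bounded_set Om.
Hypothesis T0 : 0 < T.
Local Notation ip := (L2ip leb Om).
Hypothesis mD : measurable D.
Hypothesis DT : D `<=` `]0, T[.
Hypothesis aeD : {ae mu, forall t, t \in `]0, T[ -> D t}.
Variables (u : R -> sobolev_pair R n) (du : R -> sobolev_pair R n -> R)
  (c : R -> 'rV[R]_n -> R) (phi : sobolev_pair R n).
Hypothesis Hphi : H1 Om phi.
Hypothesis idu : mu.-integrable setT (EFin \o (restrict_functional D du)^~ phi).
Hypothesis tdu : time_derivative Om T u du.
Hypothesis cc : continuous_curve (L2 leb Om) (L2norm leb Om) T c.
Hypothesis cu : forall t, D t -> {ae leb, forall x, Om x -> c t x = (u t).1 x}.

Let mOm : measurable Om. Proof. exact: open_measurable_rV. Qed.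
Let HL := L2_semi_inner leb mOm.
Local Notation w := (restrict_functional D du).

(** On [[0, T]] this is the du Bois-Reymond lemma. At negative times the clamped curve is constant
    and the restricted functional vanishes, so both sides depend only on the positive parts of [s]
    and [t]. *)
Lemma evolution_increment s t : s <= t -> t <= T ->
  ip (c (clamp T t)) phi.1 - ip (c (clamp T s)) phi.1 = \int[mu]_(r in `]s, t[) w r phi.
Proof.
move=> st tT; rewrite !clamp_max//; last exact: le_trans tT.
have [Phi [dPhi Phi_le0 Phi_ge1 Phi01 Phi1]] := @smooth_step R.
have mst : Num.max 0 s <= Num.max 0 t.
  by rewrite ge_max le_max lexx/= le_max st orbT.
have mt : Num.max 0 t <= T by rewrite ge_max (ltW T0).
have m0 : 0 <= Num.max 0 s by rewrite le_max lexx.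
have cF := continuous_clamped_pairing T0 HL cc (H1_L2 Hphi).
have := @du_bois_reymond_step R Phi dPhi Phi_le0 Phi_ge1 Phi01 Phi1
  (fun t => ip (c (clamp T t)) phi.1) (w^~ phi) T cF.
move=> /(_ (integrable_subset_lebesgue (measurable_itv _) idu)) h.
have {}h : ip (c (clamp T (Num.max 0 t))) phi.1 - ip (c (clamp T (Num.max 0 s))) phi.1
    = \int[mu]_(r in `]Num.max 0 s, Num.max 0 t[) w r phi.
  apply: h => // psi tpsi.
  transitivity (\int[mu]_(t in `]0, T[) (ip (u t).1 phi.1 * derive1 psi t)).
    apply: ae_eq_Rintegral.
    apply: (ae_imply aeD) => r Dr rT; rewrite clamp_id; last first.
      by move: rT; rewrite /= !in_itv/= => /andP[/ltW -> /ltW ->].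
    by congr (_ * _); apply: L2ip_ae; [exact: cu (Dr rT)|exact: aeW].
  rewrite tdu//; congr (- _); apply: ae_eq_Rintegral.
  by apply: (ae_imply aeD) => r Dr rT; rewrite restrict_functional_in//; exact: Dr.
rewrite !clamp_id in h; last 2 first.
- by rewrite in_itv/= m0 (le_trans mst).
- by rewrite in_itv/= mt (le_trans m0).
rewrite h Rintegral_mkcond [RHS]Rintegral_mkcond; apply: eq_Rintegral => r _.
rewrite !patchE; have [Dr|Dr] := pselect (D r); last first.
  by rewrite restrict_functional_out//; case: ifP; case: ifP.
have /andP[r0 rT] : 0 < r < T by have := DT Dr; rewrite /= in_itv.
congr (if _ then _ else _); apply/idP/idP; rewrite !inE/= !in_itv/=.
  by rewrite gt_max lt_max => /andP[/andP[_ ->]] /orP[|->//]; rewrite ltNge (ltW r0).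
by rewrite gt_max lt_max r0 => /andP[-> ->]; rewrite orbT.
Qed.

End evolution.

(** * Differences of two convolutions *)

Lemma integrable_sqrB (R : realType) (f g : R -> R) :
  measurable_fun setT f -> measurable_fun setT g ->
  (@lebesgue_measure R).-integrable setT (EFin \o (fun s => f s ^+ 2)) ->
  (@lebesgue_measure R).-integrable setT (EFin \o (fun s => g s ^+ 2)) ->
  (@lebesgue_measure R).-integrable setT (EFin \o (fun s => (f s - g s) ^+ 2)).
Proof.
move=> mf mg i1 i2.
have i12 := integrableD_lebesgue measurableT
  (integrableZ_lebesgue 2 measurableT i1) (integrableZ_lebesgue 2 measurableT i2).
apply: (dominated_integrable_lebesgue _ _ i12) => //.
  by apply: measurable_funX; exact: measurable_funB.
move=> s _; rewrite ger0_norm ?sqr_ge0//.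
have := sqr_ge0 (f s + g s); lra.
Qed.

Section convolution_difference.
Context {R : realType}.
Local Notation mu := (@lebesgue_measure R).

Lemma kernel_L2 (k : R -> R) (t : R) : measurable_fun setT k ->
  mu.-integrable setT (EFin \o (fun s => k s ^+ 2)) ->
  L2 mu `]0, t[ (fun s => k (t - s)) /\
  L2ip mu `]0, t[ (fun s => k (t - s)) (fun s => k (t - s)) = primitive (fun s => k s ^+ 2) t.
Proof.
move=> mk ik.
have m2 : measurable_fun setT (fun s => (k s ^+ 2)%:E) by exact/measurable_EFinP/measurable_funX.
have E : (\int[mu]_(s in `]0%R, t[) (k (t - s) ^+ 2)%:E = \int[mu]_(s in `]0%R, t[) (k s ^+ 2)%:E)%E.
  by apply: (ge0_integral_reflection (f := fun s => (k s ^+ 2)%:E)) => // s; rewrite lee_fin sqr_ge0.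
split; last first.
  rewrite /L2ip /primitive /Rintegral -E; congr fine.
split.
  apply: measurable_funTS; apply: measurableT_comp => //.
  exact: measurable_funB.
rewrite E; apply: integrable_lty => //.
exact: integrable_subset_lebesgue ik.
Qed.

Lemma kernel_bound (k a : R -> R) (t : R) : measurable_fun setT k -> measurable_fun setT a ->
  (forall s, 0 <= a s) ->
  mu.-integrable setT (EFin \o (fun s => k s ^+ 2)) ->
  mu.-integrable setT (EFin \o (fun s => a s ^+ 2)) ->
  (\int[mu]_(s in `]0%R, t[) (`|k (t - s)| * a s)%:E <=
   (Num.sqrt (primitive (fun s => (k s ^+ 2)%R) t) * Num.sqrt (primitive (fun s => (a s ^+ 2)%R) t))%:E)%E.
Proof.
move=> mk ma a0 ik ia.
have [Lk kE] := kernel_L2 t mk ik.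
have La : L2 mu `]0, t[ a.
  split; first exact: measurable_funTS.
  by apply: integrable_lty => //; exact: integrable_subset_lebesgue ia.
have := @L2_cauchy_schwarz_abs _ _ R mu `]0, t[%classic _ _ (measurable_itv _) Lk La.
have aE : L2ip mu `]0, t[ a a = primitive (fun s => a s ^+ 2) t by [].
rewrite /semi_norm kE aE.
apply: le_trans; rewrite le_eqVlt; apply/orP; left; apply/eqP; apply: eq_integral => s _.
by rewrite normrM (ger0_norm (a0 s)).
Qed.

Context {n : nat}.
Variable Om : set 'rV[R]_n.
Hypothesis oOm : open Om.
Hypothesis bOm : bounded_set Om.
Local Notation leb := (@lebesgue_rV R n).
Local Notation ip := (L2ip leb Om).
Local Notation nrm := (semi_norm ip).

Let mOm : measurable Om. Proof. exact: open_measurable_rV. Qed.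
Let HL := L2_semi_inner leb mOm.

Variables (k1 k2 a1 a2 d : R -> R) (v1 v2 : R -> 'rV[R]_n -> R) (t : R).
Hypothesis mk1 : measurable_fun setT k1.
Hypothesis mk2 : measurable_fun setT k2.
Hypothesis ik1 : mu.-integrable setT (EFin \o (fun s => k1 s ^+ 2)).
Hypothesis ik2 : mu.-integrable setT (EFin \o (fun s => k2 s ^+ 2)).
Hypothesis mv1 : measurable_fun setT (fun z : R * 'rV[R]_n => v1 z.1 z.2).
Hypothesis mv2 : measurable_fun setT (fun z : R * 'rV[R]_n => v2 z.1 z.2).
Hypothesis ma1 : measurable_fun setT a1.
Hypothesis ma2 : measurable_fun setT a2.
Hypothesis md : measurable_fun setT d.
Hypothesis a10 : forall s, 0 <= a1 s.
Hypothesis a20 : forall s, 0 <= a2 s.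
Hypothesis d0 : forall s, 0 <= d s.
Hypothesis ia1 : mu.-integrable setT (EFin \o (fun s => a1 s ^+ 2)).
Hypothesis ia2 : mu.-integrable setT (EFin \o (fun s => a2 s ^+ 2)).
Hypothesis id2 : mu.-integrable setT (EFin \o (fun s => d s ^+ 2)).
Hypothesis h1 : {ae mu, forall s, s \in `]0, t[ -> L2 leb Om (v1 s) /\ nrm (v1 s) <= a1 s}.
Hypothesis h2 : {ae mu, forall s, s \in `]0, t[ -> L2 leb Om (v2 s) /\ nrm (v2 s) <= a2 s}.
Hypothesis hd : {ae mu, forall s, s \in `]0, t[ -> nrm (v1 s - v2 s) <= d s}.

Local Notation sq f := (fun s : R => f s ^+ 2).

(* [k1 * v1 - k2 * v2 = k1 * (v1 - v2) + (k1 - k2) * v2] *)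
Lemma window_conv_difference phi : L2 leb Om phi ->
  `|ip (window_conv k1 v1 t) phi - ip (window_conv k2 v2 t) phi| <=
  (Num.sqrt (primitive (sq k1) t) * Num.sqrt (primitive (sq d) t) +
   Num.sqrt (primitive (fun s => (k1 s - k2 s) ^+ 2) t) * Num.sqrt (primitive (sq a2) t))
  * nrm phi.
Proof.
move=> Lphi.
have mk : measurable_fun setT (fun s => k1 s - k2 s) by exact: measurable_funB.
have mv : measurable_fun setT (fun z : R * 'rV[R]_n => (v1 z.1 - v2 z.1) z.2).
  exact: measurable_funB.
have ik := integrable_sqrB mk1 mk2 ik1 ik2.
have hdd : {ae mu, forall s, s \in `]0, t[ ->
    L2 leb Om (v1 s - v2 s) /\ nrm (v1 s - v2 s) <= d s}.
  apply: (ae_imply (ae_and (ae_and h1 h2) hd)) => s [[x1 x2] x3] st; split; last exact: x3.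
  by apply: (domB HL); [case: (x1 st)|case: (x2 st)].
have C1 := kernel_bound t mk1 ma1 a10 ik1 ia1.
have C2 := kernel_bound t mk2 ma2 a20 ik2 ia2.
have CA := kernel_bound t mk1 md d0 ik1 id2.
have CB := kernel_bound t mk ma2 a20 ik ia2.
have [i1 _] := window_conv_bound oOm bOm mk1 mv1 ma1 a10 h1 C1 Lphi.
have [i2 _] := window_conv_bound oOm bOm mk2 mv2 ma2 a20 h2 C2 Lphi.
have [iA bA] := window_conv_bound oOm bOm mk1 mv md d0 hdd CA Lphi.
have [iB bB] := window_conv_bound oOm bOm mk mv2 ma2 a20 h2 CB Lphi.
(* At a fixed [x] the decomposition adds and subtracts four integrals in [s]; each is integrable for
   almost every [x]. *)
have e1 := window_conv_integrable oOm bOm mk1 mv1 ma1 a10 h1 C1.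
have e2 := window_conv_integrable oOm bOm mk2 mv2 ma2 a20 h2 C2.
have eA := window_conv_integrable oOm bOm mk1 mv md d0 hdd CA.
have eB := window_conv_integrable oOm bOm mk mv2 ma2 a20 h2 CB.
rewrite mulrDl; apply: le_trans (lerD bA bB).
apply: le_trans (ler_normD _ _); rewrite le_eqVlt; apply/orP; left; apply/eqP; congr `|_|.
rewrite -RintegralB// -RintegralD//; apply: ae_eq_Rintegral.
apply: (ae_imply (ae_and (ae_and e1 e2) (ae_and eA eB))) => x [[x1 x2] [xA xB]] Ox.
rewrite -mulrBl -mulrDl; congr (_ * _).
rewrite /window_conv -RintegralB//; [|exact: x1|exact: x2].
rewrite -RintegralD//; [|exact: xA|exact: xB].
apply: eq_Rintegral => s _.
have -> : (v1 s - v2 s) x = v1 s x - v2 s x by [].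
by ring.
Qed.

End convolution_difference.

(** The closed and the open window differ by the endpoints 0 and [t], where the patched functions
    may differ from the originals; these two points are null. *)
Lemma conv_window (R : realType) (K m k m' : R -> R) (t T : R) : t < T ->
  (forall s, 0 < s < T -> K s = k s) -> (forall s, 0 < s < T -> m s = m' s) ->
  Defs.conv K m t = \int[@lebesgue_measure R]_(s in `]0, t[) (k (t - s) * m' s).
Proof.
move=> tT Kk mm; rewrite /Defs.conv Rintegral_mkcond [RHS]Rintegral_mkcond; apply: ae_eq_Rintegral.
have n0 (x : R) : {ae @lebesgue_measure R, forall s : R, s != x}.
  exists [set x]; split => //; first by rewrite lebesgue_measure_set1.
  by move=> s /= /negP; rewrite negbK => /eqP.
apply: (ae_imply (ae_and (n0 0) (n0 t))) => s [s0 st] _; rewrite !patchE.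
have [/andP[ps ts]|ns] := boolP (0 < s < t).
  rewrite !mem_set/= ?in_itv/= ?ps ?ts ?(ltW ps) ?(ltW ts)//.
  by rewrite Kk ?mm// ?ps ?(lt_trans ts)// subr_gt0 ts (le_lt_trans _ tT)// lerBlDr lerDl ltW.
rewrite !memNset//= in_itv/=; first exact/negP.
by move=> /andP[h1 h2]; move/negP: ns; apply; rewrite !lt_neqAle h1 h2 eq_sym s0 st.
Qed.

(** * Comparison of two solutions *)

Section one_solution.
Context {R : realType} {n : nat}.
Local Notation mu := (@lebesgue_measure R).
Local Notation leb := (@lebesgue_rV R n).
Variables (Om : set 'rV[R]_n) (T : R).
Hypothesis oOm : open Om.
Hypothesis bOm : bounded_set Om.
Hypothesis T0 : 0 < T.
Variables (u0 : 'rV[R]_n -> R) (g h : R -> 'rV[R]_n -> R) (m dm : R -> R).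
Variable f : 'rV[R]_n -> R -> R -> 'rV[R]_n -> R.
Local Notation ip := (L2ip leb Om).
Local Notation H1n := (semi_norm (H1ip Om)).
Local Notation surf := (@surface_measure R n).
Local Notation Gam := (rV_boundary Om).

Let mOm : measurable Om. Proof. exact: open_measurable_rV. Qed.
Let HL := L2_semi_inner leb mOm.
Let HH := H1_semi_inner oOm bOm.

(** Collects what a solution asserts at almost every time, with the existential witnesses as
    parameters, so that a single full set of times can serve two solutions. *)
Record solution_at (u : R -> sobolev_pair R n) (K : R -> R) (c : R -> 'rV[R]_n -> R)
    (du : R -> sobolev_pair R n -> R) (su : nat -> R -> sobolev_pair R n)
    (sdu : nat -> R -> sobolev_pair R n -> R) (t : R) : Prop := SolutionAt {
  at_H1 : H1 Om (u t);
  at_su : H1n (su k t - u t) @[k --> \oo] --> (0 : R);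
  at_dual : dual (H1 Om) H1n (du t);
  at_sdu : dual_norm (H1 Om) H1n (sdu k t - du t) @[k --> \oo] --> (0 : R);
  at_c : {ae leb, forall x, Om x -> c t x = (u t).1 x};
  at_P : forall phi, H1 Om phi ->
    du t phi + gradip Om (u t) phi + L2ip surf Gam (g t) (trace Om phi)
    + K t * ip (h t) phi.1 + ip (fun x => Defs.conv K (fun s => (u s).1 x) t) phi.1
    = ip (source f u t) phi.1;
  at_MP : dm t + L2ip surf Gam (g t) (cst 1) + K t * ip (h t) (cst 1) + Defs.conv K m t
    = ip (source f u t) (cst 1)
}.

Record solution_data (u : R -> sobolev_pair R n) (K : R -> R) (c : R -> 'rV[R]_n -> R)
    (du : R -> sobolev_pair R n -> R) (su : nat -> R -> sobolev_pair R n)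
    (sdu : nat -> R -> sobolev_pair R n -> R) : Prop := SolutionData {
  data_su : forall k, simple_curve (H1 Om) (su k);
  data_sdu : forall k, simple_curve (dual (H1 Om) H1n) (sdu k);
  data_u2 : (\int[mu]_(t in `]0%R, T[) (H1n (u t) ^+ 2)%:E < +oo)%E;
  data_du2 : (\int[mu]_(t in `]0%R, T[) (dual_norm (H1 Om) H1n (du t) ^+ 2)%:E < +oo)%E;
  data_tdu : time_derivative Om T u du;
  data_c : continuous_curve (L2 leb Om) (L2norm leb Om) T c;
  data_c0 : {ae leb, forall x, Om x -> c 0 x = u0 x};
  data_meas : measurable_fun (`]0, T[ `*` Om) (fun z : R * 'rV[R]_n => (u z.1).1 z.2);
  data_K : L2 mu `]0, T[ K;
  data_ae : {ae mu, forall t, t \in `]0, T[ -> solution_at u K c du su sdu t}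
}.

Lemma solution_dataP u K : solution Om T u0 g h m dm f u K ->
  exists c du su sdu, solution_data u K c du su sdu.
Proof.
case=> [[uH [su [ssu csu]] u2] mu2 LK [c [cc cu c0]]
  [du [[duH [sdu [ssdu csdu]] du2] tdu eqP]] eqMP].
exists c, du, su, sdu; split => //.
apply: (ae_imply (ae_and (ae_and (ae_and uH csu) (ae_and duH csdu)) (ae_and cu (ae_and eqP eqMP)))).
by move=> t [[[h1 h2] [h3 h4]] [h5 [h6 h7]]] tT; split; [exact: h1|exact: h2|exact: h3|
  exact: h4|exact: h5|exact: h6|exact: h7].
Qed.

Variables (u : R -> sobolev_pair R n) (K : R -> R) (c : R -> 'rV[R]_n -> R)
  (du : R -> sobolev_pair R n -> R) (su : nat -> R -> sobolev_pair R n)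
  (sdu : nat -> R -> sobolev_pair R n -> R) (D : set R).
Hypothesis data : solution_data u K c du su sdu.
Hypothesis mD : measurable D.
Hypothesis DT : D `<=` `]0, T[.
Hypothesis aeD : {ae mu, forall t, t \in `]0, T[ -> D t}.
Hypothesis Dsol : forall t, D t -> solution_at u K c du su sdu t.

Local Notation U := (restrict_curve D u).
Local Notation W := (restrict_functional D du).

(** The jointly measurable version of [u], for Fubini's theorem. The patched curve
    [restrict_curve D u] is the strongly measurable one; they agree on [D] times [Om]. *)
Definition joint_patch (u : R -> sobolev_pair R n) (s : R) (x : 'rV[R]_n) : R :=
  ((fun z : R * 'rV[R]_n => (u z.1).1 z.2) \_ (`]0, T[ `*` Om)) (s, x).

Definition fst_energy_norm (u : R -> sobolev_pair R n) (s : R) : R := semi_norm ip (u s).1.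

Definition time_patch (K : R -> R) : R -> R := K \_ `]0, T[.

Definition clamped_patch (m : R -> R) (t : R) : R := \1_(`]0, T[) t * m (clamp T t).

Lemma patched_H1 t : H1 Om (U t).
Proof. by apply: (restrict_curve_dom HH) => r /Dsol; exact: at_H1. Qed.

Lemma patched_simple_limit : simple_limit (S := H1 Om) (ip := H1ip Om) U.
Proof.
apply: (restrict_curve_simple_limit HH mD (data_su data)) => t Dt.
exact: at_su (Dsol Dt).
Qed.

Lemma patched_integrable : mu.-integrable setT (EFin \o (fun t => H1ip Om (U t) (U t))).
Proof.
apply: (restrict_curve_integrable HH DT _ patched_simple_limit (data_u2 data)) => t Dt.
exact: at_H1 (Dsol Dt).
Qed.

Lemma functional_linear t : linear_on (H1 Om) (W t).
Proof. by apply: restrict_functional_linear => r Dr; exact: at_dual (Dsol Dr). Qed.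

Lemma functional_integrable phi : H1 Om phi -> mu.-integrable setT (EFin \o W^~ phi).
Proof.
move=> Hphi.
apply: (integrable_restrict_functional HH mD DT _ Hphi (data_sdu data) _ (data_du2 data)).
- by move=> r Dr; exact: at_dual (Dsol Dr).
- by move=> r Dr; exact: at_sdu (Dsol Dr).
Qed.

Lemma functional_measurable phi : H1 Om phi -> measurable_fun setT (W^~ phi).
Proof. by move=> /functional_integrable /measurable_int /measurable_EFinP. Qed.

Lemma functional_increment phi : H1 Om phi -> forall s t, s <= t -> t <= T ->
  ip (c (clamp T t)) phi.1 - ip (c (clamp T s)) phi.1 = \int[mu]_(r in `]s, t[) W r phi.
Proof.
move=> Hphi; apply: (evolution_increment oOm T0 DT aeD Hphi (functional_integrable Hphi)).
- exact: data_tdu data.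
- exact: data_c data.
- by move=> t Dt; exact: at_c (Dsol Dt).
Qed.

Lemma measurable_joint_patch : measurable_fun setT
  (fun z : R * 'rV[R]_n => joint_patch u z.1 z.2).
Proof.
rewrite (_ : (fun z => _) = (fun z : R * 'rV[R]_n => (u z.1).1 z.2) \_ (`]0, T[ `*` Om)).
  by apply/(measurable_restrictT _ _).1; [exact: measurableX|exact: data_meas data].
by apply/funext => -[].
Qed.

Lemma joint_patchE s x : 0 < s < T -> Om x -> joint_patch u s x = (u s).1 x.
Proof.
by move=> sT Ox; rewrite /joint_patch patchE mem_set//; split => //=; rewrite in_itv.
Qed.

Lemma joint_patch_L2 s : D s -> L2 leb Om (joint_patch u s).
Proof.
move=> Ds; apply: (L2_ae _ (H1_L2 (at_H1 (Dsol Ds)))).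
  by apply: measurable_funTS; exact: measurable_fun_pair2 measurable_joint_patch.
apply: aeW => x Ox; rewrite joint_patchE//.
by have := DT Ds; rewrite /= in_itv.
Qed.

Lemma joint_patch_ip s phi : D s -> ip (joint_patch u s) phi = ip (U s).1 phi.
Proof.
move=> Ds; apply: eq_Rintegral => x; rewrite inE => Ox.
rewrite joint_patchE//; first by rewrite restrict_curve_in.
by have := DT Ds; rewrite /= in_itv.
Qed.

Lemma measurable_fst_energy_norm : measurable_fun setT (fst_energy_norm U).
Proof.
apply: (measurableT_comp (continuous_measurable_fun (@sqrt_continuous R))).
exact: (measurable_fst_energy oOm bOm patched_H1 patched_simple_limit).
Qed.

Lemma integrable_fst_energy_norm :
  mu.-integrable setT (EFin \o (fun s => fst_energy_norm U s ^+ 2)).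
Proof.
rewrite (_ : (fun s => _) = (fun s => ip (U s).1 (U s).1)).
  exact: (integrable_fst_energy oOm bOm patched_H1 patched_simple_limit patched_integrable).
by apply/funext => s; rewrite /fst_energy_norm (nrm_sqr HL)//; exact: H1_L2 (patched_H1 s).
Qed.

Lemma joint_patch_norm s : D s -> semi_norm ip (joint_patch u s) = fst_energy_norm U s.
Proof.
move=> Ds; congr Num.sqrt; rewrite joint_patch_ip//.
rewrite (semi_ipC HL); [|exact: H1_L2 (patched_H1 s)|exact: joint_patch_L2].
by rewrite joint_patch_ip.
Qed.

Lemma measurable_time_patch : measurable_fun setT (time_patch K).
Proof. by apply/(measurable_restrictT _ _).1 => //; case: (data_K data). Qed.

Lemma integrable_time_patch :
  mu.-integrable setT (EFin \o (fun s => time_patch K s ^+ 2)).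
Proof.
have := L2_integrable_sqr (data_K data) => /(integrable_mkcond _ _).1 i.
have {}i := i (measurable_itv _).
move: i; congr (mu.-integrable _ _); apply/funext => s /=.
by rewrite /time_patch !patchE; case: ifP => // _; rewrite expr0n.
Qed.

Lemma time_patchE s : 0 < s < T -> time_patch K s = K s.
Proof. by move=> sT; rewrite /time_patch patchE mem_set//= in_itv. Qed.

Lemma patched_variational t phi : D t -> H1 Om phi ->
  W t phi + gradip Om (U t) phi + L2ip surf Gam (g t) (trace Om phi)
  + K t * ip (h t) phi.1 + ip (window_conv (time_patch K) (joint_patch u) t) phi.1
  = ip (source f U t) phi.1.
Proof.
move=> Dt Hphi; have := at_P (Dsol Dt) Hphi.
have /andP[t0 tT] : 0 < t < T by have := DT Dt; rewrite /= in_itv.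
rewrite restrict_functional_in// {2}/source restrict_curve_in// => <-.
congr (_ + _); apply: eq_Rintegral => x; rewrite inE => Ox; congr (_ * _).
symmetry; apply: (conv_window (T := T)) => // s sT; first by rewrite time_patchE.
by rewrite joint_patchE.
Qed.

Lemma patched_measurement t : D t ->
  dm t + L2ip surf Gam (g t) (cst 1) + K t * ip (h t) (cst 1)
  + \int[mu]_(s in `]0, t[) (time_patch K (t - s) * clamped_patch m s)
  = ip (source f U t) (cst 1).
Proof.
move=> Dt; have := at_MP (Dsol Dt).
have /andP[t0 tT] : 0 < t < T by have := DT Dt; rewrite /= in_itv.
rewrite /source restrict_curve_in// => <-; congr (_ + _).
symmetry; apply: (conv_window (T := T)) => // s sT; first by rewrite time_patchE.
have /andP[s0 s1] := sT.
rewrite /clamped_patch indicE mem_set/= ?in_itv//= mul1r clamp_id//.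
by rewrite in_itv/= (ltW s0) (ltW s1).
Qed.

End one_solution.

Lemma continuous_clamped (R : realType) (m : R -> R) (T : R) : 0 < T ->
  {within `[0, T], continuous m} -> continuous (m \o clamp T).
Proof.
move=> T0 hm t; apply: (cvg_comp (clamp T) m (clamp_within T0 (t := t))).
have tI : `[0, T]%classic (clamp T t) by exact: clamp_itv.
exact: (@subspace_continuousP _ _ _ _).1 hm _ tI.
Qed.

(** * Estimates for the differences of the two solutions *)

Section two_solutions.
Context {R : realType} {n : nat}.
Local Notation mu := (@lebesgue_measure R).
Local Notation leb := (@lebesgue_rV R n).
Variables (Om : set 'rV[R]_n) (T : R).
Hypothesis oOm : open Om.
Hypothesis bOm : bounded_set Om.
Hypothesis T0 : 0 < T.
Variables (u0 : 'rV[R]_n -> R) (g h : R -> 'rV[R]_n -> R) (m dm : R -> R).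
Variable f : 'rV[R]_n -> R -> R -> 'rV[R]_n -> R.
Local Notation ip := (L2ip leb Om).
Local Notation nrm := (semi_norm ip).
Local Notation H1n := (semi_norm (H1ip Om)).

Let mOm : measurable Om. Proof. exact: open_measurable_rV. Qed.
Let HL := L2_semi_inner leb mOm.
Let HH := H1_semi_inner oOm bOm.
Let HG := gradip_semi_inner oOm bOm.

Variables (L omega : R).
Hypothesis L0 : 0 < L.
Hypothesis fL : forall (t : R) x y a b p q, t \in `[0, T] -> Om x -> Om y ->
  `|f x t a p - f y t b q| <= L * Num.max `|x - y| (Num.max `|a - b| `|p - q|).
Hypothesis hh : continuous_curve (L2 leb Om) (L2norm leb Om) T h.
Hypothesis omega0 : 0 < omega.
Hypothesis hmin : forall t, t \in `[0, T] -> omega <= `|ip (h t) (cst 1)|.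
Hypothesis hm : {within `[0, T], continuous m}.

Variables (u1 u2 : R -> sobolev_pair R n) (K1 K2 : R -> R) (c1 c2 : R -> 'rV[R]_n -> R)
  (du1 du2 : R -> sobolev_pair R n -> R) (su1 su2 : nat -> R -> sobolev_pair R n)
  (sdu1 sdu2 : nat -> R -> sobolev_pair R n -> R) (D : set R).
Hypothesis data1 : solution_data Om T u0 g h m dm f u1 K1 c1 du1 su1 sdu1.
Hypothesis data2 : solution_data Om T u0 g h m dm f u2 K2 c2 du2 su2 sdu2.
Hypothesis mD : measurable D.
Hypothesis DT : D `<=` `]0, T[.
Hypothesis aeD : {ae mu, forall t, t \in `]0, T[ -> D t}.
Hypothesis Dsol1 : forall t, D t -> solution_at Om g h m dm f u1 K1 c1 du1 su1 sdu1 t.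
Hypothesis Dsol2 : forall t, D t -> solution_at Om g h m dm f u2 K2 c2 du2 su2 sdu2 t.

Local Notation U1 := (restrict_curve D u1).
Local Notation U2 := (restrict_curve D u2).
Local Notation W1 := (restrict_functional D du1).
Local Notation W2 := (restrict_functional D du2).
Local Notation k1 := (time_patch T K1).
Local Notation k2 := (time_patch T K2).
Local Notation v1 := (joint_patch Om T u1).
Local Notation v2 := (joint_patch Om T u2).

Let u t := U1 t - U2 t.
Let w t v := W1 t v - W2 t v.
Let c t := c1 (clamp T t) - c2 (clamp T t).
Let k12 t := k1 t - k2 t.
(** The additional cut to [D] makes the pointwise bound of [k] hold at every time. The primitives up
    to [T] are unchanged ([primitive_k12]). *)
Let K t := \1_D t * k12 t.
Let a t := ip (u t).1 (u t).1.
Let p t := gradip Om (u t) (u t).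
Let k t := K t ^+ 2.

Let HU1 t : H1 Om (U1 t). Proof. exact: (patched_H1 oOm bOm Dsol1 t). Qed.
Let HU2 t : H1 Om (U2 t). Proof. exact: (patched_H1 oOm bOm Dsol2 t). Qed.
Let Hu t : H1 Om (u t). Proof. exact: (domB HH (HU1 t) (HU2 t)). Qed.

Let DT' t : D t -> 0 < t < T. Proof. by move=> /DT; rewrite /= in_itv. Qed.

Let u_simple : simple_limit (S := H1 Om) (ip := H1ip Om) u.
Proof.
apply: (simple_limitB HH HU1 HU2).
- exact: (patched_simple_limit oOm bOm data1 mD Dsol1).
- exact: (patched_simple_limit oOm bOm data2 mD Dsol2).
Qed.

Let iu : mu.-integrable setT (EFin \o (fun t => H1ip Om (u t) (u t))).
Proof.
have i1 := patched_integrable oOm bOm data1 mD DT Dsol1.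
have i2 := patched_integrable oOm bOm data2 mD DT Dsol2.
have ii := integrableD_lebesgue measurableT
  (integrableZ_lebesgue 2 measurableT i1) (integrableZ_lebesgue 2 measurableT i2).
apply: (dominated_integrable_lebesgue _ _ ii) => //.
  exact: (measurable_ip HH Hu u_simple Hu u_simple).
move=> t _; rewrite ger0_norm ?(ip_ge0 HH)// (ip_sqrB HH)//.
have := ip_ge0 HH (domD HH (HU1 t) (HU2 t)); rewrite (ip_sqrD HH)//=; lra.
Qed.

Let mk1 := measurable_time_patch data1.
Let mk2 := measurable_time_patch data2.
Let ik1 := integrable_time_patch data1.
Let ik2 := integrable_time_patch data2.

Let mK : measurable_fun setT K.
Proof. by apply: measurable_funM; [exact: measurable_indic|exact: measurable_funB]. Qed.

Let ik12 : mu.-integrable setT (EFin \o (fun s => k12 s ^+ 2)).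
Proof. exact: integrable_sqrB. Qed.

Let iK : mu.-integrable setT (EFin \o k).
Proof.
apply: (dominated_integrable_lebesgue _ _ ik12) => //; first exact: measurable_funX.
move=> t _; rewrite ger0_norm ?sqr_ge0// /k /K indicE.
by case: (_ \in _); rewrite ?mul1r// mul0r expr0n sqr_ge0.
Qed.

Let primitive_k12 t : t <= T -> primitive (fun s => k12 s ^+ 2) t = primitive k t.
Proof.
move=> tT; apply: ae_eq_Rintegral; apply: (ae_imply aeD) => s Ds.
rewrite /= in_itv/= => /andP[s0 st]; rewrite /k /K indicE mem_set ?mul1r//.
by apply: Ds; rewrite in_itv/= s0 (lt_le_trans st).
Qed.

Let Ka t : D t -> K t = K1 t - K2 t.
Proof.
by move=> Dt; rewrite /K /k12 indicE mem_set// mul1r !time_patchE ?(DT' Dt).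
Qed.

Let ae_sub t (P : R -> Prop) : t <= T -> (forall s, D s -> P s) ->
  {ae mu, forall s, s \in `]0, t[ -> P s}.
Proof.
move=> tT DP; apply: (ae_imply aeD) => s Ds; rewrite in_itv/= => /andP[s0 st].
by apply/DP/Ds; rewrite in_itv/= s0 (lt_le_trans st).
Qed.

Let A1 := Num.sqrt (primitive (fun s => k1 s ^+ 2) T).
Let A2 := Num.sqrt (primitive (fun s => fst_energy_norm Om U2 s ^+ 2) T).
(** [A1] and [A2] are the norms of [K1] and [u2] on the whole time interval, the coefficients in
    [K1 * u + K * u2]; [sqrt_cauchy] merges the two terms under one root. *)
Let Cq := A1 ^+ 2 + A2 ^+ 2.

Let a0 t : 0 <= a t. Proof. exact: (ip_ge0 HL (H1_L2 (Hu t))). Qed.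
Let p0 t : 0 <= p t. Proof. exact: (ip_ge0 HG (Hu t)). Qed.
Let k0 t : 0 <= k t. Proof. exact: sqr_ge0. Qed.

Let sqrt_cauchy (x y s t : R) : 0 <= x -> 0 <= y -> 0 <= s -> 0 <= t ->
  x * Num.sqrt s + y * Num.sqrt t <= Num.sqrt ((x ^+ 2 + y ^+ 2) * (s + t)).
Proof.
move=> x0 y0 s0 t0.
have st0 : 0 <= x * Num.sqrt s + y * Num.sqrt t by rewrite addr_ge0 ?mulr_ge0 ?sqrtr_ge0.
rewrite -[leLHS]ger0_norm// -sqrtr_sqr ler_wsqrtr//.
have h1 := sqr_sqrtr s0; have h2 := sqr_sqrtr t0.
have := sqr_ge0 (x * Num.sqrt t - y * Num.sqrt s).
set X := Num.sqrt s in h1 *; set Y := Num.sqrt t in h2 *; rewrite -h1 -h2; lra.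
Qed.

Let convolution_bound t phi : D t -> L2 leb Om phi ->
  `|ip (window_conv k1 v1 t) phi - ip (window_conv k2 v2 t) phi| <=
  Num.sqrt (Cq * (primitive a t + primitive k t)) * nrm phi.
Proof.
move=> Dt Lphi; have /andP[t0 /ltW tT] := DT' Dt.
have ia : mu.-integrable setT (EFin \o a) by exact: (integrable_fst_energy oOm bOm Hu u_simple iu).
have aE : (fun s => fst_energy_norm Om u s ^+ 2) = a.
  by apply/funext => s; rewrite /fst_energy_norm (nrm_sqr HL)//; exact: H1_L2.
have := @window_conv_difference R n Om oOm bOm k1 k2 (fst_energy_norm Om U1)
  (fst_energy_norm Om U2) (fst_energy_norm Om u) v1 v2 t mk1 mk2 ik1 ik2
  (measurable_joint_patch oOm data1) (measurable_joint_patch oOm data2)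
  (measurable_fst_energy_norm oOm bOm data1 mD Dsol1)
  (measurable_fst_energy_norm oOm bOm data2 mD Dsol2).
have mfu : measurable_fun setT (fst_energy_norm Om u).
  apply: (measurableT_comp (continuous_measurable_fun (@sqrt_continuous R))).
  exact: (measurable_fst_energy oOm bOm Hu u_simple).
move=> /(_ mfu (fun s => sqrtr_ge0 _) (fun s => sqrtr_ge0 _) (fun s => sqrtr_ge0 _)).
move=> /(_ (integrable_fst_energy_norm oOm bOm data1 mD DT Dsol1)).
have i2 := integrable_fst_energy_norm oOm bOm data2 mD DT Dsol2.
move=> /(_ i2); rewrite aE => /(_ ia _ _ _ phi Lphi) hb.
apply: le_trans (hb _ _ _) _.
- apply: ae_sub => // s Ds; split; first exact: (joint_patch_L2 oOm data1 DT Dsol1).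
  by rewrite (joint_patch_norm oOm bOm data1 DT Dsol1).
- apply: ae_sub => // s Ds; split; first exact: (joint_patch_L2 oOm data2 DT Dsol2).
  by rewrite (joint_patch_norm oOm bOm data2 DT Dsol2).
- apply: ae_sub => // s Ds; rewrite le_eqVlt; apply/orP; left; apply/eqP.
  congr Num.sqrt; apply: eq_Rintegral => x; rewrite inE => Ox.
  have -> : (v1 s - v2 s) x = v1 s x - v2 s x by [].
  by rewrite !joint_patchE ?(DT' Ds)// /u !restrict_curve_in.
rewrite ler_wpM2r ?sqrtr_ge0// primitive_k12//.
apply: le_trans (sqrt_cauchy _ _ _ _); rewrite ?sqrtr_ge0//; try exact: primitive_ge0.
apply: lerD; first by rewrite ler_wpM2r ?sqrtr_ge0// ler_wsqrtr// primitive_nd// => r; exact: sqr_ge0.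
rewrite mulrC ler_wpM2r ?sqrtr_ge0// ler_wsqrtr// primitive_nd// => r; exact: sqr_ge0.
Qed.

Let source_bound t phi : D t -> L2 leb Om phi ->
  `|ip (source f U1 t) phi - ip (source f U2 t) phi| <= L * H1n (u t) * nrm phi.
Proof.
move=> Dt Lphi; have /andP[/ltW t0 /ltW tT] := DT' Dt.
have tI : t \in `[0, T] by rewrite in_itv/= t0 tT.
have S1 := source_L2 oOm bOm L0 fL tI (HU1 t).
have S2 := source_L2 oOm bOm L0 fL tI (HU2 t).
rewrite -(linear_onB HL (ip_linearl HL Lphi))//.
apply: le_trans (cauchy_schwarz HL (domB HL S1 S2) Lphi) _.
rewrite ler_wpM2r ?sqrtr_ge0//.
have := source_lipschitz oOm bOm L0 fL tI (HU1 t) (HU2 t).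
move=> /ler_wsqrtr /le_trans; apply.
by rewrite sqrtrM ?sqr_ge0// sqrtr_sqr ger0_norm ?(ltW L0).
Qed.

Let h_bound : exists2 M, 0 <= M & forall t, t \in `[0, T] -> L2 leb Om (h t) /\ nrm (h t) <= M.
Proof.
have [M hM] := clamped_bound T0 HL hh.
exists (Num.sqrt M) => [|t tT]; first exact: sqrtr_ge0.
split; first by case: hh => + _; apply.
by rewrite ler_wsqrtr//; have := hM t; rewrite clamp_id.
Qed.

Lemma variational_difference : exists2 Mh, 0 <= Mh & forall t v, H1 Om v -> t \in `]0, T[ ->
  `|w t v + gradip Om (u t) v| <=
  (L * H1n (u t) + Mh * `|K t| + Num.sqrt (Cq * (primitive a t + primitive k t))) * nrm v.1.
Proof.
have [Mh Mh0 hMh] := h_bound; exists Mh => // t v Hv tT.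
have Lv := H1_L2 Hv.
have [Dt|Dt] := pselect (D t); last first.
  rewrite /w !restrict_functional_out// /u !restrict_curve_out// !subr0.
  rewrite (linear_on0 HG (ip_linearl HG Hv)) addr0 normr0.
  by rewrite mulr_ge0 ?sqrtr_ge0// !addr_ge0 ?sqrtr_ge0 ?mulr_ge0 ?sqrtr_ge0 ?(ltW L0).
have tI : t \in `[0, T] by move: tT; rewrite !in_itv/= => /andP[/ltW -> /ltW ->].
have e1 := patched_variational DT Dsol1 Dt Hv.
have e2 := patched_variational DT Dsol2 Dt Hv.
have eG : gradip Om (u t) v = gradip Om (U1 t) v - gradip Om (U2 t) v.
  by rewrite (linear_onB HG (ip_linearl HG Hv)).
have -> : w t v + gradip Om (u t) v =
    (ip (source f U1 t) v.1 - ip (source f U2 t) v.1) - K t * ip (h t) v.1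
    - (ip (window_conv k1 v1 t) v.1 - ip (window_conv k2 v2 t) v.1).
  (* [r] is the boundary term, common to both equations, and cancels. *)
  have alg (x1 x2 g1 g2 r y1 y2 z q1 q2 : R) : x1 - x2 + (g1 - g2) =
      (x1 + g1 + r + y1 * z + q1 - (x2 + g2 + r + y2 * z + q2)) - (y1 - y2) * z - (q1 - q2) by ring.
  by rewrite eG (Ka Dt) -e1 -e2; exact: alg.
apply: le_trans (ler_normB _ _) _; rewrite mulrDl; apply: lerD; last exact: convolution_bound.
apply: le_trans (ler_normB _ _) _; rewrite mulrDl; apply: lerD; first exact: source_bound.
have [Lh nh] := hMh t tI.
rewrite normrM [Mh * _]mulrC -mulrA ler_wpM2l//.
by apply: le_trans (cauchy_schwarz HL Lh Lv) _; rewrite ler_wpM2r ?sqrtr_ge0.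
Qed.

(** Both solutions are measured by the same [m], so the difference is the convolution of [K1 - K2]
    with [m]. Cauchy-Schwarz gives the squared L^2 norm of [m] as [B]. *)
Let measurement_kernel_bound : exists2 B, 0 <= B & forall t, D t ->
  (\int[mu]_(s in `]0, t[) (k1 (t - s) * clamped_patch T m s) -
   \int[mu]_(s in `]0, t[) (k2 (t - s) * clamped_patch T m s)) ^+ 2 <= B * primitive k t.
Proof.
have cm := continuous_clamped T0 hm.
have [M mM] := clamped_compact T0 cm.
have mmt : measurable_fun setT (clamped_patch T m).
  by apply: measurable_funM; [exact: measurable_indic|exact: continuous_measurable_fun cm].
have imt : mu.-integrable setT (EFin \o (fun s => clamped_patch T m s ^+ 2)).
  have iI : mu.-integrable setT (EFin \o (fun t => \1_(`]0, T[) t)) by exact: integrable_indic_itv.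
  apply: (dominated_integrable_lebesgue _ _ (integrableZ_lebesgue (M ^+ 2) measurableT iI)) => //.
    exact: measurable_funX.
  move=> t _; rewrite ger0_norm ?sqr_ge0// /clamped_patch exprMn indicE.
  case: (_ \in _); rewrite /= ?expr1n ?expr0n/= ?mul1r ?mulr1 ?mul0r ?mulr0//.
  by rewrite -real_normK ?num_real// lerXn2r ?nnegrE// (le_trans _ (mM 0)).
exists (primitive (fun s => clamped_patch T m s ^+ 2) T).
  by apply: primitive_ge0 => s; exact: sqr_ge0.
move=> t Dt; have /andP[/ltW t0 /ltW tT] := DT' Dt.
have Hmu := @L2_semi_inner _ _ R mu `]0, t[%classic (measurable_itv _).
have mk12 : measurable_fun setT k12 by exact: measurable_funB.
have [Lk1 _] := kernel_L2 t mk1 ik1; have [Lk2 _] := kernel_L2 t mk2 ik2.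
have [Lk12 kE] := kernel_L2 t mk12 ik12.
have Lm : L2 mu `]0, t[ (clamped_patch T m).
  split; first exact: measurable_funTS.
  by apply: integrable_lty => //; exact: integrable_subset_lebesgue imt.
have mE : L2ip mu `]0, t[ (clamped_patch T m) (clamped_patch T m) =
  primitive (fun s => clamped_patch T m s ^+ 2) t by [].
have := cauchy_schwarz_sqr Hmu Lk12 Lm; rewrite kE mE primitive_k12//.
have -> : (fun s => k12 (t - s)) = (fun s => k1 (t - s)) - (fun s => k2 (t - s)) by [].
rewrite (linear_onB Hmu (ip_linearl Hmu Lm))// => /le_trans; apply.
by rewrite mulrC ler_wpM2r ?primitive_ge0// primitive_nd// => s; exact: sqr_ge0.
Qed.

Lemma kernel_difference : exists C1, forall t, k t <= C1 * (primitive k t + a t + p t).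
Proof.
have [B B0 hB] := measurement_kernel_bound.
have fOm : (leb Om < +oo)%E by exact: bounded_lebesgue_rV_lty.
have L1 : L2 leb Om (cst 1) by exact: L2_cst.
pose V := ip (cst 1) (cst 1).
have V0 : 0 <= V by exact: (ip_ge0 HL L1).
(* The factors 2 come from [(x - y)^2 <= 2 x^2 + 2 y^2] for the source and convolution differences,
   [V] from testing with 1, and [omega] from dividing by [(h, 1)]. *)
exists (omega ^- 2 * (2 * B + 2 * L ^+ 2 * V)) => t.
have C0 : 0 <= 2 * B + 2 * L ^+ 2 * V.
  by apply: addr_ge0; apply: mulr_ge0 => //; apply: mulr_ge0 => //; exact: sqr_ge0.
have P0 := primitive_ge0 t k0.
have [Dt|Dt] := pselect (D t); last first.
  rewrite {1}/k {1}/K indicE memNset// mul0r expr0n/=.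
  apply: mulr_ge0; last by rewrite !addr_ge0.
  by rewrite mulr_ge0// invr_ge0 sqr_ge0.
have tI : t \in `[0, T] by have := DT' Dt; rewrite in_itv/= => /andP[/ltW -> /ltW ->].
have e1 := patched_measurement DT Dsol1 Dt.
have e2 := patched_measurement DT Dsol2 Dt.
have hI := hB t Dt; have hS := source_bound Dt L1.
move: e1 e2 hI hS.
set I1 := \int[_]_(_ in _) _; set I2 := \int[_]_(_ in _) (k2 _ * _).
set S1 := ip (source f U1 t) _; set S2 := ip (source f U2 t) _ => e1 e2 hI hS.
have eK : K t * ip (h t) (cst 1) = (S1 - S2) - (I1 - I2) by rewrite (Ka Dt) -e1 -e2; ring.
have hS2 : (S1 - S2) ^+ 2 <= L ^+ 2 * (a t + p t) * V.
  have -> : a t + p t = H1n (u t) ^+ 2 by rewrite (nrm_sqr HH (Hu t)).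
  have -> : V = nrm (cst 1) ^+ 2 by rewrite (nrm_sqr HL L1).
  rewrite -!exprMn -[leLHS]real_normK ?num_real//.
  by rewrite lerXn2r ?nnegrE ?mulr_ge0 ?sqrtr_ge0 ?(ltW L0).
have hK : omega ^+ 2 * k t <= (S1 - S2 - (I1 - I2)) ^+ 2.
  rewrite -eK exprMn mulrC ler_wpM2l// -[leRHS]real_normK ?num_real//.
  by rewrite lerXn2r ?nnegrE ?(ltW omega0)// hmin.
have o2 : 0 < omega ^+ 2 by rewrite exprn_gt0.
rewrite -[leRHS]mulrA ler_pdivlMl//; apply: (le_trans hK).
have h3 := sqr_ge0 (S1 - S2 + (I1 - I2)).
have h4 : 0 <= B * (a t + p t) by rewrite mulr_ge0 ?addr_ge0.
have h5 : 0 <= L ^+ 2 * V * primitive k t.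
  by apply: mulr_ge0 => //; apply: mulr_ge0 => //; exact: sqr_ge0.
have alg (x y b l P a' p' : R) : y ^+ 2 <= b * P -> x ^+ 2 <= l * (a' + p') ->
    0 <= (x + y) ^+ 2 -> 0 <= b * (a' + p') -> 0 <= l * P ->
    (x - y) ^+ 2 <= (2 * b + 2 * l) * (P + a' + p') by move=> *; lra.
rewrite (_ : 2 * L ^+ 2 * V = 2 * (L ^+ 2 * V)); last by rewrite mulrA.
by apply: alg => //; rewrite mulrAC.
Qed.

Let cc1 := data_c data1.
Let cc2 := data_c data2.
Let Lc1 t := clamped_dom T0 cc1 t.
Let Lc2 t := clamped_dom T0 cc2 t.
Let Lc t : L2 leb Om (c t). Proof. exact: (domB HL (Lc1 t) (Lc2 t)). Qed.

Let c_cvg t : nrm (c s - c t) @[s --> t] --> (0 : R).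
Proof.
have hc : nrm (c1 (clamp T s) - c1 (clamp T t)) + nrm (c2 (clamp T s) - c2 (clamp T t))
    @[s --> t] --> (0 : R).
  by rewrite -[X in _ --> X](addr0 0); apply: cvgD; [exact: (clamped_cvg T0 cc1 t)|exact: (clamped_cvg T0 cc2 t)].
apply: (squeeze_cvgr _ (cvg_cst 0) hc); apply: nearW => s.
rewrite sqrtr_ge0/=.
have -> : c s - c t = (c1 (clamp T s) - c1 (clamp T t)) - (c2 (clamp T s) - c2 (clamp T t)).
  by rewrite /c !opprB addrACA [RHS]addrACA; congr (_ + _); exact: addrC.
have L1 := domB HL (Lc1 s) (Lc1 t); have L2 := domB HL (Lc2 s) (Lc2 t).
by apply: le_trans (nrmD HL L1 (domN HL L2)) _; rewrite (nrmN HL).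
Qed.

Let c_init : ip (c 0) (c 0) = 0.
Proof.
have I0 : clamp T 0 = 0 by rewrite clamp_id// in_itv/= lexx ltW.
have c00 : {ae leb, forall x, Om x -> c 0 x = 0}.
  apply: (ae_imply (ae_and (data_c0 data1) (data_c0 data2))) => x [h1 h2] Ox.
  have -> : c 0 x = c1 (clamp T 0) x - c2 (clamp T 0) x by [].
  by rewrite I0 h1// h2// subrr.
exact: (L2ip_ae0 mOm c00).
Qed.

Let c_bound : exists M, forall t, ip (c t) (c t) <= M.
Proof.
have [M1 hM1] := clamped_bound T0 HL cc1; have [M2 hM2] := clamped_bound T0 HL cc2.
exists (2 * M1 + 2 * M2) => t; rewrite /c (ip_sqrB HL)//.
have := ip_ge0 HL (domD HL (Lc1 t) (Lc2 t)); rewrite (ip_sqrD HL)//.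
have := hM1 t; have := hM2 t; lra.
Qed.

Let w_linear t : linear_on (H1 Om) (w t).
Proof.
move=> e v v' Hv Hv'; rewrite /w (functional_linear Dsol1)// (functional_linear Dsol2)//.
by ring.
Qed.

Let w_measurable v : H1 Om v -> measurable_fun setT (w^~ v).
Proof.
move=> Hv; apply: measurable_funB.
- exact: (functional_measurable oOm bOm data1 mD DT Dsol1 Hv).
- exact: (functional_measurable oOm bOm data2 mD DT Dsol2 Hv).
Qed.

Let w_out t v : t \notin `]0, T[ -> w t v = 0.
Proof.
move=> tT; have nD : ~ D t by move=> /DT Dt; move/negP: tT.
by rewrite /w !restrict_functional_out// subrr.
Qed.

Let c_increment phi : H1 Om phi -> forall s t, s <= t -> t <= T ->
  ip (c t) phi.1 - ip (c s) phi.1 = \int[mu]_(r in `]s, t[) w r phi.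
Proof.
move=> Hphi s t st tT; have Lphi := H1_L2 Hphi.
have i1 := functional_integrable oOm bOm data1 mD DT Dsol1 Hphi.
have i2 := functional_integrable oOm bOm data2 mD DT Dsol2 Hphi.
rewrite RintegralB//; try exact: (integrable_subset_lebesgue (measurable_itv _)).
rewrite -(functional_increment oOm bOm T0 data1 mD DT aeD Dsol1 Hphi st tT).
rewrite -(functional_increment oOm bOm T0 data2 mD DT aeD Dsol2 Hphi st tT).
rewrite /c !(linear_onB HL (ip_linearl HL Lphi))//; ring.
Qed.

Let uD t : D t -> u t = u1 t - u2 t.
Proof. by move=> Dt; rewrite /u !restrict_curve_in. Qed.

Let c_eq t : D t -> {ae leb, forall x, Om x -> c t x = (u t).1 x}.
Proof.
move=> Dt; have /andP[/ltW t0 /ltW tT] := DT' Dt.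
apply: (ae_imply (ae_and (at_c (Dsol1 Dt)) (at_c (Dsol2 Dt)))) => x [h1 h2] Ox.
have -> : c t x = c1 (clamp T t) x - c2 (clamp T t) x by [].
have tI : t \in `[0, T] by rewrite in_itv/= t0 tT.
by rewrite clamp_id// h1// h2// uD.
Qed.

Let c_u : {ae mu, forall t, t \in `]0, T[ -> ip (c t - (u t).1) (c t - (u t).1) = 0}.
Proof.
apply: (ae_imply aeD) => t Dt tT.
have e0 : {ae leb, forall x, Om x -> (c t - (u t).1) x = 0}.
  apply: (ae_imply (c_eq (Dt tT))) => x e Ox.
  have -> : (c t - (u t).1) x = c t x - (u t).1 x by [].
  by rewrite e// subrr.
exact: (L2ip_ae0 mOm e0).
Qed.

Let vanishing : [/\ forall t, 0 < t <= T -> ip (c t) (c t) = 0, primitive p T = 0 &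
  primitive k T = 0].
Proof.
have [Mh Mh0 hw] := variational_difference.
have [C1 hk] := kernel_difference; have [M cM] := c_bound.
have Cq0 : 0 <= Cq by apply: addr_ge0; exact: sqr_ge0.
exact: (vanishing_estimate oOm bOm T0 Hu u_simple iu (ltW L0) Mh0 Cq0 w_linear w_measurable
  w_out Lc c_cvg c_init cM c_increment c_u mK iK hw hk).
Qed.

Lemma solutions_agree :
  {ae mu, forall t, t \in `]0, T[ ->
    {ae leb, forall x, Om x -> (u1 t).1 x = (u2 t).1 x /\ (u1 t).2 x = (u2 t).2 x}} /\
  {ae mu, forall t, t \in `]0, T[ -> K1 t = K2 t}.
Proof.
have [E0 P0 k00] := vanishing; split; last first.
  have LK : L2 mu `]0, T[ K.
    split; first exact: measurable_funTS.
    by apply: integrable_lty => //; exact: integrable_subset_lebesgue iK.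
  have kT : L2ip mu `]0, T[ K K = 0 by exact: k00.
  have K0 := @L2ip0_ae _ _ R mu `]0, T[%classic (measurable_itv _) K LK kT.
  apply: (ae_imply (ae_and K0 aeD)) => t [Kt Dt] tT; apply/eqP.
  by rewrite -subr_eq0 -(Ka (Dt tT)) Kt.
have ip0 := integrable_gradient_energy oOm bOm Hu u_simple iu.
(* The vanishing primitive of [p] is the squared L^2 norm of its root, so the root vanishes almost
   everywhere. *)
pose q t := Num.sqrt (p t).
have q2 t : q t ^+ 2 = p t by rewrite sqr_sqrtr.
have Lq : L2 mu `]0, T[ q.
  split.
    apply: measurable_funTS.
    apply: (measurableT_comp (continuous_measurable_fun (@sqrt_continuous R))).
    exact/measurable_EFinP/measurable_int/ip0.
  under eq_integral do rewrite q2.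
  by apply: integrable_lty => //; exact: integrable_subset_lebesgue ip0.
have qT : L2ip mu `]0, T[ q q = 0.
  by apply: etrans _ P0; apply: eq_Rintegral => t _; rewrite -expr2 q2.
have p_0 := @L2ip0_ae _ _ R mu `]0, T[%classic (measurable_itv _) q Lq qT.
apply: (ae_imply (ae_and p_0 aeD)) => t [pt Dt] tT; have {}Dt := Dt tT.
have {}pt : p t = 0 by rewrite -q2 pt// expr0n.
have cE : ip (c t) (c t) = 0 by apply: E0; have /andP[-> /ltW ->] := DT' Dt.
have c0 := L2ip0_ae mOm (Lc t) cE.
have g0 i : {ae leb, forall x, Om x -> partial_component i (u t) x = 0}.
  have Lg j : L2 leb Om (partial_component j (u t)) by exact: H1_partial_L2 (Hu t).
  apply: (L2ip0_ae mOm (Lg i)).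
  have := pt; rewrite /p gradipE// => /eqP.
  rewrite psumr_eq0; last by move=> j _; exact: (ip_ge0 HL).
  by move=> /allP /(_ i (mem_index_enum i)) /eqP.
(* The exceptional sets of the finitely many partial derivatives are united. *)
have gall : {ae leb, forall x, forall i, Om x -> partial_component i (u t) x = 0}.
  exact: (@filter_forall _ _ _ _ (ae_filter_ringOfSetsType leb) g0).
apply: (ae_imply (ae_and (ae_and c0 (c_eq Dt)) gall)) => x [[h1 h2] h3] Ox.
have uE := uD Dt.
split.
  apply/eqP; rewrite -subr_eq0; apply/eqP.
  by rewrite -[RHS](h1 Ox) h2// uE.
apply/rowP => i; apply/eqP; rewrite -subr_eq0; apply/eqP.
by rewrite -[RHS](h3 i Ox) uE /partial_component /= !mxE.
Qed.

End two_solutions.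

Theorem theorem1 (R : realType) (N : nat) (hN : (1 <= N)%N)
  (Om : set 'rV[R]_N) (hOm : bounded_lipschitz_domain Om)
  (T : R) (hT : 0 < T)
  (u0 : 'rV[R]_N -> R) (hu0 : L2 (lebesgue_rV N) Om u0)
  (g : R -> 'rV[R]_N -> R)
  (hg : forall t, t \in `[0, T] -> L2 (surface_measure N) (rV_boundary Om) (g t))
  (h : R -> 'rV[R]_N -> R)
  (hh : continuous_curve (L2 (lebesgue_rV N) Om) (L2norm (lebesgue_rV N) Om) T h)
  (omega : R) (homega : 0 < omega)
  (hmin : forall t, t \in `[0, T] ->
    omega <= `|L2ip (lebesgue_rV N) Om (h t) (cst 1)|)
  (m : R -> R) (hm : {within `[0, T], continuous m})
  (dm : R -> R) (hdm : weak_derivative T m dm)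
  (f : 'rV[R]_N -> R -> R -> 'rV[R]_N -> R)
  (hf : [lipschitz (f z.1.1.1 z.1.1.2 z.1.2 z.2) | z in
     [set z : 'rV[R]_N * R * R * 'rV[R]_N | Om z.1.1.1 /\ z.1.1.2 \in `[0, T]] ])
  (u1 u2 : R -> sobolev_pair R N) (K1 K2 : R -> R)
  (sol1 : solution Om T u0 g h m dm f u1 K1)
  (sol2 : solution Om T u0 g h m dm f u2 K2) :
  {ae lebesgue_measure, forall t, t \in `]0, T[ ->
    {ae lebesgue_rV N, forall x, Om x ->
      (u1 t).1 x = (u2 t).1 x /\ (u1 t).2 x = (u2 t).2 x}} /\
  {ae lebesgue_measure, forall t, t \in `]0, T[ -> K1 t = K2 t}.
Proof.
have [oOm _ _ bOm _] := hOm.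
have [L L0 fL] := lipschitz_cst hf.
have [c1 [du1 [su1 [sdu1 data1]]]] := solution_dataP sol1.
have [c2 [du2 [su2 [sdu2 data2]]]] := solution_dataP sol2.
have both : {ae @lebesgue_measure R, forall t, t \in `]0, T[ ->
    solution_at Om g h m dm f u1 K1 c1 du1 su1 sdu1 t /\
    solution_at Om g h m dm f u2 K2 c2 du2 su2 sdu2 t}.
  by apply: (ae_imply (ae_and (data_ae data1) (data_ae data2))) => t [s1 s2] tT; split; [exact: s1|exact: s2].
have [D [mD DT Dsol aeD]] := ae_full_set both.
apply: (solutions_agree oOm bOm hT L0 fL hh homega hmin hm data1 data2 mD DT aeD).
- by move=> t /Dsol[].
- by move=> t /Dsol[].
Qed.
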